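(* Let $\mathcal{E}$ be a Hilbert space, let $\Theta \in H^\infty_{\mathcal{B}(\mathcal{E})}(\mathbb{D})$ be an inner multiplier, let $\mathcal{Q}_\Theta = H^2_{\mathcal{E}}(\mathbb{D}) \ominus \Theta H^2_{\mathcal{E}}(\mathbb{D})$, and let $T$ be a bounded linear operator on $\mathcal{Q}_\Theta$. Assume that $\Theta(e^{i\theta})$ is invertible for almost every $e^{i\theta} \in \mathbb{T}$. Then $S_\Theta^{*} T S_\Theta = T$ if and only if $T = 0$.
   Context: $\mathbb{D}$ is the open unit disc and $\mathbb{T}$ the unit circle. $\mathcal{B}(\mathcal{E})$ denotes the bounded linear operators on $\mathcal{E}$. $H^2_{\mathcal{E}}(\mathbb{D})$ is the $\mathcal{E}$-valued Hardy space over $\mathbb{D}$, and $H^\infty_{\mathcal{B}(\mathcal{E})}(\mathbb{D})$ is the space of bounded holomorphic $\mathcal{B}(\mathcal{E})$-valued functions on $\mathbb{D}$. A function $\Theta \in H^\infty_{\mathcal{B}(\mathcal{E})}(\mathbb{D})$ is an inner multiplier if its radial boundary values (in the strong operator topology) $\Theta(e^{i\theta})$ are isometries on $\mathcal{E}$ for almost every $e^{i\theta} \in \mathbb{T}$; then multiplication by $\Theta$ is an isometry on $H^2_{\mathcal{E}}(\mathbb{D})$. $T_z$ is the operator of multiplication by $z$ on $H^2_{\mathcal{E}}(\mathbb{D})$, $P_{\mathcal{Q}_\Theta}$ is the orthogonal projection of $H^2_{\mathcal{E}}(\mathbb{D})$ onto $\mathcal{Q}_\Theta$, and $S_\Theta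 = P_{\mathcal{Q}_\Theta} T_z|_{\mathcal{Q}_\Theta}$ is the model operator on $\mathcal{Q}_\Theta$. *)

(* Defs.v *)
From HB Require Import structures.
From mathcomp Require Import all_boot all_order all_algebra sesquilinear.
From mathcomp Require Import complex.
From mathcomp Require Import all_classical all_reals all_analysis.

Set Implicit Arguments.
Unset Strict Implicit.
Unset Printing Implicit Defensive.

Import Order.TTheory GRing.Theory Num.Theory.
Import numFieldNormedType.Exports.

Local Open Scope classical_set_scope.
Local Open Scope ring_scope.
Local Open Scope complex_scope.

(* The topology of the complex plane, as the library does for its own fields
   in [numFieldNormedType]. *)
Section ComplexTopology.
Variable R : realType.
#[non_forgetful_inheritance]
HB.instance Definition _ := GRing.ComAlgebra.copy R[i] R[i]^o.
#[non_forgetful_inheritance]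
HB.instance Definition _ := Vector.copy R[i] R[i]^o.
#[non_forgetful_inheritance]
HB.instance Definition _ := NormedModule.copy R[i] R[i]^o.
End ComplexTopology.

Definition expi (R : realType) (t : R) : R[i] := cos t +i* sin t.

(** A complex Hilbert space is a complete normed module over R[i] (whose norm
    takes its values in R[i]) together with an inner product, linear in its
    first argument, that induces the norm. *)
Definition induces_norm (R : realType) (E : completeNormedModType R[i])
    (dot : {dot E for @Num.conj R[i]}) : Prop :=
  forall x : E, `|x| ^+ 2 = dot x x.

(** ** Operator-valued functions on the disc and their boundary values

    An operator-valued function is a total function on R[i]; none of the
    predicates below looks at its values outside the open unit disc. *)

Section OperatorFunctions.
Variables (R : realType) (E : completeNormedModType R[i]).
Implicit Types (Theta : R[i] -> {linear E -> E}) (V W : {linear E -> E}).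

(** Bounded operators are the continuous linear maps.  An inequality
    [`|A x| <= c * `|x|] for all [x] is the operator norm bound [`|A| <= c]. *)

(* Complex differentiability at z for the operator norm. *)
Definition complex_differentiable Theta (z : R[i]) : Prop :=
  exists2 A : {linear E -> E}, continuous A &
    forall e : R, 0 < e -> \forall w \near z, forall x : E,
      `|Theta w x - Theta z x - (w - z) *: A x| <= e%:C * `|w - z| * `|x|.

Definition Hinfty Theta : Prop :=
  (forall z, `|z| < 1 -> complex_differentiable Theta z) /\
  exists M : R, forall z, `|z| < 1 -> forall x : E,
    `|Theta z x| <= M%:C * `|x|.

(* V is the radial limit of Theta at zeta in the strong operator topology. *)
Definition radial_limit Theta (zeta : R[i]) V : Prop :=
  forall x : E, Theta (r%:C * zeta) x @[r --> (1 : R)^'-] --> V x.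

(* Almost everywhere on the circle, for arc length. *)
Definition ae_circle (P : R[i] -> Prop) : Prop :=
  {ae (@lebesgue_measure R), forall t, t \in `[0, 2 * pi] -> P (expi t)}.

Definition isometry_op V : Prop := forall x : E, `|V x| = `|x|.

Definition invertible_op V : Prop :=
  continuous V /\
  exists2 W : {linear E -> E}, continuous W & cancel V W /\ cancel W V.

Definition inner_multiplier Theta : Prop :=
  Hinfty Theta /\
  ae_circle (fun zeta => exists2 V, radial_limit Theta zeta V & isometry_op V).

Definition ae_invertible_boundary Theta : Prop :=
  ae_circle (fun zeta => exists2 V, radial_limit Theta zeta V & invertible_op V).

End OperatorFunctions.

(** ** The vector-valued Hardy space

    An E-valued function on the disc is encoded as a function on R[i] that
    vanishes outside the open unit disc, so that Leibniz equality is equality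
    of functions on the disc. *)

Section HardySpace.
Variables (R : realType) (E : completeNormedModType R[i]).
Variable dot : {dot E for @Num.conj R[i]}.
Implicit Types (f g h : R[i] -> E) (a : nat -> E) (Q : set (R[i] -> E)).

Definition taylor_coefs f a : Prop :=
  forall z : R[i], `|z| < 1 -> series (fun n => z ^+ n *: a n) @ \oo --> f z.

Definition H2 : set (R[i] -> E) :=
  [set f | (forall z, ~~ (`|z| < 1) -> f z = 0) /\
    exists2 a, taylor_coefs f a & cvgn (series (fun n => `|a n| ^+ 2))].

(* Taylor coefficients are unique, so the choice made here is immaterial. *)
Definition coef f : nat -> E := xget (fun=> 0) [set a | taylor_coefs f a].

Definition H2dot f g : R[i] :=
  limn (series (fun n => dot (coef f n) (coef g n))).

Definition H2norm f : R[i] := sqrtC (H2dot f f).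

Definition bounded_operator_on Q (T : (R[i] -> E) -> (R[i] -> E)) : Prop :=
  [/\ forall f, Q f -> Q (T f),
      forall (c : R[i]) f g, Q f -> Q g -> T (c *: f + g) = c *: T f + T g
    & exists M : R, forall f, Q f -> H2norm (T f) <= M%:C * H2norm f].

(** The orthogonal projection onto a closed subspace [Q] of [H2], and the
    adjoint of a bounded operator on [Q], are given by their characteristic
    properties: at most one function satisfies each of them, and one does by
    the projection theorem and by the Riesz representation theorem. *)
Definition orth_proj Q f : R[i] -> E :=
  xget 0 [set g | Q g /\ forall h, Q h -> H2dot (f - g) h = 0].

Definition adjoint_on Q (A : (R[i] -> E) -> (R[i] -> E)) g : R[i] -> E :=
  xget 0 [set h | Q h /\ forall f, Q f -> H2dot (A f) g = H2dot f h].

Definition shift f : R[i] -> E := fun z => z *: f z.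

Variable Theta : R[i] -> {linear E -> E}.

(* Outside the disc, [Theta z (f z) = Theta z 0 = 0]. *)
Definition ThetaH2 : set (R[i] -> E) :=
  [set (fun z => Theta z (f z)) | f in H2].

Definition Qspace : set (R[i] -> E) :=
  [set f | H2 f /\ forall g, ThetaH2 g -> H2dot f g = 0].

Definition model_operator f : R[i] -> E := orth_proj Qspace (shift f).

End HardySpace.

(* Main.v *)
Require Import Defs.
From HB Require Import structures.
From mathcomp Require Import all_boot all_order all_algebra sesquilinear.
From mathcomp Require Import complex.
From mathcomp Require Import all_classical all_reals all_analysis.
From mathcomp Require Import ring lra.

(** Write [S] for the compressed shift of the model space [Q]. If
    [S^* T S = T], then [<h, T f> = <S^n h, T (S^n f)>] for every [n]; since [S]
    is a contraction and [T] is bounded, [T = 0] follows as soon as [S^n f]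
    tends to [0] for all [f] in [Q] (lemma [S_iter_small], theorem
    [fixed_point_eq0]). The space [Q] is invariant under the backward shift, so
    [S^n f] is the projection of [z^n f] to [Q], and it tends to [0] when the
    distance of [z^n f] to [Theta H2] does. By density this only has to be seen
    for a constant [f = x].

    Let [Theta z] be the sum of [z^k Theta_k], and let [p_n] be the adjoint of
    multiplication by [Theta] applied to [z^n x], that is the polynomial
    [\sum_(k <= n) z^(n - k) Theta_k^* x]. Then
    [[
      |z^n x - Theta p_n|^2 = |x|^2 - 2 |p_n|^2 + |Theta p_n|^2
                           <= |x|^2 - \sum_(k <= n) |Theta_k^* x|^2
    ]]
    (lemma [Q_dot_coef]), and the right-hand side tends to [0], because of two
    facts about boundary values. First, [Theta] does not increase the norm of
    a polynomial, its boundary values being isometries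
    ([mulcoef_contraction]). Second, the boundary values are isometric and
    invertible, hence unitary, so that [Theta(r zeta)^* x] tends weakly to a
    vector of norm [|x|] as [r] tends to [1], and therefore
    [|x|^2 <= \sum_k |Theta_k^* x|^2] ([adjoint_coefs_lower]). Both follow from
    Parseval's identity for trigonometric polynomials and bounded convergence
    on the circle.

    The Taylor expansion of [Theta], which is only assumed to be complex
    differentiable, comes from Goursat's theorem. In logarithmic polar
    coordinates an annulus is a rectangle, and Goursat's bisection argument
    says that the mean of a holomorphic function over a circle does not depend
    on the radius ([goursat_Re], [cmean_annulus]). Applied to difference
    quotients this yields the Taylor series of bounded scalar functions
    ([scalar_taylor]); the coefficients of vector-valued functions, and the
    adjoints [Theta_k^*], are then given by the Riesz representation theorem
    ([holomorphic_taylor], [Hinfty_adjoint_coefs]).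

    Conversely, [T = 0] solves the equation because the adjoint of [S] maps [0]
    to [0] ([zero_is_fixed_point]). *)

Set Implicit Arguments.
Unset Strict Implicit.
Unset Printing Implicit Defensive.

Import Order.TTheory GRing.Theory Num.Theory.
Import numFieldNormedType.Exports.

Local Open Scope classical_set_scope.
Local Open Scope ring_scope.
Local Open Scope complex_scope.

(** * Integrals of continuous functions over a segment *)

Section SegmentIntegral.
Variable R : realType.
Implicit Types (a b c : R) (f g : R -> R).

Definition segint a b f : R := \int[@lebesgue_measure R]_(x in `[a, b]) f x.

Lemma segment_integrable a b f : {in `[a, b], continuous f} ->
  (@lebesgue_measure R).-integrable `[a, b] (EFin \o f).
Proof.
move=> cf; apply: continuous_compact_integrable; first exact: segment_compact.
by apply: continuous_in_subspaceT => x; rewrite inE/= => /cf.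
Qed.

Lemma segintB a b f g : {in `[a, b], continuous f} ->
  {in `[a, b], continuous g} ->
  segint a b (fun x => f x - g x) = segint a b f - segint a b g.
Proof.
by move=> cf cg; rewrite /segint RintegralB//; exact: segment_integrable.
Qed.

Lemma segintD a b f g : {in `[a, b], continuous f} ->
  {in `[a, b], continuous g} ->
  segint a b (fun x => f x + g x) = segint a b f + segint a b g.
Proof.
by move=> cf cg; rewrite /segint RintegralD//; exact: segment_integrable.
Qed.

Lemma segintZ a b c f : {in `[a, b], continuous f} ->
  segint a b (fun x => c * f x) = c * segint a b f.
Proof.
by move=> cf; rewrite /segint RintegralZl//; exact: segment_integrable.
Qed.

Lemma segint_cst a b c : a <= b -> segint a b (fun=> c) = c * (b - a).
Proof.
move=> ab; rewrite /segint Rintegral_cst//=; congr (_ * _).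
by rewrite lebesgue_measure_itv/= lte_fin; case: ltgtP ab => //= -> _; rewrite subrr.
Qed.

Lemma eq_segint a b f g : {in `[a, b], f =1 g} -> segint a b f = segint a b g.
Proof. by move=> fg; apply: eq_Rintegral => x; rewrite inE => /fg. Qed.

Lemma le_segint a b f g : {in `[a, b], continuous f} ->
  {in `[a, b], continuous g} -> {in `[a, b], forall x, f x <= g x} ->
  segint a b f <= segint a b g.
Proof.
by move=> cf cg fg; apply: le_Rintegral => //; exact: segment_integrable.
Qed.

Lemma segint_le_bound a b c f : a <= b -> {in `[a, b], continuous f} ->
  {in `[a, b], forall x, `|f x| <= c} -> `|segint a b f| <= c * (b - a).
Proof.
move=> ab cf fc; rewrite ler_norml -mulNr -!segint_cst//; apply/andP; split.
  by apply: le_segint => // [x _|x /fc]; [exact: cst_continuous|rewrite ler_norml => /andP[]].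
by apply: le_segint => // [x _|x /fc]; [exact: cst_continuous|rewrite ler_norml => /andP[]].
Qed.

Lemma segint_split a b c f : a <= c -> c <= b -> {in `[a, b], continuous f} ->
  segint a b f = segint a c f + segint c b f.
Proof.
move=> ac cb cf; rewrite -[RHS]addrC; apply/eqP; rewrite -subr_eq; apply/eqP.
rewrite /segint Rintegral_itvB ?bnd_simp//; last exact: segment_integrable.
rewrite Rintegral_itv_obnd_cbnd//.
apply: (integrableS _ _ _ (segment_integrable cf)) => //.
by apply: subset_itv; rewrite ?bnd_simp.
Qed.

(** The passage to the limit [r --> 1] under integrals over the circle, and the
    crossing of an exceptional circle, both go through this form of dominated
    convergence. *)
Lemma bounded_convergence a b (C : R) (f_ : nat -> R -> R) f :
  (forall n, {in `[a, b], continuous (f_ n)}) -> {in `[a, b], continuous f} ->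
  (forall n, {in `[a, b], forall x, `|f_ n x| <= C}) ->
  {ae (@lebesgue_measure R),
    forall x, x \in `[a, b] -> f_ n x @[n --> \oo] --> f x} ->
  segint a b (f_ n) @[n --> \oo] --> segint a b f.
Proof.
move=> cf_ cf bf aef.
have itf := segment_integrable cf.
have [||||||_ _] := @dominated_convergence _ _ _ (@lebesgue_measure R) `[a, b]
  _ (fun n => EFin \o f_ n) (EFin \o f) (EFin \o (fun=> C)).
- by [].
- by move=> n; have /integrableP[] := segment_integrable (cf_ n).
- by have /integrableP[] := itf.
- have aeF := ae_filter_ringOfSetsType (@lebesgue_measure R).
  apply: (@filterS _ _ aeF _ _ _ aef) => x fx xab.
  by apply: cvg_EFin; [exact: nearW|exact: fx].
- by apply: segment_integrable => x _; exact: cst_continuous.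
- by apply: aeW => x n xab /=; rewrite lee_fin bf.
rewrite -[X in _ --> X -> _]fineK; first by move=> /fine_cvgP[_].
by apply: integrable_fin_num => //; exact: itf.
Qed.

End SegmentIntegral.

(** * Bisection of rectangles *)

Section Bisection.
Variable R : realType.
Implicit Types (s t : R) (Phi : R -> R -> R -> R -> R).

Lemma exists_half_power_lt (W d : R) : 0 < d -> exists n, W / 2 ^+ n < d.
Proof.
move=> d0; pose n := Num.bound `|W / d|; exists n.
rewrite ltr_pdivrMr ?exprn_gt0// mulrC -ltr_pdivrMr//.
apply: le_lt_trans (ler_norm _) _.
apply: lt_trans (archi_boundP (normr_ge0 _)) _.
by rewrite -natrX ltr_nat ltn_expl.
Qed.

(** Goursat's argument, abstracted from contour integrals. Repeated bisection
    gives nested rectangles, the [n]-th of which carries at least the part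
    [4 ^- n] of [`|Phi S1 S2 T1 T2|], while the estimate at their common point
    makes this part small compared with [4 ^- n]. *)
Lemma additive_rectangle_eq0 Phi (S1 S2 T1 T2 : R) : S1 <= S2 -> T1 <= T2 ->
  (forall s1 s s2 t1 t2, S1 <= s1 -> s1 <= s -> s <= s2 -> s2 <= S2 ->
    T1 <= t1 -> t1 <= t2 -> t2 <= T2 ->
    Phi s1 s2 t1 t2 = Phi s1 s t1 t2 + Phi s s2 t1 t2) ->
  (forall s1 s2 t1 t t2, S1 <= s1 -> s1 <= s2 -> s2 <= S2 ->
    T1 <= t1 -> t1 <= t -> t <= t2 -> t2 <= T2 ->
    Phi s1 s2 t1 t2 = Phi s1 s2 t1 t + Phi s1 s2 t t2) ->
  (forall s t (e : R), S1 <= s <= S2 -> T1 <= t <= T2 -> 0 < e ->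
    exists2 d : R, 0 < d & forall s1 s2 t1 t2,
      S1 <= s1 <= s -> s <= s2 <= S2 -> T1 <= t1 <= t -> t <= t2 <= T2 ->
      s2 - s1 < d -> t2 - t1 < d ->
      `|Phi s1 s2 t1 t2| <= e * ((s2 - s1) + (t2 - t1)) ^+ 2) ->
  Phi S1 S2 T1 T2 = 0.
Proof.
move=> S12 T12 addS addT small.
pose W := S2 - S1; pose H := T2 - T1.
have W0 : 0 <= W by rewrite subr_ge0.
have H0 : 0 <= H by rewrite subr_ge0.
pose w n := W / 2 ^+ n; pose h n := H / 2 ^+ n.
have w0 n : 0 <= w n by rewrite divr_ge0// exprn_ge0.
have h0 n : 0 <= h n by rewrite divr_ge0// exprn_ge0.
have wS n : w n = w n.+1 + w n.+1.
  by rewrite /w exprS invfM; field; rewrite lt0r_neq0// exprn_gt0.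
have hS n : h n = h n.+1 + h n.+1.
  by rewrite /h exprS invfM; field; rewrite lt0r_neq0// exprn_gt0.
pose area (n : nat) (q : R * R) := `|Phi q.1 (q.1 + w n) q.2 (q.2 + h n)| : R.
pose inK (n : nat) (q : R * R) :=
  [/\ S1 <= q.1, q.1 + w n <= S2, T1 <= q.2 & q.2 + h n <= T2].
(* A rectangle is given by its lower corner [q] and its generation [n]. One of
   its four quarters carries a quarter of the value of [Phi]. *)
have step (x : nat * (R * R)) : exists y : R * R, inK x.1 x.2 ->
    [/\ inK x.1.+1 y, area x.1 x.2 <= 4 * area x.1.+1 y,
        x.2.1 <= y.1 /\ y.1 + w x.1.+1 <= x.2.1 + w x.1 &
        x.2.2 <= y.2 /\ y.2 + h x.1.+1 <= x.2.2 + h x.1].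
  case: x => n [a b] /=.
  have [[/= a1 a2 b1 b2]|] := pselect (inK n (a, b)); last first.
    by move=> nK; exists (a, b).
  have wn := w0 n.+1; have hn := h0 n.+1.
  move: a2 b2; rewrite wS hS !addrA => a2 b2.
  pose a' := a + w n.+1; pose b' := b + h n.+1.
  have E : Phi a (a' + w n.+1) b (b' + h n.+1) =
      (Phi a a' b b' + Phi a a' b' (b' + h n.+1)) +
      (Phi a' (a' + w n.+1) b b' + Phi a' (a' + w n.+1) b' (b' + h n.+1)).
    rewrite (addS _ a') 1?(addT a a' b b') 1?(addT a' _ b b')//;
      rewrite /a' /b'; lra.
  have K1 : inK n.+1 (a, b) by split => //=; lra.
  have K2 : inK n.+1 (a, b') by split => //=; rewrite ?/b'; lra.
  have K3 : inK n.+1 (a', b) by split => //=; rewrite ?/a'; lra.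
  have K4 : inK n.+1 (a', b') by split => //=; rewrite ?/a' ?/b'; lra.
  have L : area n (a, b) <= (area n.+1 (a, b) + area n.+1 (a, b')) +
      (area n.+1 (a', b) + area n.+1 (a', b')).
    rewrite /area /= wS hS (addrA a) (addrA b) -/a' -/b' E.
    by apply: le_trans (ler_normD _ _) _; apply: lerD; exact: ler_normD.
  have [l1|?] := ltP (4 * area n.+1 (a, b)) (area n (a, b)); last first.
    by exists (a, b); split => //=; split; lra.
  have [l2|?] := ltP (4 * area n.+1 (a, b')) (area n (a, b)); last first.
    by exists (a, b'); split => //=; split; rewrite ?/b'; lra.
  have [l3|?] := ltP (4 * area n.+1 (a', b)) (area n (a, b)); last first.
    by exists (a', b); split => //=; split; rewrite ?/a'; lra.
  exists (a', b'); split => //=; last 2 first.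
  - by split; rewrite ?/a'; lra.
  - by split; rewrite ?/b'; lra.
  - by lra.
have [next nextP] := choice step.
pose q := fix q n := if n is m.+1 then next (m, q m) else (S1, T1).
have qK n : inK n (q n).
  elim: n => [|n IH] /=; last by have [] := nextP (n, q n) IH.
  by split; rewrite /= /w /h ?expr0 ?divr1 /W /H; lra.
have area0 n : area 0 (q 0) <= 4 ^+ n * area n (q n).
  elim: n => [|n IH]; first by rewrite expr0 mul1r.
  apply: le_trans IH _; rewrite exprSr -mulrA ler_wpM2l ?exprn_ge0//.
  by have [] := nextP (n, q n) (qK n).
have lo n m : (q n).1 <= (q (n + m)%N).1 /\ (q n).2 <= (q (n + m)%N).2.
  elim: m => [|m [IH1 IH2]]; first by rewrite addn0.
  rewrite addnS /=; have [_ _ [? _] [? _]] := nextP (_, q (n + m)%N) (qK _).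
  by split; [apply: le_trans IH1 _|apply: le_trans IH2 _].
have hi n m : (q (n + m)%N).1 + w (n + m)%N <= (q n).1 + w n /\
    (q (n + m)%N).2 + h (n + m)%N <= (q n).2 + h n.
  elim: m => [|m [IH1 IH2]]; first by rewrite addn0.
  rewrite addnS /=; have [_ _ [_ ?] [_ ?]] := nextP (_, q (n + m)%N) (qK _).
  by split; [apply: le_trans IH1|apply: le_trans IH2].
have ub n m : (q n).1 <= (q m).1 + w m /\ (q n).2 <= (q m).2 + h m.
  have [[? ?] [H1 H2]] := (lo n m, hi m n).
  have H3 := w0 (m + n)%N; have H4 := h0 (m + n)%N.
  by rewrite (addnC m n) in H1 H2 H3 H4; split; lra.
pose s := sup (range (fun n => (q n).1)); pose t := sup (range (fun n => (q n).2)).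
have sP n : (q n).1 <= s <= (q n).1 + w n.
  apply/andP; split.
    apply: ub_le_sup; last by exists n.
    by exists ((q 0).1 + w 0) => _ [m _ <-]; have [] := ub m 0%N.
  apply: ge_sup; first by exists (q 0).1; exists 0%N.
  by move=> _ [m _ <-]; have [] := ub m n.
have tP n : (q n).2 <= t <= (q n).2 + h n.
  apply/andP; split.
    apply: ub_le_sup; last by exists n.
    by exists ((q 0).2 + h 0) => _ [m _ <-]; have [] := ub m 0%N.
  apply: ge_sup; first by exists (q 0).2; exists 0%N.
  by move=> _ [m _ <-]; have [] := ub m n.
have sK : S1 <= s <= S2.
  have /andP[? ?] := sP 0%N; have [/= ? ? _ _] := qK 0%N.
  by apply/andP; split; [apply: le_trans (_ : (q 0%N).1 <= _)|apply: le_trans (_ : _ <= (q 0%N).1 + w 0%N) _].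
have tK : T1 <= t <= T2.
  have /andP[? ?] := tP 0%N; have [/= _ _ ? ?] := qK 0%N.
  by apply/andP; split; [apply: le_trans (_ : (q 0%N).2 <= _)|apply: le_trans (_ : _ <= (q 0%N).2 + h 0%N) _].
have bound e : 0 < e -> `|Phi S1 S2 T1 T2| <= e * (W + H) ^+ 2.
  move=> e0; have [d d0 dP] := small s t e sK tK e0.
  have [n nd] := exists_half_power_lt (W + H) d0.
  have p0 : 0 < 2 ^+ n :> R by rewrite exprn_gt0.
  have wd : w n < d.
    by apply: le_lt_trans nd; rewrite ler_pM2r ?invr_gt0// lerDl.
  have hd : h n < d.
    by apply: le_lt_trans nd; rewrite ler_pM2r ?invr_gt0// lerDr.
  have [? ? ? ?] := qK n; have /andP[? ?] := sP n; have /andP[? ?] := tP n.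
  have := area0 n; rewrite /area /= {1 2}/w {1 2}/h expr0 !divr1.
  rewrite /W /H [S1 + _]addrC subrK [T1 + _]addrC subrK -/W -/H => /le_trans; apply.
  have : area n (q n) <= e * (w n + h n) ^+ 2.
    have -> : w n + h n = ((q n).1 + w n - (q n).1) + ((q n).2 + h n - (q n).2).
      by ring.
    by apply: dP; rewrite ?(addrAC _ (w n)) ?(addrAC _ (h n)) ?subrr ?add0r;
      [apply/andP; split.. | | ].
  rewrite -(ler_pM2l (exprn_gt0 n (ltr0n R 4))) => /le_trans; apply.
  rewrite /w /h -mulrDl exprMn exprVn -exprM [(n * 2)%N]mulnC exprM.
  have -> : 2 ^+ 2 = 4 :> R by rewrite -natrX.
  by rewrite [e * _]mulrA mulrCA divff ?mulr1// expf_neq0.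
apply/eqP; rewrite -normr_le0; apply/ler_addgt0Pl => e e0; rewrite addr0.
pose c := (W + H) ^+ 2 + 1.
have c0 : 0 < c by rewrite /c ltr_wpDl ?sqr_ge0.
apply: (le_trans (bound (e / c) _)); first by rewrite divr_gt0.
by rewrite mulrAC ler_pdivrMr// ler_pM2l// /c lerDl.
Qed.

End Bisection.

(** * Real norms in complex normed spaces *)

Section RealNorm.
Variables (R : realType) (V : normedModType R[i]).
Implicit Types (x y : V).

(** [`|x|] lives in [R[i]], whose order is only partial; all estimates are made
    with its real part. *)
Definition rnorm x : R := complex.Re `|x|.

Lemma rnormE x : `|x| = (rnorm x)%:C.
Proof. by rewrite /rnorm RRe_real// normr_real. Qed.

Lemma rnorm_ge0 x : 0 <= rnorm x.
Proof. by rewrite -ler0c -rnormE normr_ge0. Qed.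

Lemma rnorm0 : rnorm (0 : V) = 0.
Proof. by rewrite /rnorm normr0. Qed.

Lemma rnorm_eq0 x : (rnorm x == 0) = (x == 0).
Proof. by rewrite -(normr_eq0 x) rnormE eq_complex/= eqxx andbT. Qed.

Lemma rnormN x : rnorm (- x) = rnorm x.
Proof. by rewrite /rnorm normrN. Qed.

Lemma rnormC x y : rnorm (x - y) = rnorm (y - x).
Proof. by rewrite /rnorm distrC. Qed.

Lemma rnormD x y : rnorm (x + y) <= rnorm x + rnorm y.
Proof. by rewrite -lecR rmorphD/= -!rnormE ler_normD. Qed.

Lemma rnormB x y : rnorm (x - y) <= rnorm x + rnorm y.
Proof. by rewrite -(rnormN y) rnormD. Qed.

Lemma rnorm_dist x y z : rnorm (x - y) <= rnorm (x - z) + rnorm (z - y).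
Proof. by rewrite (le_trans _ (rnormD _ _))// addrA subrK. Qed.

Lemma rnorm_sum (I : Type) (s : seq I) (P : pred I) (F : I -> V) :
  rnorm (\sum_(i <- s | P i) F i) <= \sum_(i <- s | P i) rnorm (F i).
Proof.
elim/big_rec2: _ => [|i a b _ h]; first by rewrite rnorm0.
by apply: le_trans (rnormD _ _) _; rewrite lerD2l.
Qed.

Lemma cvg_rnormP (T : Type) (F : set_system T) (FF : Filter F) (f : T -> V) x :
  f t @[t --> F] --> x <-> rnorm (f t - x) @[t --> F] --> (0 : R).
Proof.
split=> [/cvgrPdist_lt fx|fx].
  apply/cvgrPdist_lt => e e0.
  have e0' : 0 < e%:C by rewrite ltcR.
  apply: filterS (fx _ e0') => t.
  by rewrite rnormE ltcR sub0r normrN ger0_norm ?rnorm_ge0// rnormC.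
apply/cvgrPdist_lt => e e0.
have eE : e = (complex.Re e)%:C by rewrite RRe_real// gtr0_real.
move: e0; rewrite eE ltcR => e0.
move/cvgrPdist_lt : fx => /(_ _ e0); apply: filterS => t.
by rewrite sub0r normrN ger0_norm ?rnorm_ge0// rnormE ltcR rnormC.
Qed.

Lemma cvg_rnorm (T : Type) (F : set_system T) (FF : Filter F) (f : T -> V) x :
  f t @[t --> F] --> x -> rnorm (f t) @[t --> F] --> rnorm x.
Proof.
move=> /cvg_rnormP fx; apply/cvgrPdist_lt => e e0.
move/cvgrPdist_lt : fx => /(_ _ e0); apply: filterS => t.
rewrite sub0r normrN ger0_norm ?rnorm_ge0//; apply: le_lt_trans.
rewrite ler_norml; have := rnormD (f t - x) x; have := rnormD (x - f t) (f t).
by rewrite !subrK (rnormC x); lra.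
Qed.

Lemma near_rnormP x (P : set V) :
  (\forall y \near x, P y) <->
  exists2 d : R, 0 < d & forall y, rnorm (y - x) < d -> P y.
Proof.
split=> [/nbhs_normP[e /= e0 eP]|[d d0 dP]].
  have eE : e = (complex.Re e)%:C by rewrite RRe_real// gtr0_real.
  move: e0 eP; rewrite eE ltcR => e0 eP; exists (complex.Re e) => // y ye.
  by apply: eP; rewrite /ball_/= rnormE ltcR rnormC.
apply/nbhs_normP; exists d%:C => /=; first by rewrite ltcR.
by move=> y; rewrite /ball_/= rnormE ltcR rnormC; exact: dP.
Qed.

End RealNorm.
Arguments rnorm {R V} x.

Section ComplexNorm.
Variable R : realType.
Implicit Types (c d z : R[i]) (r : R).

Lemma rnormZ (V : normedModType R[i]) c (x : V) :
  rnorm (c *: x) = rnorm c * rnorm x.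
Proof.
apply: complexI; rewrite rmorphM/= -!rnormE.
exact: (@normrZ R[i] V c x).
Qed.

Lemma rnormM c d : rnorm (c * d) = rnorm c * rnorm d.
Proof. exact: rnormZ. Qed.

Lemma rnorm_real r : rnorm r%:C = `|r|.
Proof.
by rewrite /rnorm normc_def/= expr0n addr0 sqrtr_sqr.
Qed.

Lemma rnorm1 : rnorm (1 : R[i]) = 1.
Proof. by rewrite (_ : 1 = 1%:C)// rnorm_real normr1. Qed.

Lemma rnormX c n : rnorm (c ^+ n) = rnorm c ^+ n.
Proof. by elim: n => [|n IH]; rewrite ?expr0 ?rnorm1// !exprS rnormM IH. Qed.

Lemma rnormV c : rnorm c^-1 = (rnorm c)^-1.
Proof.
have [->|c0] := eqVneq c 0; first by rewrite invr0 rnorm0 invr0.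
have n0 : rnorm c != 0 by rewrite rnorm_eq0.
by apply: (mulfI n0); rewrite -rnormM !divff// rnorm1.
Qed.

Lemma sqr_rnorm c : rnorm c ^+ 2 = complex.Re c ^+ 2 + complex.Im c ^+ 2.
Proof.
by rewrite /rnorm normc_def/= sqr_sqrtr// addr_ge0 ?sqr_ge0.
Qed.

Lemma rnorm_conj c : rnorm c^* = rnorm c.
Proof. by rewrite /rnorm normcJ. Qed.

Lemma normRe_le c : `|complex.Re c| <= rnorm c.
Proof.
rewrite -(@ler_pXn2r _ 2)// ?nnegrE ?rnorm_ge0//.
by rewrite real_normK ?num_real// sqr_rnorm lerDl sqr_ge0.
Qed.

Lemma normIm_le c : `|complex.Im c| <= rnorm c.
Proof.
rewrite -(@ler_pXn2r _ 2)// ?nnegrE ?rnorm_ge0//.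
by rewrite real_normK ?num_real// sqr_rnorm lerDr sqr_ge0.
Qed.

Lemma Re_le_rnorm c : complex.Re c <= rnorm c.
Proof. exact: le_trans (ler_norm _) (normRe_le c). Qed.

Lemma rnorm_le_ReIm c : rnorm c <= `|complex.Re c| + `|complex.Im c|.
Proof.
rewrite -(@ler_pXn2r _ 2)// ?nnegrE ?rnorm_ge0 ?addr_ge0//.
rewrite sqr_rnorm sqrrD !real_normK ?num_real// lerD2r lerDl.
by rewrite mulrn_wge0// mulr_ge0.
Qed.

Lemma Re_add c d : complex.Re (c + d) = complex.Re c + complex.Re d.
Proof. by case: c; case: d. Qed.
Lemma Im_add c d : complex.Im (c + d) = complex.Im c + complex.Im d.
Proof. by case: c; case: d. Qed.
Lemma Re_opp c : complex.Re (- c) = - complex.Re c.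
Proof. by case: c. Qed.
Lemma Im_opp c : complex.Im (- c) = - complex.Im c.
Proof. by case: c. Qed.
Lemma Re_sub c d : complex.Re (c - d) = complex.Re c - complex.Re d.
Proof. by rewrite Re_add Re_opp. Qed.
Lemma Im_sub c d : complex.Im (c - d) = complex.Im c - complex.Im d.
Proof. by rewrite Im_add Im_opp. Qed.
Lemma Re_mul c d : complex.Re (c * d) =
  complex.Re c * complex.Re d - complex.Im c * complex.Im d.
Proof. by case: c; case: d. Qed.
Lemma Im_mul c d : complex.Im (c * d) =
  complex.Re c * complex.Im d + complex.Im c * complex.Re d.
Proof. by case: c; case: d. Qed.

Lemma cvg_Re (T : Type) (F : set_system T) (FF : Filter F) (f : T -> R[i]) c :
  f t @[t --> F] --> c -> complex.Re (f t) @[t --> F] --> complex.Re c.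
Proof.
move=> /cvg_rnormP /cvgrPdist_lt fx; apply/cvgrPdist_lt => e e0.
apply: filterS (fx _ e0) => t; rewrite sub0r normrN ger0_norm ?rnorm_ge0//.
by apply: le_lt_trans; rewrite -Re_sub rnormC normRe_le.
Qed.

Lemma cvg_Im (T : Type) (F : set_system T) (FF : Filter F) (f : T -> R[i]) c :
  f t @[t --> F] --> c -> complex.Im (f t) @[t --> F] --> complex.Im c.
Proof.
move=> /cvg_rnormP /cvgrPdist_lt fx; apply/cvgrPdist_lt => e e0.
apply: filterS (fx _ e0) => t; rewrite sub0r normrN ger0_norm ?rnorm_ge0//.
by apply: le_lt_trans; rewrite -Im_sub rnormC normIm_le.
Qed.

Lemma cvg_ReIm (T : Type) (F : set_system T) (FF : Filter F) (f : T -> R[i]) c :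
  complex.Re (f t) @[t --> F] --> complex.Re c ->
  complex.Im (f t) @[t --> F] --> complex.Im c -> f t @[t --> F] --> c.
Proof.
move=> fr fi; apply/cvg_rnormP.
apply: (@squeeze_cvgr _ _ _ _ (cst 0)
  (fun t => `|complex.Re c - complex.Re (f t)| + `|complex.Im c - complex.Im (f t)|)).
- by apply: nearW => t; rewrite rnorm_ge0 rnormC -Re_sub -Im_sub rnorm_le_ReIm.
- exact: cvg_cst.
- rewrite -[X in _ --> X]addr0; apply: cvgD.
    by rewrite -(normr0 R) -(subrr (complex.Re c)); apply: cvg_norm; apply: cvgB => //; exact: cvg_cst.
  by rewrite -(normr0 R) -(subrr (complex.Im c)); apply: cvg_norm; apply: cvgB => //; exact: cvg_cst.
Qed.

End ComplexNorm.

(** * Differentiability through slopes *)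

Section Slope.
Variable K : numFieldType.
Implicit Types (f g : K -> K) (x : K).

(** Carathéodory's form of differentiability: the chain, product and quotient
    rules become continuity of explicit slope functions. *)
Definition has_slope f x :=
  exists2 g : K -> K, {for x, continuous g} & forall y : K, f y - f x = (y - x) * g y.

Definition slope f x (df : K) y := if y == x then df else (f y - f x) / (y - x).

Lemma slopeE f x df y : f y - f x = (y - x) * slope f x df y.
Proof.
rewrite /slope; case: eqVneq => [->|yx]; first by rewrite !subrr mul0r.
by rewrite mulrC divfK// subr_eq0.
Qed.

Lemma continuous_cst_at (c : K) x : {for x, continuous (fun=> c : K)}.
Proof. by move: x; exact: cst_continuous. Qed.

Lemma continuous_id_at x : {for x, continuous (id : K -> K)}.
Proof. by move=> A. Qed.

Lemma has_slope_continuous f x : has_slope f x -> {for x, continuous f}.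
Proof.
move=> [g cg fg].
have -> : f = (fun=> f x) + (fun y => (y - x) * g y).
  by apply/funext => y; rewrite /= -[LHS](subrK (f x)) fg addrC.
apply: continuousD; first exact: continuous_cst_at.
apply: (@continuousM _ _ (fun y => y - x)) => //.
by apply: continuousB; [exact: continuous_id_at|exact: continuous_cst_at].
Qed.

Lemma has_slope_cst c x : has_slope (fun=> c) x.
Proof.
exists (fun=> 0) => [|y]; first exact: continuous_cst_at.
by rewrite subrr mulr0.
Qed.

Lemma has_slope_id x : has_slope id x.
Proof.
by exists (fun=> 1) => [|y]; [exact: continuous_cst_at|rewrite mulr1].
Qed.

Lemma has_slopeB f g x : has_slope f x -> has_slope g x ->
  has_slope (fun y => f y - g y) x.
Proof.
move=> [f' cf fE] [g' cg gE]; exists (f' - g'); first exact: continuousB.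
by move=> y; rewrite [X in _ * X](_ : _ = f' y - g' y)// mulrBr -fE -gE; ring.
Qed.

Lemma has_slopeM f g x : has_slope f x -> has_slope g x ->
  has_slope (fun y => f y * g y) x.
Proof.
move=> [f' cf fE] gx; have cg := has_slope_continuous gx; case: gx => g' cg' gE.
exists ((f' \* g) + ((fun=> f x) \* g')).
  apply: continuousD; first exact: continuousM.
  by apply: continuousM => //; exact: continuous_cst_at.
move=> y; change (f y * g y - f x * g x = (y - x) * (f' y * g y + f x * g' y)).
have e1 : f y = f x + (y - x) * f' y by rewrite -fE; ring.
have e2 : g y = g x + (y - x) * g' y by rewrite -gE; ring.
by rewrite e1 e2; ring.
Qed.

Lemma has_slopeX f n x : has_slope f x -> has_slope (fun y => f y ^+ n) x.
Proof.
move=> fx; elim: n => [|n IH].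
  by under eq_fun do rewrite expr0; exact: has_slope_cst.
by under eq_fun do rewrite exprS; exact: has_slopeM.
Qed.

Lemma has_slopeV f x : f x != 0 -> has_slope f x ->
  has_slope (fun y => (f y)^-1) x.
Proof.
move=> fx0 sf; have cf := has_slope_continuous sf; case: sf => f' cf' fE.
exists (fun y => if f y == 0 then f' y / f x ^+ 2 else - f' y / (f x * f y)).
  have c : {for x, continuous
      ((fun y => - f' y) \* (fun y => (f x * f y)^-1))}.
    apply: continuousM; first exact: continuousN.
    apply: (@continuousV _ _ ((fun=> f x) \* f)); first by rewrite mulf_neq0.
    by apply: continuousM => //; exact: continuous_cst_at.
  move: c; rewrite /prop_for/continuous_at (negPf fx0); apply: cvg_trans.
  apply: (@near_eq_cvg _ _ (nbhs x)).
  have nz : \forall y \near x, f y != 0 by move/cvgr_neq0 : cf; exact.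
  by apply: filterS nz => y /negPf ->.
move=> y; have e : (y - x) * f' y = f y - f x by rewrite fE.
case: eqVneq => [fy0|fy0].
  by rewrite (mulrA (y - x)) e fy0 invr0; field.
by rewrite mulNr mulrN (mulrA (y - x)) e; field; apply/andP.
Qed.

Lemma has_slope_comp f h x : has_slope h x -> has_slope f (h x) ->
  has_slope (f \o h) x.
Proof.
move=> sh; have ch := has_slope_continuous sh; case: sh => h' ch' hE.
move=> [f' cf' fE]; exists (h' \* (f' \o h)).
  by apply: continuousM => //; exact: continuous_comp.
by move=> y /=; rewrite fE hE mulrA.
Qed.

Lemma derive_slope_continuous f x df : is_derive x 1 f df ->
  {for x, continuous (slope f x df)}.
Proof.
move=> [dfx dfE]; apply/continuous_withinNshiftx.
rewrite /= {2}/slope eqxx.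
have : h^-1 *: ((f \o shift x) (h *: 1) - f x) @[h --> 0^'] --> df.
  by rewrite -dfE; exact: dfx.
apply: cvg_trans; apply: near_eq_cvg; near=> h => /=.
have h0 : h != 0 by near: h; exact: nbhs_dnbhs_neq.
rewrite /slope -subr_eq0 addrK (negPf h0) /shift/=.
by rewrite mulrC /GRing.scale/= mulr1.
Unshelve. all: by end_near. Qed.

End Slope.

(** * Complex differentiability and the exponential *)

Section ComplexSlope.
Variable R : realType.
Implicit Types (f G : R[i] -> R[i]) (x w A : R[i]) (e d s t : R).

Lemma approx_has_slope f x A :
  (forall e, 0 < e -> exists2 d, 0 < d & forall y, rnorm (y - x) < d ->
    rnorm (f y - f x - (y - x) * A) <= e * rnorm (y - x)) ->
  has_slope f x.
Proof.
move=> H; exists (slope f x A); last by move=> y; exact: slopeE.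
rewrite /prop_for/continuous_at {2}/slope eqxx.
move=> P /near_rnormP[e e0 eP]; apply/near_rnormP.
have e20 : 0 < e / 2 by rewrite divr_gt0.
have [d d0 dP] := H _ e20; exists d => // y yd; apply: eP.
rewrite /slope; case: eqVneq => [_|yx]; first by rewrite subrr rnorm0.
have yx0 : 0 < rnorm (y - x).
  by rewrite lt_neqAle rnorm_ge0 andbT eq_sym rnorm_eq0 subr_eq0.
have -> : (f y - f x) / (y - x) - A = (f y - f x - (y - x) * A) / (y - x).
  by field; rewrite subr_eq0.
rewrite rnormM rnormV ltr_pdivrMr//; apply: le_lt_trans (dP _ yd) _.
by rewrite ltr_pM2r// ltr_pdivrMr// mulr_natr mulr2n ltrDl.
Qed.

Lemma has_slope_approx f x : has_slope f x -> exists A,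
  forall e, 0 < e -> exists2 d, 0 < d & forall y, rnorm (y - x) < d ->
    rnorm (f y - f x - (y - x) * A) <= e * rnorm (y - x).
Proof.
move=> [g cg fg]; exists (g x) => e e0.
have /cg/near_rnormP[d d0 dP] : \forall z \near g x, rnorm (z - g x) < e.
  by apply/near_rnormP; exists e.
exists d => // y yd; rewrite fg -mulrBr rnormM mulrC ler_wpM2r ?rnorm_ge0//.
exact/ltW/dP.
Qed.

Lemma real_slope_approx (f : R -> R) (df : R) : is_derive (0 : R) (1 : R) f df ->
  forall e, 0 < e -> exists2 d, 0 < d & forall y, `|y| < d ->
    `|f y - f 0 - y * df| <= e * `|y|.
Proof.
move=> /derive_slope_continuous; rewrite /prop_for/continuous_at {2}/slope eqxx.
move=> /cvgrPdist_lt H e e0; have := H e e0 => /nbhs_normP[d /= d0 dP].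
exists d => // y yd.
have -> : f y - f 0 - y * df = y * (slope f 0 df y - df).
  by rewrite (slopeE _ _ df) subr0 mulrBr.
rewrite normrM mulrC ler_wpM2r// distrC ltW//.
by apply: dP; rewrite /ball_/= sub0r normrN.
Qed.

Definition cexp (w : R[i]) : R[i] :=
  (expR (complex.Re w))%:C * expi (complex.Im w).

Lemma expiD s t : expi (s + t) = expi s * expi t :> R[i].
Proof. by rewrite /expi cosD sinD /=; congr (_ +i* _); rewrite addrC. Qed.

Lemma expi0 : expi 0 = 1 :> R[i].
Proof. by rewrite /expi cos0 sin0. Qed.

Lemma rnorm_expi t : rnorm (expi t : R[i]) = 1.
Proof.
apply/eqP; rewrite -(@eqrXn2 _ 2) ?rnorm_ge0// sqr_rnorm /= cos2Dsin2.
by rewrite expr1n.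
Qed.

Lemma expi2pi t : expi (t + 2 * pi) = expi t :> R[i].
Proof.
by rewrite /expi mulr_natl cosD2pi sinD2pi.
Qed.

Lemma cexpD w x : cexp (w + x) = cexp w * cexp x.
Proof.
by rewrite /cexp Re_add Im_add expRD expiD rmorphM/= mulrACA.
Qed.

Lemma rnorm_cexp w : rnorm (cexp w) = expR (complex.Re w).
Proof. by rewrite rnormM rnorm_expi mulr1 rnorm_real ger0_norm ?expR_ge0. Qed.

Lemma cexp0 : cexp 0 = 1.
Proof. by rewrite /cexp expR0 expi0 mulr1. Qed.

(** The first-order expansions of [expR], [cos] and [sin] at [0] combine to that
    of [cexp]; the constant [6] collects their error terms. *)
Lemma cexp0_has_slope : has_slope cexp 0.
Proof.
apply: (@approx_has_slope _ _ 1) => e e0.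
pose k := Num.min 1 (e / 6); have k0 : 0 < k by rewrite lt_min ltr01 divr_gt0.
have [d1 d10 dexp] := real_slope_approx (is_derive_expR 0) k0.
have [d2 d20 dcos] := real_slope_approx (is_derive_cos 0) k0.
have [d3 d30 dsin] := real_slope_approx (is_derive_sin 0) k0.
pose d := Num.min (Num.min d1 d2) (Num.min d3 (k / 3)).
have d0 : 0 < d by rewrite !lt_min d10 d20 d30 divr_gt0.
exists d => // h; rewrite subr0 mulr1 => hd.
pose p := complex.Re h; pose q := complex.Im h; pose r := rnorm h.
have pr : `|p| <= r := normRe_le h; have qr : `|q| <= r := normIm_le h.
move: hd; rewrite -/r !lt_min => /andP[/andP[hd1 hd2] /andP[hd3 hdk]].
have := dexp p (le_lt_trans pr hd1); have := dcos q (le_lt_trans qr hd2).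
have := dsin q (le_lt_trans qr hd3).
rewrite expR0 cos0 sin0 !oppr0 mulr0 ?addr0 !subr0 !mulr1 => Hs Hc He.
have k1 : k <= 1 by rewrite ge_min lexx.
have k6 : 6 * k <= e by rewrite mulrC -ler_pdivlMr// ge_min lexx orbT.
have r0 : 0 <= r := rnorm_ge0 h.
have rk : 3 * r <= k by rewrite mulrC -ler_pdivlMr// ltW.
apply: le_trans (rnorm_le_ReIm _) _.
rewrite cexp0 -/r !(Re_sub, Im_sub) /cexp Re_mul Im_mul /= !mul0r subr0 addr0.
rewrite -/p -/q.
have E1 : `|expR p - 1| <= k.
  have -> : expR p - 1 = (expR p - 1 - p) + p by ring.
  apply: le_trans (ler_normD _ _) _.
  have : k * `|p| <= 1 * r by apply: ler_pM => //; exact: ltW.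
  lra.
have E2 : `|expR p| <= 2.
  have -> : expR p = (expR p - 1) + 1 by ring.
  by apply: le_trans (ler_normD _ _) _; rewrite normr1; lra.
have kp : k * `|p| <= k * r by rewrite ler_pM2l.
have kq : k * `|q| <= k * r by rewrite ler_pM2l.
have T1 : `|expR p * cos q - 1 - p| <= 3 * (k * r).
  have -> : expR p * cos q - 1 - p = (expR p - 1 - p) + expR p * (cos q - 1) by ring.
  apply: le_trans (ler_normD _ _) _; rewrite normrM.
  have : `|expR p| * `|cos q - 1| <= 2 * (k * r).
    by apply: ler_pM => //; apply: le_trans kq.
  lra.
have T2 : `|expR p * sin q - 0 - q| <= 3 * (k * r).
  have -> : expR p * sin q - 0 - q = expR p * (sin q - q) + (expR p - 1) * q by ring.
  apply: le_trans (ler_normD _ _) _; rewrite !normrM.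
  have : `|expR p| * `|sin q - q| <= 2 * (k * r).
    by apply: ler_pM => //; apply: le_trans kq.
  have : `|expR p - 1| * `|q| <= k * r by apply: ler_pM.
  lra.
have : 6 * k * r <= e * r by rewrite ler_wpM2r.
lra.
Qed.

Lemma cexp_has_slope w : has_slope cexp w.
Proof.
have -> : cexp = fun y => cexp w * (cexp \o (fun y => y - w)) y.
  by apply/funext => y; rewrite /= -cexpD addrC subrK.
apply: has_slopeM; first exact: has_slope_cst.
apply: has_slope_comp.
  by apply: has_slopeB; [exact: has_slope_id|exact: has_slope_cst].
by rewrite subrr; exact: cexp0_has_slope.
Qed.

End ComplexSlope.

(** * Goursat's theorem *)

Section Goursat.
Variable R : realType.
Implicit Types (G : R[i] -> R[i]) (f : R -> R[i]) (w : R[i]) (s t : R).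

Lemma continuous_vertical G s t : {for s +i* t, continuous G} ->
  {for t, continuous (fun t => G (s +i* t))}.
Proof.
move=> cG; apply: (@continuous_comp _ _ _ (fun t => s +i* t) G); last exact: cG.
by apply: cvg_ReIm => /=; [exact: cvg_cst|exact: cvg_id].
Qed.

Lemma continuous_horizontal G s t : {for s +i* t, continuous G} ->
  {for s, continuous (fun s => G (s +i* t))}.
Proof.
move=> cG; apply: (@continuous_comp _ _ _ (fun s => s +i* t) G); last exact: cG.
by apply: cvg_ReIm => /=; [exact: cvg_id|exact: cvg_cst].
Qed.

Lemma continuous_Re_at f t : {for t, continuous f} ->
  {for t, continuous (fun t => complex.Re (f t))}.
Proof. by move=> cf; apply: cvg_Re. Qed.

Lemma continuous_Im_at f t : {for t, continuous f} ->
  {for t, continuous (fun t => complex.Im (f t))}.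
Proof. by move=> cf; apply: cvg_Im. Qed.

(** Cauchy's theorem for the rectangle with corners [S1] and [S2 +i* T]: the
    integrals over the two horizontal sides cancel by periodicity, and those over
    the vertical sides are left. *)
Lemma goursat_Re G S1 S2 T : S1 <= S2 -> 0 <= T ->
  (forall w, S1 <= complex.Re w <= S2 -> has_slope G w) ->
  (forall s, G (s +i* T) = G (s +i* 0)) ->
  segint 0 T (fun t => complex.Re (G (S1 +i* t))) =
  segint 0 T (fun t => complex.Re (G (S2 +i* t))).
Proof.
move=> S12 T0 dG perG.
pose u s t := complex.Re (G (s +i* t)); pose v s t := complex.Im (G (s +i* t)).
have cu s : S1 <= s <= S2 -> forall t, {for t, continuous (u s)}.
  move=> sS t; apply: continuous_Re_at; apply: continuous_vertical.
  exact/has_slope_continuous/dG.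
have cv t s : S1 <= s <= S2 -> {for s, continuous (fun s => v s t)}.
  move=> sS; apply: continuous_Im_at; apply: continuous_horizontal.
  exact/has_slope_continuous/dG.
have cuB s1 s2 : S1 <= s1 <= S2 -> S1 <= s2 <= S2 ->
    forall t, {for t, continuous (fun t => u s2 t - u s1 t)}.
  by move=> ? ? t; apply: continuousB; exact: cu.
have cvB t1 t2 s : S1 <= s <= S2 ->
    {for s, continuous (fun s => v s t2 - v s t1)}.
  by move=> ?; apply: continuousB; exact: cv.
(* [Phi] is the imaginary part of the contour integral of [G]. *)
pose Phi s1 s2 t1 t2 := segint t1 t2 (fun t => u s2 t - u s1 t) -
  segint s1 s2 (fun s => v s t2 - v s t1).
suff : Phi S1 S2 0 T = 0.
  rewrite /Phi (_ : (fun s => v s T - v s 0) = fun=> 0); last first.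
    by apply/funext => s; rewrite /v perG subrr.
  rewrite segint_cst// mul0r subr0 segintB; last 2 first.
  - by move=> t _; apply: cu; rewrite S12 lexx.
  - by move=> t _; apply: cu; rewrite S12 lexx.
  by move/eqP; rewrite subr_eq0 => /eqP ->.
have uE s1 s2 t1 t2 : S1 <= s1 <= S2 -> S1 <= s2 <= S2 ->
    segint t1 t2 (fun t => u s2 t - u s1 t) =
    segint t1 t2 (u s2) - segint t1 t2 (u s1).
  by move=> ? ?; apply: segintB => t _; exact: cu.
have vE s1 s2 t1 t2 : S1 <= s1 -> s2 <= S2 ->
    segint s1 s2 (fun s => v s t2 - v s t1) =
    segint s1 s2 (fun s => v s t2) - segint s1 s2 (fun s => v s t1).
  move=> ? ?; apply: segintB => s; rewrite in_itv/= => /andP[? ?]; apply: cv;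
    by apply/andP; split; lra.
apply: additive_rectangle_eq0 => //.
- move=> s1 s s2 t1 t2 S1s1 s1s ss2 s2S2 _ t12 _.
  rewrite /Phi !uE; try by apply/andP; split; lra.
  rewrite (segint_split s1s ss2); first by ring.
  move=> y; rewrite in_itv/= => /andP[? ?]; apply: cvB.
  by apply/andP; split; lra.
- move=> s1 s2 t1 t t2 S1s1 s12 s2S2 _ t1t tt2 _.
  rewrite /Phi !vE// (segint_split t1t tt2); first by ring.
  by move=> y _; apply: cuB; apply/andP; split; lra.
(* By the Cauchy-Riemann equations the linear part of [G] at [(s, t)] does not
   contribute. Two points of the rectangle enter each difference, whence
   [e / 2]. *)
move=> s t e /andP[S1s sS2] tT e0.
have [] := @has_slope_approx _ G (s +i* t); first by apply: dG; rewrite /= S1s.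
move=> A /(_ (e / 2))[|d d0 dP]; first by rewrite divr_gt0.
exists (d / 2); first by rewrite divr_gt0.
move=> s1 s2 t1 t2 /andP[S1s1 s1s] /andP[ss2 s2S] /andP[_ t1t] /andP[tt2 _] sd td.
set a := complex.Re A; set b := complex.Im A.
pose D := (s2 - s1) + (t2 - t1).
have approx s' t' : s1 <= s' <= s2 -> t1 <= t' <= t2 ->
    `|u s' t' - u s t - (a * (s' - s) - b * (t' - t))| <= e / 2 * D /\
    `|v s' t' - v s t - (b * (s' - s) + a * (t' - t))| <= e / 2 * D.
  move=> /andP[s1s' s's2] /andP[t1t' t't2].
  have nD : rnorm ((s' +i* t') - (s +i* t)) <= D.
    apply: le_trans (rnorm_le_ReIm _) _; rewrite /= /D.
    have : `|s' - s| <= s2 - s1 by rewrite ler_norml; apply/andP; split; lra.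
    have : `|t' - t| <= t2 - t1 by rewrite ler_norml; apply/andP; split; lra.
    lra.
  have nd : rnorm ((s' +i* t') - (s +i* t)) < d.
    by apply: le_lt_trans nD _; rewrite /D; lra.
  have H : rnorm (G (s' +i* t') - G (s +i* t) -
      ((s' +i* t') - (s +i* t)) * A) <= e / 2 * D.
    apply: le_trans (dP _ nd) _.
    by rewrite ler_pM2l// divr_gt0.
  split.
    apply: le_trans H; apply: le_trans (normRe_le _).
    rewrite !(Re_sub, Re_mul) /= -/a -/b /u.
    by rewrite (mulrC (s' - s)) (mulrC (t' - t)).
  apply: le_trans H; apply: le_trans (normIm_le _).
  rewrite !(Im_sub, Im_mul) /= -/a -/b /v.
  by rewrite (mulrC (s' - s)) (mulrC (t' - t)).
have D0 : 0 <= D by rewrite /D; lra.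
have bu : `|segint t1 t2 (fun t => u s2 t - u s1 t) - a * (s2 - s1) * (t2 - t1)|
    <= e * D * (t2 - t1).
  have t12 : t1 <= t2 by lra.
  rewrite -(segint_cst _ t12) -segintB; last 2 first.
  - by move=> y _; apply: cuB; apply/andP; split; lra.
  - by move=> y _; exact: continuous_cst_at.
  apply: segint_le_bound => //.
    move=> y _; apply: (@continuousB _ _ _ (fun y => u s2 y - u s1 y) (fun=> _));
      last exact: continuous_cst_at.
    by apply: cuB; apply/andP; split; lra.
  move=> y; rewrite in_itv/= => yt.
  have s1K : s1 <= s1 <= s2 by rewrite lexx; lra.
  have s2K : s1 <= s2 <= s2 by rewrite lexx andbT; lra.
  have [+ _] := approx s1 y s1K yt; have [+ _] := approx s2 y s2K yt.
  rewrite !ler_norml => /andP[? ?] /andP[? ?].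
  by apply/andP; split; lra.
have bv : `|segint s1 s2 (fun s => v s t2 - v s t1) - a * (t2 - t1) * (s2 - s1)|
    <= e * D * (s2 - s1).
  have s12 : s1 <= s2 by lra.
  rewrite -(segint_cst _ s12) -segintB; last 2 first.
  - move=> y; rewrite in_itv/= => /andP[? ?]; apply: cvB.
    by apply/andP; split; lra.
  - by move=> y _; exact: continuous_cst_at.
  apply: segint_le_bound => //.
    move=> y; rewrite in_itv/= => /andP[? ?].
    apply: (@continuousB _ _ _ (fun y => v y t2 - v y t1) (fun=> _));
      last exact: continuous_cst_at.
    by apply: cvB; apply/andP; split; lra.
  move=> y; rewrite in_itv/= => ys.
  have t1K : t1 <= t1 <= t2 by rewrite lexx; lra.
  have t2K : t1 <= t2 <= t2 by rewrite lexx andbT; lra.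
  have [_] := approx y t1 ys t1K; have [_] := approx y t2 ys t2K.
  rewrite !ler_norml => /andP[? ?] /andP[? ?].
  by apply/andP; split; lra.
have -> : Phi s1 s2 t1 t2 =
    (segint t1 t2 (fun t => u s2 t - u s1 t) - a * (s2 - s1) * (t2 - t1)) -
    (segint s1 s2 (fun s => v s t2 - v s t1) - a * (t2 - t1) * (s2 - s1)).
  by rewrite /Phi; ring.
apply: le_trans (ler_normB _ _) _; apply: le_trans (lerD bu bv) _.
by rewrite -/D /D; lra.
Qed.

End Goursat.

(** * Means over circles *)

Section CircleMean.
Variable R : realType.
Implicit Types (f g : R -> R[i]) (psi : R[i] -> R[i]) (r s t : R).

Let T : R := 2 * pi.

Let T_gt0 : 0 < T. Proof. by rewrite mulr_gt0// pi_gt0. Qed.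

Definition cmean f : R[i] :=
  (segint 0 (2 * pi) (fun t => complex.Re (f t)) +i*
   segint 0 (2 * pi) (fun t => complex.Im (f t))) * ((2 * pi)^-1)%:C.

Let contI f : continuous f -> {in `[0, T], continuous (fun t => complex.Re (f t))}
  /\ {in `[0, T], continuous (fun t => complex.Im (f t))}.
Proof.
by move=> cf; split=> t _; [apply: continuous_Re_at|apply: continuous_Im_at];
  exact: cf.
Qed.

Lemma cmeanD f g : continuous f -> continuous g ->
  cmean (fun t => f t + g t) = cmean f + cmean g.
Proof.
move=> /contI[cRf cIf] /contI[cRg cIg]; rewrite /cmean -mulrDl; congr (_ * _).
under eq_segint do rewrite Re_add.
under [X in _ +i* X]eq_segint do rewrite Im_add.
by rewrite !segintD.
Qed.

Lemma cmeanZ c f : continuous f -> cmean (fun t => c * f t) = c * cmean f.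
Proof.
move=> /contI[cRf cIf]; rewrite /cmean mulrA; congr (_ * _).
have cZ (k : R) (h : R -> R) : {in `[0, T], continuous h} ->
    {in `[0, T], continuous (fun t => k * h t)}.
  move=> ch t tT; apply: (@continuousM _ _ (fun=> k)); last exact: ch.
  exact: continuous_cst_at.
under eq_segint do rewrite Re_mul.
under [X in _ +i* X]eq_segint do rewrite Im_mul.
rewrite segintB; try exact: cZ.
rewrite segintD; try exact: cZ.
by rewrite !segintZ//; case: (c).
Qed.

Lemma cmean_cst c : cmean (fun=> c) = c.
Proof.
rewrite /cmean !segint_cst ?ltW// subr0; case: c => a b /=.
apply/eqP; rewrite eq_complex /= !mulr0 subr0 add0r.
by rewrite !mulfK ?eqxx// gt_eqF.
Qed.

Lemma eq_cmean f g : f =1 g -> cmean f = cmean g.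
Proof. by move=> /funext ->. Qed.

Lemma rnorm_cmean f (C : R) : continuous f -> (forall t, rnorm (f t) <= C) ->
  rnorm (cmean f) <= 2 * C.
Proof.
move=> /contI[cRf cIf] fC; rewrite rnormM rnorm_real ger0_norm; last first.
  by rewrite invr_ge0 ltW.
rewrite ler_pdivrMr//; apply: le_trans (rnorm_le_ReIm _) _ => /=.
rewrite (_ : 2 * C * T = C * (T - 0) + C * (T - 0)); last by ring.
apply: lerD; (apply: segint_le_bound => //; first exact: ltW) => t _.
  exact: le_trans (normRe_le _) (fC t).
exact: le_trans (normIm_le _) (fC t).
Qed.

Lemma cvg_cmean (C : R) (f_ : nat -> R -> R[i]) f :
  (forall n, continuous (f_ n)) -> continuous f ->
  (forall n t, rnorm (f_ n t) <= C) ->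
  (forall t, f_ n t @[n --> \oo] --> f t) ->
  cmean (f_ n) @[n --> \oo] --> cmean f.
Proof.
move=> cf_ cf fC fcvg.
have cR : segint 0 T (fun t => complex.Re (f_ n t)) @[n --> \oo] -->
    segint 0 T (fun t => complex.Re (f t)).
  apply: (@bounded_convergence _ _ _ C).
  - by move=> n; case: (contI (cf_ n)).
  - by case: (contI cf).
  - by move=> n t _; exact: le_trans (normRe_le _) (fC n t).
  - by apply: aeW => t _; exact: cvg_Re.
have cI : segint 0 T (fun t => complex.Im (f_ n t)) @[n --> \oo] -->
    segint 0 T (fun t => complex.Im (f t)).
  apply: (@bounded_convergence _ _ _ C).
  - by move=> n; case: (contI (cf_ n)).
  - by case: (contI cf).
  - by move=> n t _; exact: le_trans (normIm_le _) (fC n t).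
  - by apply: aeW => t _; exact: cvg_Im.
by apply: (@cvgM R[i]); [exact: cvg_ReIm|exact: cvg_cst].
Qed.

Definition circle r t : R[i] := r%:C * expi t.

Lemma rnorm_circle r t : 0 <= r -> rnorm (circle r t) = r.
Proof. by move=> r0; rewrite rnormM rnorm_expi mulr1 rnorm_real ger0_norm. Qed.

Lemma circle_cexp s t : circle (expR s) t = cexp (s +i* t).
Proof. by []. Qed.

Lemma continuous_circle r : continuous (circle r).
Proof.
move=> t; apply: (@continuousM R[i] _ (fun=> r%:C)).
  by move=> A; exact: cvg_cst.
by apply: cvg_ReIm => /=; [exact: continuous_cos|exact: continuous_sin].
Qed.

Lemma continuous_on_circle psi r :
  (forall t, {for circle r t, continuous psi}) ->
  continuous (fun t => psi (circle r t)).
Proof.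
move=> cpsi t; apply: (@continuous_comp _ _ _ (circle r) psi); last exact: cpsi.
exact: continuous_circle.
Qed.

(** Slopes are global functions, but only their values near the point matter. *)
Lemma has_slope_near (f g : R[i] -> R[i]) x (d : R) : 0 < d ->
  (forall y, rnorm (y - x) < d -> f y = g y) -> has_slope g x -> has_slope f x.
Proof.
move=> d0 fg /has_slope_approx[A gA]; apply: (approx_has_slope (A := A)) => e.
move=> /gA[d' d'0 d'P]; exists (Num.min d d'); first by rewrite lt_min d0.
move=> y; rewrite lt_min => /andP[yd yd'].
by rewrite !fg ?d'P// subrr rnorm0.
Qed.

(** Cauchy's theorem for the annulus, in logarithmic polar coordinates: there
    the annulus becomes a rectangle whose horizontal sides cancel by
    periodicity. *)
Lemma cmean_annulus psi r1 r2 : 0 < r1 -> r1 <= r2 ->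
  (forall z, r1 <= rnorm z <= r2 -> has_slope psi z) ->
  cmean (fun t => psi (circle r1 t)) = cmean (fun t => psi (circle r2 t)).
Proof.
move=> r10 r12 dpsi; have r20 : 0 < r2 by exact: lt_le_trans r12.
have main psi0 : (forall z, r1 <= rnorm z <= r2 -> has_slope psi0 z) ->
    segint 0 T (fun t => complex.Re (psi0 (circle r1 t))) =
    segint 0 T (fun t => complex.Re (psi0 (circle r2 t))).
  move=> dpsi0.
  have polar r : 0 < r -> (fun t => complex.Re (psi0 (circle r t))) =
      (fun t => complex.Re ((psi0 \o @cexp R) (ln r +i* t))).
    by move=> r0; apply/funext => t; rewrite /= -circle_cexp lnK.
  rewrite (polar r1 r10) (polar r2 r20); apply: goursat_Re.
  - by rewrite ler_ln ?posrE.
  - exact: ltW.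
  - move=> w /andP[h1 h2]; apply: has_slope_comp; first exact: cexp_has_slope.
    apply: dpsi0; rewrite rnorm_cexp -{1}(lnK r10) -{1}(lnK r20) !ler_expR.
    by rewrite h1.
  - move=> s; congr (psi0 _); rewrite /cexp /=; congr (_ * _).
    by rewrite -[X in expi X]add0r expi2pi.
rewrite /cmean main//; congr ((_ +i* _) * _).
have := main (fun z => (- 'i) * psi z).
rewrite (_ : (fun t => complex.Re (- 'i * psi (circle r1 t))) =
             (fun t => complex.Im (psi (circle r1 t)))); last first.
  by apply/funext => t; rewrite Re_mul /= oppr0 mul0r sub0r mulN1r opprK.
rewrite (_ : (fun t => complex.Re (- 'i * psi (circle r2 t))) =
             (fun t => complex.Im (psi (circle r2 t)))); last first.
  by apply/funext => t; rewrite Re_mul /= oppr0 mul0r sub0r mulN1r opprK.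
apply=> z zr; apply: has_slopeM; first exact: has_slope_cst.
exact: dpsi.
Qed.

Lemma cvg_cmean_circle psi (B : R) (r_ : nat -> R) r :
  (forall z, rnorm z < 1 -> {for z, continuous psi}) ->
  (forall z, rnorm z < 1 -> rnorm (psi z) <= B) ->
  (forall n, 0 <= r_ n < 1) -> 0 <= r < 1 -> r_ n @[n --> \oo] --> r ->
  cmean (fun t => psi (circle (r_ n) t)) @[n --> \oo] -->
    cmean (fun t => psi (circle r t)).
Proof.
move=> cpsi bpsi r_1 /andP[r0 r1] cr.
have nc s t : 0 <= s < 1 -> rnorm (circle s t) < 1.
  by move=> /andP[? ?]; rewrite rnorm_circle.
apply: (@cvg_cmean B).
- by move=> n; apply: continuous_on_circle => t; exact/cpsi/nc.
- by apply: continuous_on_circle => t; apply/cpsi/nc/andP.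
- by move=> n t; exact/bpsi/nc.
move=> t; have c0 : {for circle r t, continuous psi} by apply/cpsi/nc/andP.
apply: (@cvg_comp _ _ _ (fun n => circle (r_ n) t) psi) c0.
apply: (@cvgM R[i]); last exact: cvg_cst.
by apply: cvg_ReIm => //=; exact: cvg_cst.
Qed.

(** An exceptional circle is crossed by continuity. *)
Lemma cmean_value psi (B rho r : R) :
  (forall z, rnorm z < 1 -> {for z, continuous psi}) ->
  (forall z, rnorm z < 1 -> rnorm (psi z) <= B) ->
  (forall z, 0 < rnorm z -> rnorm z < 1 -> rnorm z != rho -> has_slope psi z) ->
  0 < r -> r < 1 -> cmean (fun t => psi (circle r t)) = psi 0.
Proof.
move=> cpsi bpsi dpsi.
pose m r := cmean (fun t => psi (circle r t)).
have m0 : m 0 = psi 0.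
  rewrite -[RHS]cmean_cst; apply: eq_cmean => t.
  by rewrite /circle (_ : 0%:C = 0)// mul0r.
have hcvg (x y : R) : x + y / n.+1%:R @[n --> \oo] --> x.
  rewrite -[X in _ --> X]addr0 -[X in _ + X](mulr0 y); apply: cvgD.
    exact: cvg_cst.
  by apply: cvgM; [exact: cvg_cst|exact: cvg_harmonic].
have annulus (x y : R) : 0 < x -> x <= y -> y < 1 ->
    (forall z : R, x <= z <= y -> z != rho) -> m x = m y.
  move=> x0 xy y1 H; apply: cmean_annulus => // z /andP[xz zy].
  by apply: dpsi; [lra|lra|apply: H; rewrite xz].
have step (x y : R) c : 0 <= x < 1 -> (forall n, 0 <= x + y / n.+1%:R < 1) ->
    (forall n, m (x + y / n.+1%:R) = c) -> m x = c.
  move=> x01 xy01 mE.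
  have := cvg_cmean_circle cpsi bpsi xy01 x01 (hcvg x y).
  rewrite -/(m x) (_ : (fun n => cmean _) = fun=> c); last exact/funext.
  by move=> mc; apply/esym; exact: (cvg_unique (@norm_hausdorff _ _) (cvg_cst c) mc).
have div_itv (y : R) n : 0 <= y -> 0 <= y / n.+1%:R <= y.
  by move=> y0; rewrite divr_ge0//= ler_pdivrMr// ler_peMr// ler1n.
have small (x : R) : 0 < x -> x < 1 -> (x < rho) || (rho <= 0) -> m x = m 0.
  move=> x0 x1 xr; apply/esym/(step _ x); first by rewrite lexx ltr01.
    by move=> n; rewrite add0r; have /andP[-> /le_lt_trans->] := div_itv x n (ltW x0).
  move=> n; rewrite add0r; have /andP[_ h] := div_itv x n (ltW x0).
  apply: annulus => //; first by rewrite divr_gt0.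
  move=> z /andP[zx zx']; have z0 : 0 < z by apply: lt_le_trans zx; rewrite divr_gt0.
  by apply/eqP => zr; move: xr => /orP[]; lra.
move=> r0 r1; rewrite -m0 -/(m r).
have [rho0|rho0] := lerP rho 0; first by apply: small => //; rewrite rho0 orbT.
have [rr|rr] := ltP r rho; first by apply: small => //; rewrite rr.
have mrho : m rho = m 0.
  apply: (step _ (- rho / 2)); first by apply/andP; split; lra.
    move=> n; rewrite mulNr mulNr.
    have : 0 <= rho / 2 / n.+1%:R <= rho / 2 by apply: div_itv; lra.
    by move: (_ / n.+1%:R) => q /andP[? ?]; apply/andP; split; lra.
  move=> n; rewrite mulNr mulNr.
  have : 0 <= rho / 2 / n.+1%:R <= rho / 2 by apply: div_itv; lra.
  have : 0 < rho / 2 / n.+1%:R by rewrite !divr_gt0.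
  move: (_ / n.+1%:R) => q ? /andP[? ?].
  by apply: small; [lra|lra|apply/orP; left; lra].
have [<-//|rhor] := eqVneq rho r.
have rlt : rho < r by rewrite lt_neqAle rhor.
rewrite -mrho; apply/esym/(step _ (r - rho)); first by apply/andP; split; lra.
  move=> n; have : 0 <= (r - rho) / n.+1%:R <= r - rho by apply: div_itv; lra.
  by move: (_ / n.+1%:R) => q /andP[? ?]; apply/andP; split; lra.
move=> n; have : 0 <= (r - rho) / n.+1%:R <= r - rho by apply: div_itv; lra.
have : 0 < (r - rho) / n.+1%:R by rewrite divr_gt0// subr_gt0.
move: (_ / n.+1%:R) => q q0 /andP[_ qr].
apply: annulus => //; [lra|lra|].
by move=> z /andP[? ?]; rewrite gt_eqF//; lra.
Qed.

End CircleMean.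

(** * Taylor series of bounded scalar holomorphic functions *)

Section ScalarTaylor.
Variable R : realType.
Implicit Types (psi : R[i] -> R[i]) (r s t : R).

Lemma circle_neq0 r t : 0 < r -> circle r t != 0.
Proof. by move=> r0; rewrite -rnorm_eq0 rnorm_circle ?gt_eqF// ltW. Qed.

Lemma has_slope_invX n (z : R[i]) : z != 0 -> has_slope (fun z => z^-1 ^+ n) z.
Proof.
move=> z0; apply: (@has_slopeX _ (fun z => z^-1)).
by apply: (@has_slopeV _ id) => //; exact: has_slope_id.
Qed.

(** The mean is homogeneous in the radius, of negative degree, and by Cauchy's
    theorem it is also independent of the radius. *)
Lemma cmean_inv_pow n r : 0 < r ->
  cmean (fun t => (circle r t)^-1 ^+ n.+1) = 0.
Proof.
move=> r0; pose k := cmean (fun t => (expi t : R[i])^-1 ^+ n.+1).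
have cont : continuous (fun t => (expi t : R[i])^-1 ^+ n.+1).
  have -> : (fun t => (expi t : R[i])^-1 ^+ n.+1) =
      (fun t => (fun z => z^-1 ^+ n.+1) (circle 1 t)).
    by apply/funext => t; rewrite /circle mul1r.
  apply: (@continuous_on_circle R (fun z => z^-1 ^+ n.+1)) => t.
  exact/has_slope_continuous/has_slope_invX/circle_neq0.
have meanE s : 0 < s ->
    cmean (fun t => (circle s t)^-1 ^+ n.+1) = s%:C^-1 ^+ n.+1 * k.
  move=> s0; rewrite -cmeanZ//; apply: eq_cmean => t.
  by rewrite /circle invfM exprMn.
have : cmean (fun t => (circle 1 t)^-1 ^+ n.+1) =
    cmean (fun t => (circle 2 t)^-1 ^+ n.+1).
  apply: (@cmean_annulus R (fun z => z^-1 ^+ n.+1)) => // [|z /andP[z1 _]].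
    by rewrite ler1n.
  by apply: has_slope_invX; rewrite -rnorm_eq0 gt_eqF// (lt_le_trans ltr01).
have -> : cmean (fun t => (circle 1 t)^-1 ^+ n.+1) = k.
  by apply: eq_cmean => t; rewrite /circle mul1r.
rewrite (meanE 2 (ltr0n R 2)) (meanE r r0) => /eqP.
rewrite -[X in X == _]mul1r -subr_eq0 -mulrBl mulf_eq0 => /orP[|/eqP->];
  last by rewrite mulr0.
rewrite subr_eq0 eq_sym => /eqP/(congr1 (fun z => @rnorm R _ z)).
rewrite rnormX rnormV rnorm_real ger0_norm// rnorm1 => /eqP.
by rewrite lt_eqF// exprn_ilt1// invf_lt1// ltr1n.
Qed.

(** A radius at which Cauchy's estimate for the [n]-th coefficient loses at most
    a factor [2]. *)
Lemma exists_radius n : exists2 r : R, 0 < r < 1 & 2^-1 <= r ^+ n.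
Proof.
have bern (x : R) m : 0 <= x <= 1 -> 1 - m%:R * x <= (1 - x) ^+ m.
  move=> /andP[x0 x1]; elim: m => [|m IH]; first by rewrite mul0r subr0 expr0.
  rewrite exprS; apply: le_trans (_ : (1 - x) * (1 - m%:R * x) <= _).
    by have := mulr_ge0 (mulr_ge0 (ler0n R m) x0) x0; rewrite -natr1; lra.
  by rewrite ler_wpM2l// subr_ge0.
pose x : R := (n.+1%:R)^-1 / 2.
have x0 : 0 < x by rewrite divr_gt0.
have n1 : n.+1%:R^-1 <= 1 :> R by rewrite invf_le1// ler1n.
have x1 : x <= 2^-1 by rewrite /x ler_pdivrMr// mulVf.
exists (1 - x); first by apply/andP; split; lra.
apply: le_trans (bern x n _); last by apply/andP; split; lra.
have : n%:R * x <= 2^-1.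
  rewrite /x mulrA -[leRHS]mul1r ler_pM2r ?invr_gt0// ler_pdivrMr// mul1r.
  by rewrite ler_nat.
lra.
Qed.

(** The coefficients are the means [c n] of [psi z / z ^+ n], and they do not
    depend on the radius. Let [h n] be the corresponding means for the difference
    quotient [H] of [psi] at [a]. From [psi z = psi a + (z - a) * H z] one gets
    [c n.+1 = h n - a * h n.+1] and [c 0 = psi a - a * h 0], the latter because
    [z * H z] has mean [0]; so the Taylor series telescopes. *)
Theorem scalar_taylor psi (M : R) :
  (forall z, rnorm z < 1 -> has_slope psi z) ->
  (forall z, rnorm z < 1 -> rnorm (psi z) <= M) ->
  exists2 c : nat -> R[i], forall n, rnorm (c n) <= 4 * M &
    forall a : R[i], rnorm a < 1 -> series (fun n => a ^+ n * c n) @ \oo --> psi a.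
Proof.
move=> dpsi bpsi.
pose cr r n := cmean (fun t => psi (circle r t) * (circle r t)^-1 ^+ n).
have dpow n z : 0 < rnorm z -> rnorm z < 1 ->
    has_slope (fun z => psi z * z^-1 ^+ n) z.
  move=> z0 z1; apply: has_slopeM; first exact: dpsi.
  by apply: has_slope_invX; rewrite -rnorm_eq0 gt_eqF.
have crE n r1 r2 : 0 < r1 < 1 -> 0 < r2 < 1 -> cr r1 n = cr r2 n.
  wlog : r1 r2 / r1 <= r2.
    move=> H r1P r2P; have [h|/ltW h] := leP r1 r2; first exact: H.
    by apply/esym; exact: H.
  move=> r12 /andP[r10 _] /andP[_ r21].
  apply: (@cmean_annulus R (fun z => psi z * z^-1 ^+ n)) => // z /andP[? ?].
  by apply: dpow; lra.
have psi_cont r : 0 < r < 1 -> continuous (fun t => psi (circle r t)).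
  move=> /andP[? ?]; apply: continuous_on_circle => t.
  by apply/has_slope_continuous/dpsi; rewrite rnorm_circle// ltW.
have half : 0 < (2^-1 : R) < 1 by apply/andP; split; lra.
exists (cr 2^-1) => [n|a a1].
  have [r /andP[r0 r1] rn] := exists_radius n.
  rewrite (@crE _ _ r)//; last by rewrite r0.
  have M0 : 0 <= M by apply: le_trans (bpsi 0 _); rewrite ?rnorm_ge0// rnorm0.
  rewrite (_ : 4 * M = 2 * (2 * M)); last by ring.
  apply: rnorm_cmean => [|t].
    apply: (@continuous_on_circle R (fun z => psi z * z^-1 ^+ n)) => t.
    by apply/has_slope_continuous/dpow; rewrite rnorm_circle ?(ltW r0).
  rewrite rnormM rnormX rnormV rnorm_circle ?(ltW r0)// mulrC.
  apply: ler_pM => //; rewrite ?rnorm_ge0 ?exprn_ge0 ?invr_ge0 ?(ltW r0)//.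
    by rewrite exprVn -[leRHS]invrK lef_pV2 ?posrE ?exprn_gt0// invr_gt0.
  by apply: bpsi; rewrite rnorm_circle ?(ltW r0).
pose r := (1 + rnorm a) / 2.
have a0 := rnorm_ge0 a.
have ar : rnorm a < r by rewrite /r; lra.
have r0 : 0 < r by rewrite /r; lra.
have r1 : r < 1 by rewrite /r; lra.
have rP : 0 < r < 1 by rewrite r0.
have cz t : circle r t != 0 by exact: circle_neq0.
(* [H] is continuous at [a] and holomorphic elsewhere. *)
have [A dA] := has_slope_approx (dpsi a a1).
pose H := slope psi a A.
have HE z : z != a -> H z = (psi z - psi a) / (z - a).
  by rewrite /H /slope => /negPf ->.
have sH z : rnorm z < 1 -> z != a -> has_slope H z.
  move=> z1 za; have d0 : 0 < rnorm (z - a).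
    by rewrite lt_neqAle rnorm_ge0 eq_sym rnorm_eq0 subr_eq0 za.
  apply: (@has_slope_near _ _ (fun z => (psi z - psi a) * (z - a)^-1) _ _ d0).
    move=> y yz; apply: HE; apply: contraTneq yz => ->.
    by rewrite rnormC ltxx.
  apply: has_slopeM.
    by apply: has_slopeB; [exact: dpsi|exact: has_slope_cst].
  apply: has_slopeV; first by rewrite subr_eq0.
  by apply: has_slopeB; [exact: has_slope_id|exact: has_slope_cst].
have cHa : {for a, continuous H}.
  move=> P; rewrite {1}/H {1}/slope eqxx => /near_rnormP[e e0 eP].
  have e20 : 0 < e / 2 by rewrite divr_gt0.
  have [d d0 dP] := dA _ e20.
  apply/near_rnormP; exists d => // y yd; apply: eP.
  have [->|ya] := eqVneq y a; first by rewrite /H /slope eqxx subrr rnorm0.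
  rewrite HE//; have ya0 : 0 < rnorm (y - a).
    by rewrite lt_neqAle rnorm_ge0 eq_sym rnorm_eq0 subr_eq0 ya.
  have -> : (psi y - psi a) / (y - a) - A =
      (psi y - psi a - (y - a) * A) / (y - a) by field; rewrite subr_eq0.
  rewrite rnormM rnormV ltr_pdivrMr//; apply: le_lt_trans (dP _ yd) _.
  by rewrite ltr_pM2r// ltr_pdivrMr// mulr_natr mulr2n ltrDl.
have cH z : rnorm z < 1 -> {for z, continuous H}.
  move=> z1; have [->//|za] := eqVneq z a.
  exact/has_slope_continuous/sH.
have [B bH] : exists B, forall z, rnorm z < 1 -> rnorm (H z) <= B.
  have [d d0 dP] : exists2 d : R, 0 < d &
      forall y, rnorm (y - a) < d -> rnorm (H y - H a) < 1.
    have /cHa/near_rnormP : \forall z \near H a, rnorm (z - H a) < 1.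
      by apply/near_rnormP; exists 1.
    by [].
  have M0 : 0 <= M by apply: le_trans (bpsi 0 _); rewrite ?rnorm_ge0// rnorm0.
  exists (1 + rnorm (H a) + 2 * M / d) => z z1.
  have Md0 : 0 <= 2 * M / d by rewrite divr_ge0 ?mulr_ge0// ltW.
  have [zd|zd] := ltP (rnorm (z - a)) d.
    have := rnormD (H z - H a) (H a); rewrite subrK; have := dP _ zd; lra.
  have za : z != a by apply: contraTneq zd => ->; rewrite subrr rnorm0 -ltNge.
  rewrite HE// rnormM rnormV.
  have : rnorm (psi z - psi a) / rnorm (z - a) <= 2 * M / d.
    apply: ler_pM; rewrite ?rnorm_ge0 ?invr_ge0 ?rnorm_ge0//.
      by have := rnormB (psi z) (psi a); have := bpsi _ z1; have := bpsi _ a1; lra.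
    by rewrite lef_pV2 ?posrE// (lt_le_trans d0).
  have := rnorm_ge0 (H a); lra.
(* The circle through [a] is exceptional for the mean value property. *)
have KE : cmean (fun t => circle r t * H (circle r t)) = 0.
  have K1 (z : R[i]) : rnorm z < 1 -> {for z, continuous (fun z : R[i] => z * H z)}.
    move=> z1; apply: (@continuousM _ _ id H); last exact: cH.
    exact: continuous_id_at.
  have K2 (z : R[i]) : rnorm z < 1 -> rnorm (z * H z) <= B.
    move=> z1; rewrite rnormM -[B]mul1r.
    by apply: ler_pM; rewrite ?rnorm_ge0 ?bH// ltW.
  have K3 (z : R[i]) : 0 < rnorm z -> rnorm z < 1 -> rnorm z != rnorm a ->
      has_slope (fun z => z * H z) z.
    move=> z0 z1 za; apply: has_slopeM; first exact: has_slope_id.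
    by apply: sH => //; apply: contraNneq za => ->.
  have := @cmean_value _ (fun z => z * H z) B (rnorm a) r K1 K2 K3 r0 r1.
  by rewrite mul0r.
pose h n := cmean (fun t => H (circle r t) * (circle r t)^-1 ^+ n).
have contH n : continuous (fun t => H (circle r t) * (circle r t)^-1 ^+ n).
  apply: (@continuous_on_circle R (fun z => H z * z^-1 ^+ n)) => t.
  apply: (@continuousM _ _ H); first by apply: cH; rewrite rnorm_circle// ltW.
  exact/has_slope_continuous/has_slope_invX.
have contV n : continuous (fun t => (circle r t)^-1 ^+ n).
  apply: (@continuous_on_circle R (fun z => z^-1 ^+ n)) => t.
  exact/has_slope_continuous/has_slope_invX.
have contHz n : continuous (fun t => circle r t * H (circle r t) * (circle r t)^-1 ^+ n).
  move=> t; apply: (@continuousM _ _ (fun t => circle r t * H (circle r t))); last exact: contV.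
  apply: continuousM; first exact: continuous_circle.
  apply: (@continuous_on_circle R H) => t'.
  by apply: cH; rewrite rnorm_circle// ltW.
pose F1 n t := circle r t * H (circle r t) * (circle r t)^-1 ^+ n.
pose F2 n t := H (circle r t) * (circle r t)^-1 ^+ n.
pose F3 n t := (circle r t)^-1 ^+ n.
have cF2 n : continuous (fun t => - a * F2 n t).
  move=> t; apply: (@continuousM _ _ (fun=> - a)); last exact: (contH n t).
  by apply: cvg_cst.
have cF3 n : continuous (fun t => psi a * F3 n t).
  move=> t; apply: (@continuousM _ _ (fun=> psi a)); last exact: (contV n t).
  by apply: cvg_cst.
have cF12 n : continuous (fun t => F1 n t + - a * F2 n t).
  by move=> t; apply: continuousD; [exact: (contHz n t)|exact: (cF2 n t)].
have split_psi n : cr r n = cmean (F1 n) - a * h n + psi a * cmean (F3 n).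
  have -> : cr r n = cmean (fun t => (F1 n t + - a * F2 n t) + psi a * F3 n t).
    apply: eq_cmean => t; have := slopeE psi a A (circle r t); rewrite -/H.
    move=> /eqP; rewrite subr_eq => /eqP ->; rewrite /F1 /F2 /F3.
    by move: (H _) (_ ^+ n) => x y; ring.
  rewrite (cmeanD (cF12 n) (cF3 n)) (cmeanD (contHz n) (cF2 n)).
  by rewrite (cmeanZ _ (contH n)) (cmeanZ _ (contV n)) mulNr.
have c0 : cr r 0%N = psi a - a * h 0%N.
  have F10 : cmean (F1 0%N) = 0.
    by rewrite -[RHS]KE; apply: eq_cmean => t; rewrite /F1 expr0 mulr1.
  have F30 : cmean (F3 0%N) = 1.
    by rewrite -[RHS]cmean_cst; apply: eq_cmean => t; rewrite /F3 expr0.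
  by rewrite split_psi F10 F30 mulr1 sub0r addrC.
have cS n : cr r n.+1 = h n - a * h n.+1.
  rewrite split_psi (cmean_inv_pow n r0) mulr0 addr0; congr (_ - _).
  apply: eq_cmean => t; rewrite /F1 exprS mulrA; congr (_ * _).
  by rewrite mulrAC divff ?cz// mul1r.
have sumE N : series (fun n => a ^+ n * cr 2^-1 n) N.+1 = psi a - a ^+ N.+1 * h N.
  rewrite /series /=; elim: N => [|N IH].
    by rewrite big_nat1 expr0 mul1r (@crE _ _ r)// c0 expr1.
  by rewrite big_nat_recr//= IH (@crE _ _ r)// cS (exprSr a N.+1);
    move: (a ^+ N.+1) (h N) (h N.+1) (psi a) => x y y' p; ring.
rewrite -(cvg_shiftn 1); under eq_fun do rewrite addn1.
apply/cvg_rnormP; pose q := rnorm a / r.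
have q0 : 0 <= q by rewrite divr_ge0// ltW.
have q1 : q < 1 by rewrite ltr_pdivrMr// mul1r.
apply: (@squeeze_cvgr _ _ _ _ (cst 0) (fun N => 2 * B * rnorm a * q ^+ N)).
- apply: nearW => N; rewrite rnorm_ge0 /= sumE addrC addKr rnormN rnormM rnormX.
  have hb : rnorm (h N) <= 2 * (B * (r ^+ N)^-1).
    apply: (rnorm_cmean (contH N)) => t.
    rewrite rnormM rnormX rnormV rnorm_circle ?(ltW r0)// exprVn.
    rewrite ler_wpM2r ?invr_ge0 ?exprn_ge0 ?(ltW r0)//.
    by apply: bH; rewrite rnorm_circle ?(ltW r0).
  apply: le_trans (ler_wpM2l (exprn_ge0 N.+1 a0) hb) _.
  rewrite exprS /q (expr_div_n (rnorm a) r N) le_eqVlt; apply/orP; left; apply/eqP.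
  by move: (rnorm a ^+ N) ((r ^+ N)^-1) => x y; ring.
- exact: cvg_cst.
- rewrite -[X in _ --> X](mulr0 (2 * B * rnorm a)); apply: cvgM; first exact: cvg_cst.
  by apply: cvg_expr; rewrite ger0_norm.
Qed.

End ScalarTaylor.

(** * Series and Hilbert spaces *)

Section Series.
Variable R : realType.

Lemma cauchy_rnorm_cvg (V : completeNormedModType R[i]) (u : nat -> V) :
  (forall e : R, 0 < e -> exists N, forall m n, (N <= m)%N -> (N <= n)%N ->
    rnorm (u m - u n) < e) -> cvgn u.
Proof.
move=> H; apply: cauchy_cvg; apply/cauchyP => e e0.
have eE : e = (complex.Re e)%:C by rewrite RRe_real// gtr0_real.
move: (e0); rewrite eE ltcR => /H[N NP]; exists (u N).
exists N => // n /= Nn; rewrite -ball_normE /ball_/= -eE rnormE eE ltcR.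
exact: NP.
Qed.

Lemma seriesB_sum (V : zmodType) (u : nat -> V) m n : (m <= n)%N ->
  series u n - series u m = \sum_(m <= k < n) u k.
Proof.
move=> mn; rewrite /series /= (big_cat_nat (n := m))//=.
by rewrite addrAC subrr add0r.
Qed.

Lemma dominated_series_cvg (V : completeNormedModType R[i]) (u : nat -> V)
    (v : nat -> R) : (forall n, rnorm (u n) <= v n) -> cvgn (series v) ->
  cvgn (series u).
Proof.
move=> uv cv; apply: cauchy_rnorm_cvg => e e0.
have e20 : 0 < e / 2 by rewrite divr_gt0.
move/cvgrPdist_lt : cv => /(_ _ e20)[N _ NP]; exists N.
have H m n : (N <= m)%N -> (m <= n)%N -> rnorm (series u n - series u m) < e.
  move=> Nm mn; rewrite seriesB_sum//; apply: le_lt_trans (rnorm_sum _ _ _) _.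
  apply: le_lt_trans (_ : \sum_(m <= k < n) v k < _); first exact: ler_sum.
  have := NP _ Nm; have := NP _ (leq_trans Nm mn) => /=.
  rewrite -seriesB_sum// !ltr_norml => /andP[? ?] /andP[? ?]; lra.
move=> m n Nm Nn; have [mn|/ltnW nm] := leqP m n; last exact: H.
by rewrite rnormC; exact: H.
Qed.

Lemma Re_series (u : nat -> R[i]) :
  (fun n => complex.Re (series u n)) = series (fun n => complex.Re (u n)).
Proof.
apply/funext => n; rewrite /series /=; elim/big_rec2: _ => // k x y _ <-.
exact: Re_add.
Qed.

Lemma Im_series (u : nat -> R[i]) :
  (fun n => complex.Im (series u n)) = series (fun n => complex.Im (u n)).
Proof.
apply/funext => n; rewrite /series /=; elim/big_rec2: _ => // k x y _ <-.
exact: Im_add.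
Qed.

Lemma real_dominated_series_cvg (u v : nat -> R) :
  (forall n, `|u n| <= v n) -> cvgn (series v) -> cvgn (series u).
Proof.
move=> uv cv; apply: (@normed_cvg _ R^o) => /=.
have v0 n : 0 <= v n by exact: le_trans (normr_ge0 _) (uv n).
by apply: series_le_cvg cv => // n; exact: normr_ge0.
Qed.

Lemma dominated_complex_series_cvg (u : nat -> R[i]) (v : nat -> R) :
  (forall n, rnorm (u n) <= v n) -> cvgn (series v) -> cvgn (series u).
Proof.
move=> uv cv.
have cR : cvgn (series (fun n => complex.Re (u n))).
  by apply: real_dominated_series_cvg cv => n; exact: le_trans (normRe_le _) (uv n).
have cI : cvgn (series (fun n => complex.Im (u n))).
  by apply: real_dominated_series_cvg cv => n; exact: le_trans (normIm_le _) (uv n).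
apply: (cvgP (limn (series (fun n => complex.Re (u n))) +i*
              limn (series (fun n => complex.Im (u n))))).
by apply: cvg_ReIm => /=; [rewrite Re_series|rewrite Im_series].
Qed.

Lemma geometric_series_cvg (B x : R) : 0 <= x < 1 ->
  cvgn (series (fun n => B * x ^+ n)).
Proof.
by move=> /andP[x0 x1]; apply: is_cvg_geometric_series; rewrite ger0_norm.
Qed.

Lemma cvg_uniq (V : normedModType R[i]) (u : nat -> V) (x y : V) :
  u @ \oo --> x -> u @ \oo --> y -> x = y.
Proof. by move=> ux uy; exact: (cvg_unique (@norm_hausdorff _ _) ux uy). Qed.

End Series.

Section HilbertSpace.
Variables (R : realType) (E : completeNormedModType R[i]).
Variable dot : {dot E for @Num.conj R[i]}.
Hypothesis dot_norm : induces_norm dot.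
Implicit Types (x y w : E) (c : R[i]).

Lemma dotDl x y w : dot (x + y) w = dot x w + dot y w.
Proof. exact: linearDl. Qed.

Lemma dotBl x y w : dot (x - y) w = dot x w - dot y w.
Proof. exact: linearBl. Qed.

Lemma dotZl c x w : dot (c *: x) w = c * dot x w.
Proof. exact: linearZl_LR. Qed.

Lemma dotC x y : dot y x = (dot x y)^*.
Proof. by rewrite hermC expr0 mul1r. Qed.

Lemma dot0l x : dot 0 x = 0.
Proof. exact: linear0l. Qed.

Lemma dotDr x y w : dot w (x + y) = dot w x + dot w y.
Proof. by rewrite dotC dotDl rmorphD/= -!dotC. Qed.

Lemma dotBr x y w : dot w (x - y) = dot w x - dot w y.
Proof. by rewrite dotC dotBl rmorphB/= -!dotC. Qed.

Lemma dotZr c x w : dot w (c *: x) = c^* * dot w x.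
Proof. by rewrite dotC dotZl rmorphM/= -dotC. Qed.

Lemma dot0r x : dot x 0 = 0.
Proof. by rewrite dotC dot0l rmorph0. Qed.

Lemma dot_suml (I : Type) (s : seq I) (F : I -> E) w :
  dot (\sum_(i <- s) F i) w = \sum_(i <- s) dot (F i) w.
Proof.
elim/big_rec2: _ => [|i x y _ <-]; [exact: dot0l|exact: dotDl].
Qed.

Lemma dot_self x : dot x x = (rnorm x ^+ 2)%:C.
Proof. by rewrite -dot_norm rnormE rmorphXn. Qed.

Lemma sqr_rnormD x y :
  rnorm (x + y) ^+ 2 = rnorm x ^+ 2 + rnorm y ^+ 2 + 2 * complex.Re (dot x y).
Proof.
apply: complexI; rewrite -dot_self dotDl !dotDr (dotC x y) !dot_self.
case: (dot x y) => a b /=; apply/eqP; rewrite eq_complex /=.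
by apply/andP; split; apply/eqP; ring.
Qed.

Lemma rnorm_dot x y : rnorm (dot x y) <= rnorm x * rnorm y.
Proof.
have [->|y0] := eqVneq y 0; first by rewrite dot0r !rnorm0 mulr0.
have ny : 0 < rnorm y by rewrite lt_neqAle rnorm_ge0 eq_sym rnorm_eq0 y0.
pose k := (rnorm y ^+ 2)^-1; pose d := dot x y.
have ky : k * rnorm y ^+ 2 = 1 by rewrite mulVf// gt_eqF// exprn_gt0.
have := sqr_ge0 (rnorm (x + (- k%:C * d) *: y)).
rewrite sqr_rnormD rnormZ exprMn dotZr -/d.
rewrite rnormM rnormN rnorm_real exprMn real_normK ?num_real//.
have -> : complex.Re ((- k%:C * d)^* * d) = - k * rnorm d ^+ 2.
  by rewrite sqr_rnorm; case: (d) => a b /=; ring.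
have -> : k ^+ 2 * rnorm d ^+ 2 * rnorm y ^+ 2 =
    k * rnorm d ^+ 2 * (k * rnorm y ^+ 2) by ring.
rewrite ky mulr1 => H.
have H2 : k * rnorm d ^+ 2 <= rnorm x ^+ 2 by lra.
rewrite -(@ler_pXn2r _ 2)// ?nnegrE ?mulr_ge0 ?rnorm_ge0// exprMn.
have := ler_wpM2r (sqr_ge0 (rnorm y)) H2.
by rewrite mulrAC ky mul1r.
Qed.

Lemma cvg_dotl (u : nat -> E) x w : u @ \oo --> x ->
  dot (u n) w @[n --> \oo] --> dot x w.
Proof.
move=> /cvg_rnormP ux; apply/cvg_rnormP.
apply: (@squeeze_cvgr _ _ _ _ (cst 0) (fun n => rnorm (u n - x) * rnorm w)).
- by apply: nearW => n; rewrite rnorm_ge0 -dotBl rnorm_dot.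
- exact: cvg_cst.
- by rewrite -[X in _ --> X](mul0r (rnorm w)); apply: cvgM => //; exact: cvg_cst.
Qed.

(** A minimizing sequence of [rnorm x ^+ 2 - 2 * Re (phi x)] is Cauchy by the
    parallelogram identity, and the Euler equation of its limit is the
    representation. *)
Theorem riesz_representation (phi : E -> R[i]) (C : R) : 0 <= C ->
  (forall x y, phi (x + y) = phi x + phi y) ->
  (forall c x, phi (c *: x) = c * phi x) ->
  (forall x, rnorm (phi x) <= C * rnorm x) ->
  exists2 w, forall x, phi x = dot x w & rnorm w <= C.
Proof.
move=> C0 phiD phiZ phiC.
pose f x := complex.Re (phi x); pose J x : R := rnorm x ^+ 2 - 2 * f x.
have J_ge x : - (C ^+ 2) <= J x.
  have : f x <= C * rnorm x := le_trans (Re_le_rnorm _) (phiC x).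
  by have := sqr_ge0 (rnorm x - C); rewrite /J sqrrB; lra.
pose m := inf (range J).
have hasinf : has_inf (range J).
  split; first by exists (J 0); exists 0.
  by exists (- (C ^+ 2)) => _ [x _ <-].
have mJ x : m <= J x by apply: ge_inf; [case: hasinf|exists x].
have parallelogram x y :
    rnorm (x - y) ^+ 2 <= 2 * (J x - m) + 2 * (J y - m).
  have := mJ ((2^-1)%:C *: (x + y)).
  rewrite /J /f phiZ phiD rnormZ rnorm_real ger0_norm ?invr_ge0//.
  have E1 : rnorm (x + y) ^+ 2 + rnorm (x - y) ^+ 2 =
      2 * rnorm x ^+ 2 + 2 * rnorm y ^+ 2.
    rewrite !sqr_rnormD rnormN -scaleN1r dotZr rmorphN rmorph1 mulN1r Re_opp.
    by ring.
  have -> : complex.Re ((2^-1)%:C * (phi x + phi y)) = 2^-1 * (f x + f y).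
    by rewrite Re_mul /= mul0r subr0 Re_add.
  rewrite exprMn -/(f x) -/(f y) => H.
  have -> : rnorm (x - y) ^+ 2 =
    2 * rnorm x ^+ 2 + 2 * rnorm y ^+ 2 - rnorm (x + y) ^+ 2 by rewrite -E1; ring.
  lra.
have ex n : exists x, J x < m + n.+1%:R^-1.
  have n0 : 0 < (n.+1%:R : R)^-1 by rewrite invr_gt0.
  have [_ [x _ <-] xm] := inf_adherent n0 hasinf.
  by exists x.
have [u uP] := choice ex.
have /cvg_ex[w uw] : cvgn u.
  apply: cauchy_rnorm_cvg => e e0.
  have e0' : 0 < e ^+ 2 / 4 by rewrite divr_gt0// exprn_gt0.
  have /cvgrPdist_lt/(_ _ e0')[N _ NP] := @cvg_harmonic R.
  exists N => p q Np Nq; rewrite -(@ltr_pXn2r _ 2)// ?nnegrE ?rnorm_ge0 ?ltW//.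
  apply: le_lt_trans (parallelogram _ _) _.
  have := NP _ Np; have := NP _ Nq; rewrite /= !sub0r !normrN.
  rewrite !ger0_norm ?invr_ge0//; have := uP p; have := uP q.
  move: (p.+1%:R^-1 : R) (q.+1%:R^-1 : R) => hp hq; lra.
have euler h : f h = complex.Re (dot h w).
  have ineq (t : R) : 2 * t * (f h - complex.Re (dot h w)) <= t ^+ 2 * rnorm h ^+ 2.
    have cd := cvg_Re _ (@cvg_dotl u w h uw).
    have cl : 2 * t * (f h - complex.Re (dot (u n) h)) @[n --> \oo] -->
        2 * t * (f h - complex.Re (dot w h)).
      by apply: cvgM; [exact: cvg_cst|apply: cvgB; [exact: cvg_cst|exact: cd]].
    have cr : n.+1%:R^-1 + t ^+ 2 * rnorm h ^+ 2 @[n --> \oo] -->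
        0 + t ^+ 2 * rnorm h ^+ 2.
      by apply: cvgD; [exact: cvg_harmonic|exact: cvg_cst].
    have -> : complex.Re (dot h w) = complex.Re (dot w h).
      by rewrite dotC; case: (dot w h).
    rewrite -[leRHS]add0r; apply: ler_cvg_to cl cr _.
    apply: nearW => n; have := mJ (u n + t%:C *: h); have := uP n.
    rewrite /J /f phiD phiZ sqr_rnormD rnormZ rnorm_real exprMn real_normK ?num_real//.
    have -> : complex.Re (dot (u n) (t%:C *: h)) = t * complex.Re (dot (u n) h).
      by rewrite dotZr; case: (dot _ _) => a b /=; ring.
    have -> : complex.Re (phi (u n) + t%:C * phi h) = f (u n) + t * f h.
      by rewrite Re_add Re_mul /= mul0r subr0.
    rewrite -!/(f _); move: (n.+1%:R^-1 : R) => q ? ?; lra.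
  have small (x : R) (k : R) : (forall t, 2 * t * x <= t ^+ 2 * k) -> 0 <= k -> x = 0.
    move=> H k0; have k1 : 0 < k + 1 by lra.
    have := H (x / (k + 1)); have := H (x / (k + 1)).
    have -> : 2 * (x / (k + 1)) * x = 2 * (k + 1) * (x / (k + 1)) ^+ 2.
      by field; rewrite gt_eqF.
    move: (x / (k + 1)) (divfK (lt0r_neq0 k1) x) => y <- {H} H _.
    have : y ^+ 2 <= 0 by have := mulr_ge0 k0 (sqr_ge0 y); lra.
    by rewrite exprn_even_le0//= => /eqP ->; rewrite mul0r.
  by apply/eqP; rewrite -subr_eq0; apply/eqP/(small _ _ ineq)/sqr_ge0.
exists w => [x|].
  apply/eqP; rewrite eq_complex; apply/andP; split; first exact/eqP/euler.
  have := euler (- 'i *: x); rewrite /f phiZ dotZl.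
  by case: (phi x) => a b; case: (dot x w) => c d /=; rewrite !mulN1r => ?; apply/eqP; lra.
have [->|w0] := eqVneq w 0; first by rewrite rnorm0.
have nw : 0 < rnorm w by rewrite lt_neqAle rnorm_ge0 eq_sym rnorm_eq0 w0.
rewrite -(ler_pM2r nw) -expr2; apply: le_trans (phiC w).
have -> : rnorm w ^+ 2 = f w by rewrite euler dot_self.
exact: Re_le_rnorm.
Qed.

End HilbertSpace.

(** * Uniqueness of Taylor coefficients *)

Section PowerSeries.
Variables (R : realType) (V : normedModType R[i]).
Implicit Types (z : R[i]) (a b d : nat -> V).

Lemma norm_lt1 z : (`|z| < 1) = (rnorm z < 1).
Proof. by rewrite rnormE (_ : 1 = 1%:C)// ltcR. Qed.

Lemma eq_seq_cvg (u v : nat -> V) (l : V) : u =1 v ->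
  u @ \oo --> l -> v @ \oo --> l.
Proof. by move=> /funext ->. Qed.

Lemma series_bounded (u : nat -> V) (l : V) : series u @ \oo --> l ->
  exists B : R, forall n, rnorm (u n) <= B.
Proof.
move=> ul; have un : rnorm (series u n) @[n --> \oo] --> rnorm l by exact: cvg_rnorm.
have [B [_ BP]] := cvg_seq_bounded (cvgP _ un).
have H n : rnorm (series u n) <= B + 1.
  have := BP (B + 1) _ n I; rewrite ltrDl ltr01 => /(_ isT) /=.
  by apply: le_trans; exact: ler_norm.
exists ((B + 1) + (B + 1)) => n.
have -> : u n = series u n.+1 - series u n.
  by rewrite seriesB_sum// big_nat1.
by apply: le_trans (rnormB _ _) _; exact: lerD.
Qed.

Lemma sum_half_pow n : \sum_(0 <= k < n) (2^-1 : R) ^+ k <= 2.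
Proof.
suff -> : \sum_(0 <= k < n) (2^-1 : R) ^+ k = 2 - 2 * 2^-1 ^+ n.
  have : 0 <= (2^-1 : R) ^+ n by rewrite exprn_ge0// invr_ge0.
  lra.
elim: n => [|n IH]; first by rewrite big_nil expr0; ring.
by rewrite big_nat_recr//= IH exprS; move: (2^-1 ^+ n : R) => x; lra.
Qed.

(** The origin is excluded since this is also applied to a series obtained from
    another one by division by [z]; the limit at the origin identifies the
    coefficient of order [0]. *)
Lemma punctured_series_near0 (f : R[i] -> V) d :
  (forall z, z != 0 -> rnorm z < 1 ->
    series (fun n => z ^+ n *: d n) @ \oo --> f z) ->
  exists2 C : R, 0 <= C &
    forall x, 0 < x -> x <= 4^-1 -> rnorm (f x%:C - d 0%N) <= C * x.
Proof.
move=> fd; have h0 : (2^-1)%:C != 0 :> R[i].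
  by rewrite -rnorm_eq0 rnorm_real normr_eq0.
have hn : rnorm (2^-1)%:C = 2^-1 :> R by rewrite rnorm_real ger0_norm.
have [|B BP] := series_bounded (fd _ h0 _); first by rewrite hn invf_lt1// ltr1n.
have dB k : rnorm (d k) <= B * 2 ^+ k.
  have := BP k; rewrite rnormZ rnormX hn exprVn mulrC.
  by rewrite ler_pdivrMr ?exprn_gt0.
have B0 : 0 <= B by apply: le_trans (BP 0%N); exact: rnorm_ge0.
exists (4 * B) => [|x x0 x4]; first by rewrite mulr_ge0.
have xC0 : x%:C != 0 :> R[i].
  by rewrite -rnorm_eq0 rnorm_real normr_eq0 gt_eqF.
have xC1 : rnorm x%:C < 1 by rewrite rnorm_real gtr0_norm//; lra.
pose S n := series (fun n => x%:C ^+ n *: d n) n.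
have cS : S n - d 0%N @[n --> \oo] --> f x%:C - d 0%N.
  by apply: cvgB; [exact: fd|exact: cvg_cst].
apply: (ler_cvg_to (cvg_rnorm _ cS) (cvg_cst (4 * B * x))).
exists 1%N => // n /= n1.
have -> : S n - d 0%N = \sum_(1 <= k < n) x%:C ^+ k *: d k.
  by rewrite /S /series /= big_ltn// expr0 scale1r addrC addKr.
apply: le_trans (rnorm_sum _ _ _) _.
apply: le_trans (_ : \sum_(1 <= k < n) 2 * B * x * 2^-1 ^+ k.-1 <= _).
  apply: ler_sum_nat => -[//|k] _ /=.
  rewrite rnormZ rnormX rnorm_real gtr0_norm//.
  apply: le_trans (ler_wpM2l (exprn_ge0 _ (ltW x0)) (dB _)) _.
  rewrite mulrCA -exprMn exprS.
  have -> : 2 * B * x * 2^-1 ^+ k = B * (x * 2 * 2^-1 ^+ k) by ring.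
  rewrite ler_wpM2l// ler_wpM2l ?mulr_ge0 ?(ltW x0)// lerXn2r ?nnegrE; lra.
rewrite -mulr_sumr big_add1 /=.
have := ler_wpM2l (_ : 0 <= 2 * B * x) (sum_half_pow n.-1).
have -> : 2 * B * x * 2 = 4 * B * x by ring.
by apply; rewrite !mulr_ge0// ltW.
Qed.

Lemma le_small_eq0 (y C : R) : 0 <= y -> 0 <= C ->
  (forall x, 0 < x -> x <= 4^-1 -> y <= C * x) -> y = 0.
Proof.
move=> y0 C0 bound; apply/eqP; rewrite eq_le y0 andbT.
apply/ler_addgt0Pl => e e0; rewrite addr0.
pose x := Num.min 4^-1 (e / (C + 1)).
have c0 : 0 < C + 1 by lra.
have x0 : 0 < x by rewrite lt_min invr_gt0 divr_gt0// ltr0n.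
have x4 : x <= 4^-1 by rewrite ge_min lexx.
apply: le_trans (bound x x0 x4) _.
have : x * (C + 1) <= e by rewrite -ler_pdivlMr// ge_min lexx orbT.
lra.
Qed.

Definition null_series d := forall z, z != 0 -> rnorm z < 1 ->
  series (fun n => z ^+ n *: d n) @ \oo --> (0 : V).

Lemma null_series0 d : null_series d -> d 0%N = 0.
Proof.
move=> /(@punctured_series_near0 (fun=> 0))[C C0 CP].
apply/eqP; rewrite -rnorm_eq0; apply/eqP/(le_small_eq0 _ C0) => [|x x0 x4].
  exact: rnorm_ge0.
by have := CP x x0 x4; rewrite sub0r rnormN.
Qed.

Lemma null_series_shift d : null_series d -> null_series (fun n => d n.+1).
Proof.
move=> nd z z0 z1; have d0 := null_series0 nd.
have cS : (fun n => series (fun k => z ^+ k *: d k) (n + 1)%N) @ \oo --> (0 : V).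
  by rewrite (cvg_shiftn 1); exact: nd.
have SE : (fun n => series (fun k => z ^+ k *: d k) (n + 1)%N) =
    (fun n => z *: series (fun k => z ^+ k *: d k.+1) n).
  apply/funext => n; rewrite addn1 /series /= big_nat_recl// d0 scaler0 add0r.
  by rewrite scaler_sumr; apply: eq_bigr => k _; rewrite exprS scalerA.
rewrite SE in cS.
have H : z^-1 *: (z *: series (fun k => z ^+ k *: d k.+1) n) @[n --> \oo] -->
    z^-1 *: (0 : V) by apply: cvgZ => //; exact: cvg_cst.
rewrite scaler0 in H; refine (eq_seq_cvg _ H) => n /=.
by rewrite scalerA mulVf// scale1r.
Qed.

Lemma null_series_eq0 d : null_series d -> forall n, d n = 0.
Proof.
move=> nd n; elim: n d nd => [|n IH] d nd; first exact: null_series0.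
exact: (IH (fun n => d n.+1) (null_series_shift nd)).
Qed.

Lemma punctured_taylor_unique (f : R[i] -> V) a b :
  (forall z, z != 0 -> rnorm z < 1 ->
    series (fun n => z ^+ n *: a n) @ \oo --> f z) ->
  (forall z, z != 0 -> rnorm z < 1 ->
    series (fun n => z ^+ n *: b n) @ \oo --> f z) -> a = b.
Proof.
move=> fa fb; apply/funext => n; apply/eqP; rewrite -subr_eq0; apply/eqP.
apply: (@null_series_eq0 (fun n => a n - b n)) => z z0 z1.
have H : (series (fun n => z ^+ n *: a n) - series (fun n => z ^+ n *: b n))
    @ \oo --> f z - f z by apply: cvgB; [exact: fa|exact: fb].
rewrite subrr in H; refine (eq_seq_cvg _ H) => m.
transitivity (series (fun n => z ^+ n *: a n) m - series (fun n => z ^+ n *: b n) m) => //.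
by rewrite /series /= -sumrB; apply: eq_bigr => k _; rewrite scalerBr.
Qed.

End PowerSeries.

(** * Taylor series of bounded vector-valued holomorphic functions *)

Section HolomorphicTaylor.
Variables (R : realType) (E : completeNormedModType R[i]).
Variable dot : {dot E for @Num.conj R[i]}.
Hypothesis dot_norm : induces_norm dot.

Lemma bounded_series_cvg (a : nat -> E) (B : R) (z : R[i]) :
  (forall n, rnorm (a n) <= B) -> rnorm z < 1 ->
  cvgn (series (fun n => z ^+ n *: a n)).
Proof.
move=> aB z1; apply: (@dominated_series_cvg _ _ _ (fun n => B * rnorm z ^+ n)).
  by move=> n; rewrite rnormZ rnormX mulrC ler_wpM2r ?exprn_ge0 ?rnorm_ge0.
by apply: geometric_series_cvg; rewrite rnorm_ge0.
Qed.

(** Each [fun z => dot (F z) x] is a scalar function, and its coefficients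
    depend on [x] antilinearly and boundedly, hence are represented by
    vectors. *)
Theorem holomorphic_taylor (F : R[i] -> E) (M : R) : 0 <= M ->
  (forall z, rnorm z < 1 -> exists A : E, forall e, 0 < e ->
    exists2 d, 0 < d & forall w, rnorm (w - z) < d ->
      rnorm (F w - F z - (w - z) *: A) <= e * rnorm (w - z)) ->
  (forall z, rnorm z < 1 -> rnorm (F z) <= M) ->
  exists2 a, (forall n, rnorm (a n) <= 4 * M) & taylor_coefs F a.
Proof.
move=> M0 dF bF.
have /choice[c cP] : forall x, exists c : nat -> R[i],
    (forall n, rnorm (c n) <= 4 * M * rnorm x) /\
    forall z : R[i], rnorm z < 1 ->
      series (fun n => z ^+ n * c n) @ \oo --> dot (F z) x.
  move=> x; have [z z1|z z1|c c1 c2] := @scalar_taylor R (fun z => dot (F z) x) (M * rnorm x).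
  - have [A AP] := dF z z1.
    apply: (approx_has_slope (A := dot A x)) => e e0.
    have x1 : 0 < rnorm x + 1 by have := rnorm_ge0 x; lra.
    have [d d0 dP] := AP (e / (rnorm x + 1)) (divr_gt0 e0 x1).
    exists d => // w wd; rewrite -!dotBl -dotZl -dotBl.
    apply: le_trans (rnorm_dot dot_norm _ _) _.
    apply: le_trans (ler_wpM2r (rnorm_ge0 x) (dP w wd)) _.
    rewrite mulrAC ler_wpM2r ?rnorm_ge0// mulrAC ler_pdivrMr// ler_pM2l//.
    by rewrite lerDl.
  - apply: le_trans (rnorm_dot dot_norm _ _) _.
    by rewrite ler_wpM2r ?rnorm_ge0 ?bF.
  by exists c; split=> // n; rewrite -mulrA.
have c_uniq x (b : nat -> R[i]) : (forall z : R[i], rnorm z < 1 ->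
    series (fun n => z ^+ n * b n) @ \oo --> dot (F z) x) -> c x = b.
  move=> bP; apply: (@punctured_taylor_unique R R[i] (fun z => dot (F z) x)).
    by move=> z _ z1; exact: (cP x).2.
  by move=> z _ z1; exact: bP.
have cD x y n : c (x + y) n = c x n + c y n.
  have -> // : c (x + y) = fun n => c x n + c y n.
  apply: c_uniq => z z1; rewrite dotDr.
  have H : (series (fun n => z ^+ n * c x n) + series (fun n => z ^+ n * c y n))
      @ \oo --> dot (F z) x + dot (F z) y.
    by apply: cvgD; [exact: (cP x).2|exact: (cP y).2].
  refine (eq_seq_cvg _ H) => m.
  transitivity (series (fun n => z ^+ n * c x n) m + series (fun n => z ^+ n * c y n) m) => //.
  by rewrite /series /= -big_split; apply: eq_bigr => k _; rewrite mulrDr.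
have cZ k x n : c (k *: x) n = k^* * c x n.
  have -> // : c (k *: x) = fun n => k^* * c x n.
  apply: c_uniq => z z1; rewrite dotZr.
  have H : k^* * series (fun n => z ^+ n * c x n) n @[n --> \oo] -->
      k^* * dot (F z) x.
    by apply: cvgM; [exact: cvg_cst|exact: (cP x).2].
  refine (eq_seq_cvg _ H) => m.
  by rewrite /series /= mulr_sumr; apply: eq_bigr => j _; rewrite mulrCA.
have /choice[a aP] : forall n, exists w : E,
    (forall x, c x n = dot w x) /\ rnorm w <= 4 * M.
  move=> n; have [|x y|k x|x|w wP w4] :=
      @riesz_representation _ _ _ dot_norm (fun x => (c x n)^*) (4 * M).
  - by rewrite mulr_ge0.
  - by rewrite cD rmorphD.
  - by rewrite cZ rmorphM /= conjcK.
  - by rewrite rnorm_conj; exact: (cP x).1.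
  by exists w; split => // x; rewrite dotC -wP conjcK.
exists a => [n|z]; first by case: (aP n).
rewrite norm_lt1 => z1.
have /cvg_ex[l al] := bounded_series_cvg (fun n => (aP n).2) z1.
suff <- : l = F z by [].
apply/eqP; rewrite -subr_eq0 -rnorm_eq0 -sqrf_eq0; apply/eqP/complexI.
rewrite -(dot_self dot_norm); set y := l - F z.
suff -> : dot y y = dot l y - dot (F z) y.
  have := cvg_dotl dot_norm (w := y) al; have := (cP y).2 z z1.
  have -> : (fun n => dot (series (fun n => z ^+ n *: a n) n) y) =
      series (fun n => z ^+ n * c y n).
    apply/funext => n; rewrite /series /= dot_suml; apply: eq_bigr => k _.
    by rewrite dotZl (aP k).1.
  by move=> h1 h2; rewrite (cvg_uniq h1 h2) subrr.
by rewrite {1}/y dotBl.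
Qed.

End HolomorphicTaylor.

(** * Square-summable sequences *)

Section SquareSummable.
Variables (R : realType) (E : completeNormedModType R[i]).
Variable dot : {dot E for @Num.conj R[i]}.
Hypothesis dot_norm : induces_norm dot.
Implicit Types (a b c : nat -> E).

Definition l2 a := cvgn (series (fun n => rnorm (a n) ^+ 2)).

Definition l2sq a : R := limn (series (fun n => rnorm (a n) ^+ 2)).

Definition l2dot a b : R[i] := limn (series (fun n => dot (a n) (b n))).

Definition l2norm a : R := Num.sqrt (l2sq a).

Lemma series_sqr_nondecreasing a : nondecreasing_seq (series (fun n => rnorm (a n) ^+ 2)).
Proof. by apply/nondecreasing_series => n _ _; exact: sqr_ge0. Qed.

Lemma l2_of_bound a (B : R) :
  (forall n, \sum_(0 <= k < n) rnorm (a k) ^+ 2 <= B) -> l2 a.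
Proof.
move=> aB; apply: nondecreasing_is_cvgn; first exact: series_sqr_nondecreasing.
by exists B => _ [n _ <-]; exact: aB.
Qed.

Lemma l2sq_le_bound a (B : R) :
  (forall n, \sum_(0 <= k < n) rnorm (a k) ^+ 2 <= B) -> l2sq a <= B.
Proof.
move=> aB; apply: limr_le; first exact: l2_of_bound aB.
by apply: nearW => n; exact: aB.
Qed.

Lemma sum_le_l2sq a n : l2 a -> \sum_(0 <= k < n) rnorm (a k) ^+ 2 <= l2sq a.
Proof.
by move=> la; apply: (nondecreasing_cvgn_le (series_sqr_nondecreasing a) la n).
Qed.

Lemma l2sq_ge0 a : l2 a -> 0 <= l2sq a.
Proof. by move=> /(sum_le_l2sq 0); rewrite big_nil. Qed.

Lemma sqr_l2norm a : l2 a -> l2norm a ^+ 2 = l2sq a.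
Proof. by move=> la; rewrite sqr_sqrtr// l2sq_ge0. Qed.

Lemma term_le_l2sq a n : l2 a -> rnorm (a n) ^+ 2 <= l2sq a.
Proof.
move=> la; apply: le_trans (sum_le_l2sq n.+1 la).
by rewrite big_nat_recr//= lerDr sumr_ge0// => k _; exact: sqr_ge0.
Qed.

Lemma l2norm_eq0 a : l2 a -> l2norm a = 0 -> forall n, a n = 0.
Proof.
move=> la a0 n; apply/eqP; rewrite -rnorm_eq0 -sqrf_eq0 eq_le sqr_ge0 andbT.
by rewrite (le_trans (term_le_l2sq n la))// -sqr_l2norm// a0 expr0n.
Qed.

Lemma dot_amgm (x y : E) : rnorm (dot x y) <= rnorm x ^+ 2 + rnorm y ^+ 2.
Proof.
apply: le_trans (rnorm_dot dot_norm x y) _.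
have := sqr_ge0 (rnorm x - rnorm y); rewrite sqrrB.
have := mulr_ge0 (rnorm_ge0 x) (rnorm_ge0 y); lra.
Qed.

Lemma l2dot_cvg a b : l2 a -> l2 b ->
  series (fun n => dot (a n) (b n)) @ \oo --> l2dot a b.
Proof.
move=> la lb; apply: (@dominated_complex_series_cvg _ _
  ((fun n => rnorm (a n) ^+ 2) + (fun n => rnorm (b n) ^+ 2))).
  by move=> n; exact: dot_amgm.
by rewrite seriesD; exact: is_cvgD.
Qed.

Lemma l2_comb k a b : l2 a -> l2 b -> l2 (fun n => k *: a n + b n).
Proof.
move=> la lb; pose B := 2 * (rnorm k ^+ 2 * l2sq a) + 2 * l2sq b.
apply: (@l2_of_bound _ B) => n.
apply: le_trans (_ : \sum_(0 <= j < n) (2 * rnorm k ^+ 2 * rnorm (a j) ^+ 2 +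
    2 * rnorm (b j) ^+ 2) <= _).
  apply: ler_sum => j _; have := rnormD (k *: a j) (b j); rewrite rnormZ.
  move=> /(ler_wpM2l (rnorm_ge0 (k *: a j + b j))) h1.
  have h2 := rnormD (k *: a j) (b j); rewrite rnormZ in h2.
  have h3 := ler_wpM2r (addr_ge0 (mulr_ge0 (rnorm_ge0 k) (rnorm_ge0 (a j))) (rnorm_ge0 (b j))) h2.
  have := sqr_ge0 (rnorm k * rnorm (a j) - rnorm (b j)).
  rewrite -expr2 in h1; lra.
rewrite big_split/= -!mulr_sumr /B mulrA.
have k0 : 0 <= 2 * rnorm k ^+ 2 by rewrite mulr_ge0 ?sqr_ge0.
by apply: lerD; [apply: ler_wpM2l k0 _ _ _|apply: ler_wpM2l];
  rewrite ?ler0n//; exact: sum_le_l2sq.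
Qed.

Lemma eq_l2dot a b c d : a =1 c -> b =1 d -> l2dot a b = l2dot c d.
Proof. by move=> /funext -> /funext ->. Qed.

Lemma sum_nat_stationary (V : zmodType) (u : nat -> V) N n : (N <= n)%N ->
  (forall k, (N <= k)%N -> u k = 0) ->
  \sum_(0 <= k < n) u k = \sum_(0 <= k < N) u k.
Proof.
move=> Nn u0; rewrite (big_cat_nat (n := N))//=.
have -> : \sum_(N <= k < n) u k = 0; last by rewrite addr0.
by rewrite big_nat_cond big1// => k /andP[/andP[Nk _] _]; exact: u0.
Qed.

Lemma l2_finite a N : (forall n, (N <= n)%N -> a n = 0) -> l2 a.
Proof.
move=> a0; apply: (@l2_of_bound _ (\sum_(0 <= k < N) rnorm (a k) ^+ 2)) => n.
have [nN|/ltnW Nn] := leqP n N.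
  rewrite (big_cat_nat (n := n) (p := N))//= lerDl sumr_ge0// => k _.
  exact: sqr_ge0.
rewrite (sum_nat_stationary Nn)// => k Nk.
by rewrite a0// rnorm0 expr0n.
Qed.

Lemma series_finite_cvg (V : normedModType R[i]) (u : nat -> V) N :
  (forall n, (N <= n)%N -> u n = 0) ->
  series u @ \oo --> \sum_(0 <= k < N) u k.
Proof.
move=> u0; apply: cvg_near_cst; exists N => // n /= Nn; rewrite /series /=.
exact: sum_nat_stationary.
Qed.

Lemma l2dot_finitel a b N : (forall n, (N <= n)%N -> a n = 0) ->
  l2dot a b = \sum_(0 <= k < N) dot (a k) (b k).
Proof.
move=> a0; apply: cvg_lim; first exact: norm_hausdorff.
by apply: series_finite_cvg => n Nn; rewrite a0// dot0l.
Qed.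

Lemma l2dot_finiter a b N : (forall n, (N <= n)%N -> b n = 0) ->
  l2dot a b = \sum_(0 <= k < N) dot (a k) (b k).
Proof.
move=> b0; apply: cvg_lim; first exact: norm_hausdorff.
by apply: series_finite_cvg => n Nn; rewrite b0// dot0r.
Qed.

Lemma l2sq_finite a N : (forall n, (N <= n)%N -> a n = 0) ->
  l2sq a = \sum_(0 <= k < N) rnorm (a k) ^+ 2.
Proof.
move=> a0; apply: cvg_lim; first exact: norm_hausdorff.
apply: cvg_near_cst; exists N => // n /= Nn; rewrite /series /=.
rewrite (sum_nat_stationary Nn)// => k Nk.
by rewrite a0// rnorm0 expr0n.
Qed.

Lemma l2dot_comb k a b c : l2 a -> l2 b -> l2 c ->
  l2dot (fun n => k *: a n + b n) c = k * l2dot a c + l2dot b c.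
Proof.
move=> la lb lc; refine (cvg_uniq (l2dot_cvg (l2_comb (k := k) la lb) lc) _).
have H : (fun n => k * series (fun n => dot (a n) (c n)) n) +
    series (fun n => dot (b n) (c n)) @ \oo --> k * l2dot a c + l2dot b c.
  apply: cvgD; last exact: l2dot_cvg.
  by apply: cvgM; [exact: cvg_cst|exact: l2dot_cvg].
refine (eq_seq_cvg _ H) => m.
transitivity (k * series (fun n => dot (a n) (c n)) m + series (fun n => dot (b n) (c n)) m) => //.
rewrite /series /= mulr_sumr -big_split; apply: eq_bigr => j _ /=.
by rewrite dotDl dotZl.
Qed.

Lemma l2dotC a b : l2 a -> l2 b -> l2dot b a = (l2dot a b)^*.
Proof.
move=> la lb; refine (cvg_uniq (l2dot_cvg lb la) _).
have H : (series (fun n => dot (a n) (b n)) n)^* @[n --> \oo] --> (l2dot a b)^*.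
  have /cvg_rnormP H := l2dot_cvg la lb; apply/cvg_rnormP.
  have -> // : (fun n => rnorm ((series (fun n => dot (a n) (b n)) n)^* - (l2dot a b)^*)) =
      (fun n => rnorm (series (fun n => dot (a n) (b n)) n - l2dot a b)).
  by apply/funext => n; rewrite -rmorphB rnorm_conj.
refine (eq_seq_cvg _ H) => m; rewrite /series /= rmorph_sum.
by apply: eq_bigr => j _; exact/esym/dotC.
Qed.

Lemma l2dot_self a : l2 a -> l2dot a a = (l2sq a)%:C.
Proof.
move=> la; refine (cvg_uniq (l2dot_cvg la la) _).
apply: cvg_ReIm => /=.
  rewrite Re_series (_ : (fun n => _) = (fun n => rnorm (a n) ^+ 2))//.
  by apply/funext => n; rewrite dot_self.
rewrite Im_series (_ : (fun n => _) = (fun n => 0)); last first.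
  by apply/funext => n; rewrite dot_self.
rewrite (_ : series _ = cst 0); first exact: cvg_cst.
by apply/funext => n; rewrite /series /= big1.
Qed.

(** Weighted arithmetic-geometric means pass to the limit termwise; the weight is
    then optimized, with [d] keeping it away from [0] and infinity. *)
Lemma l2_cauchy_schwarz a b : l2 a -> l2 b ->
  rnorm (l2dot a b) <= l2norm a * l2norm b.
Proof.
move=> la lb.
have weighted (t : R) : 0 < t ->
    rnorm (l2dot a b) <= (t * l2sq a + l2sq b / t) / 2.
  move=> t0; apply: (ler_cvg_to (cvg_rnorm _ (l2dot_cvg la lb)) (cvg_cst _)).
  apply: nearW => n; apply: le_trans (rnorm_sum _ _ _) _.
  apply: le_trans (_ : \sum_(0 <= j < n) (t / 2 * rnorm (a j) ^+ 2 +
      (t * 2)^-1 * rnorm (b j) ^+ 2) <= _).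
    apply: ler_sum => j _; apply: le_trans (rnorm_dot dot_norm _ _) _.
    have := divr_ge0 (sqr_ge0 (t * rnorm (a j) - rnorm (b j))) (_ : 0 <= 2 * t).
    move=> /(_ (mulr_ge0 _ _)); rewrite ler0n => /(_ isT (ltW t0)).
    have -> : (t * rnorm (a j) - rnorm (b j)) ^+ 2 / (2 * t) =
      t / 2 * rnorm (a j) ^+ 2 + (t * 2)^-1 * rnorm (b j) ^+ 2 -
      rnorm (a j) * rnorm (b j) by field; rewrite gt_eqF.
    lra.
  rewrite big_split/= -!mulr_sumr.
  have -> : (t * l2sq a + l2sq b / t) / 2 = t / 2 * l2sq a + (t * 2)^-1 * l2sq b.
    by field; rewrite gt_eqF.
  apply: lerD; apply: ler_wpM2l; rewrite ?invr_ge0 ?divr_ge0 ?mulr_ge0 ?(ltW t0)//;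
    exact: sum_le_l2sq.
apply/ler_addgt0Pl => e e0.
set x := l2norm a; set y := l2norm b.
have x0 : 0 <= x by exact: sqrtr_ge0.
have y0 : 0 <= y by exact: sqrtr_ge0.
pose d := Num.min 1 (e / (x + y + 1)).
have c0 : 0 < x + y + 1 by lra.
have d0 : 0 < d by rewrite lt_min ltr01 divr_gt0.
have d1 : d <= 1 by rewrite ge_min lexx.
have de : d * (x + y + 1) <= e by rewrite -ler_pdivlMr// ge_min lexx orbT.
have xd : 0 < x + d by lra.
have yd : 0 < y + d by lra.
apply: le_trans (weighted ((y + d) / (x + d)) (divr_gt0 yd xd)) _.
rewrite -(sqr_l2norm la) -(sqr_l2norm lb) -/x -/y.
have h1 : (y + d) / (x + d) * x ^+ 2 <= (y + d) * (x + d).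
  rewrite mulrAC ler_pdivrMr// -mulrA ler_pM2l// -expr2 lerXn2r ?nnegrE; lra.
have h2 : y ^+ 2 / ((y + d) / (x + d)) <= (y + d) * (x + d).
  rewrite invf_div mulrA ler_pdivrMr//.
  have -> : (y + d) * (x + d) * (y + d) = (y + d) ^+ 2 * (x + d) by ring.
  rewrite ler_pM2r//.
  by rewrite lerXn2r ?nnegrE; lra.
have := ler_wpM2l (ltW d0) d1.
lra.
Qed.

Definition rshift a n : E := if n is m.+1 then a m else 0.

Definition lshift a n : E := a n.+1.

Lemma l2_rshift a : l2 a -> l2 (rshift a).
Proof.
move=> la; apply: (@l2_of_bound _ (l2sq a)) => -[|n].
  by rewrite big_nil l2sq_ge0.
by rewrite big_nat_recl//= rnorm0 expr0n add0r sum_le_l2sq.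
Qed.

Lemma l2_lshift a : l2 a -> l2 (lshift a).
Proof.
move=> la; apply: (@l2_of_bound _ (l2sq a)) => n.
apply: le_trans (sum_le_l2sq n.+1 la).
by rewrite big_nat_recl//= lerDr sqr_ge0.
Qed.

(** The partial sums of the two sides agree up to an index shift. *)
Lemma l2dot_rshift a b : l2dot (rshift a) b = l2dot a (lshift b).
Proof.
rewrite /l2dot; set u := series _; set v := series _.
have uv l : (u @ \oo --> l) = (v @ \oo --> l).
  rewrite -(cvg_shiftS u); congr (_ @ \oo --> l); apply/funext => n.
  by rewrite /u /v /series /= big_nat_recl// dot0l add0r.
by rewrite /lim /lim_in; congr get; apply/funext => l; rewrite uv.
Qed.

Lemma l2dot_rshiftr a b : l2dot a (rshift b) = l2dot (lshift a) b.
Proof.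
rewrite /l2dot; set u := series _; set v := series _.
have uv l : (u @ \oo --> l) = (v @ \oo --> l).
  rewrite -(cvg_shiftS u); congr (_ @ \oo --> l); apply/funext => n.
  by rewrite /u /v /series /= big_nat_recl// dot0r add0r.
by rewrite /lim /lim_in; congr get; apply/funext => l; rewrite uv.
Qed.

End SquareSummable.

(** * The Hardy space in terms of coefficients *)

Section HardyCoefficients.
Variables (R : realType) (E : completeNormedModType R[i]).
Variable dot : {dot E for @Num.conj R[i]}.
Hypothesis dot_norm : induces_norm dot.
Implicit Types (f g : R[i] -> E) (a b : nat -> E) (k z : R[i]).

Lemma taylor_coefs_unique f a b : taylor_coefs f a -> taylor_coefs f b -> a = b.
Proof.
move=> fa fb; apply: (@punctured_taylor_unique R E f) => z _;
  rewrite -norm_lt1; [exact: fa|exact: fb].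
Qed.

Lemma coef_eq f a : taylor_coefs f a -> coef f = a.
Proof.
by move=> fa; apply: xget_unique => // b fb; exact: taylor_coefs_unique fb fa.
Qed.

Lemma summable_l2 a : cvgn (series (fun n => `|a n| ^+ 2)) <-> l2 a.
Proof.
have E1 : (fun n => `|a n| ^+ 2) = (fun n => (rnorm (a n) ^+ 2)%:C).
  by apply/funext => n; rewrite rnormE rmorphXn.
rewrite /l2 E1; split.
  move=> /cvg_ex[l /cvg_Re]; rewrite Re_series => H.
  exact: cvgP H.
move=> /cvg_ex[l Hl]; apply: (cvgP l%:C); apply: cvg_ReIm.
  by rewrite Re_series.
rewrite Im_series (_ : series _ = cst 0); first exact: cvg_cst.
by apply/funext => n; rewrite /series /= big1.
Qed.

Lemma H2_taylor f : H2 f -> taylor_coefs f (coef f).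
Proof. by move=> [_ [a fa _]]; rewrite (coef_eq fa). Qed.

Lemma H2_l2 f : H2 f -> l2 (coef f).
Proof. by move=> [_ [a fa /summable_l2]]; rewrite (coef_eq fa). Qed.

Lemma H2_out f z : H2 f -> ~~ (`|z| < 1) -> f z = 0.
Proof. by move=> [f0 _]; exact: f0. Qed.

Lemma H2_ext f g : H2 f -> H2 g -> coef f = coef g -> f = g.
Proof.
move=> Hf Hg fg; apply/funext => z.
have [z1|z1] := boolP (`|z| < 1); last by rewrite !(H2_out _ z1).
by apply: cvg_uniq (H2_taylor Hf z1) _; rewrite fg; exact: H2_taylor.
Qed.

Lemma H2_of_coefs f a : (forall z, ~~ (`|z| < 1) -> f z = 0) ->
  taylor_coefs f a -> l2 a -> H2 f /\ coef f = a.
Proof.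
by move=> f0 fa la; split; [split=> //; exists a => //; exact/summable_l2|exact: coef_eq].
Qed.

Lemma comb_taylor k f g a b : taylor_coefs f a -> taylor_coefs g b ->
  taylor_coefs (k *: f + g) (fun n => k *: a n + b n).
Proof.
move=> fa gb z z1.
have H : (fun n => k *: series (fun n => z ^+ n *: a n) n) +
    series (fun n => z ^+ n *: b n) @ \oo --> k *: f z + g z.
  apply: cvgD; last exact: gb.
  by apply: cvgZ; [exact: cvg_cst|exact: fa].
refine (eq_seq_cvg _ H) => m.
transitivity (k *: series (fun n => z ^+ n *: a n) m + series (fun n => z ^+ n *: b n) m) => //.
rewrite /series /= scaler_sumr -big_split; apply: eq_bigr => j _ /=.
by rewrite scalerDr !scalerA mulrC.
Qed.

Lemma H2_comb k f g : H2 f -> H2 g -> H2 (k *: f + g) /\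
  coef (k *: f + g) = fun n => k *: coef f n + coef g n.
Proof.
move=> Hf Hg; apply: H2_of_coefs.
- move=> z z1.
  transitivity (k *: f z + g z) => //.
  by rewrite (H2_out Hf z1) (H2_out Hg z1) scaler0 addr0.
- by apply: comb_taylor; exact: H2_taylor.
- by apply: l2_comb; exact: H2_l2.
Qed.

Lemma H2_sub f g : H2 f -> H2 g -> H2 (f - g) /\
  coef (f - g) = fun n => coef f n - coef g n.
Proof.
move=> Hf Hg; have := H2_comb (-1) Hg Hf.
have -> : (-1 *: g + f) = f - g by rewrite scaleN1r addrC.
move=> [H ->]; split=> //; apply/funext => n.
by rewrite scaleN1r addrC.
Qed.

Lemma shift_taylor f a : taylor_coefs f a -> taylor_coefs (Defs.shift f) (rshift a).
Proof.
move=> fa z z1; rewrite -cvg_shiftS.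
have H : z *: series (fun n => z ^+ n *: a n) n @[n --> \oo] --> z *: f z.
  by apply: cvgZ; [exact: cvg_cst|exact: fa].
refine (eq_seq_cvg _ H) => m.
rewrite /series /= big_nat_recl// scaler0 add0r scaler_sumr.
by apply: eq_bigr => j _; rewrite scalerA exprS.
Qed.

Lemma H2_shift f : H2 f -> H2 (Defs.shift f) /\ coef (Defs.shift f) = rshift (coef f).
Proof.
move=> Hf; apply: H2_of_coefs.
- by move=> z z1; rewrite /Defs.shift (H2_out Hf z1) scaler0.
- exact/shift_taylor/H2_taylor.
- exact/l2_rshift/H2_l2.
Qed.

Definition pseries a : R[i] -> E := fun z =>
  if `|z| < 1 then limn (series (fun n => z ^+ n *: a n)) else 0.

Lemma H2_pseries a : l2 a -> H2 (pseries a) /\ coef (pseries a) = a.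
Proof.
move=> la; apply: H2_of_coefs => //.
  by move=> z /negPf z1; rewrite /pseries z1.
move=> z z1; rewrite /pseries z1.
have aB n : rnorm (a n) <= 1 + l2sq a.
  have := term_le_l2sq n la; have := sqr_ge0 (rnorm (a n) - 1).
  have := sqr_ge0 (rnorm (a n)); rewrite sqrrB; lra.
by apply: (bounded_series_cvg aB); rewrite -norm_lt1.
Qed.

Lemma H2_0 : H2 (0 : R[i] -> E) /\ coef (0 : R[i] -> E) = fun=> 0.
Proof.
apply: H2_of_coefs => // [z _|]; last exact: (@l2_finite _ _ _ 0).
rewrite (_ : series _ = cst 0); first exact: cvg_cst.
by apply/funext => n; rewrite /series /= big1// => j _; rewrite scaler0.
Qed.

Lemma H2norm_l2norm f : H2 f -> H2norm dot f = (l2norm (coef f))%:C.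
Proof.
move=> /H2_l2 lf; rewrite /H2norm.
have -> : H2dot dot f f = (l2norm (coef f) ^+ 2)%:C.
  by rewrite sqr_l2norm//; exact: (l2dot_self dot_norm).
apply/eqP; rewrite -(@eqrXn2 _ 2)// ?sqrtC_ge0 ?ler0c ?sqr_ge0 ?sqrtr_ge0//.
by rewrite sqrtCK rmorphXn.
Qed.

End HardyCoefficients.

(** * Parseval's identity for trigonometric polynomials *)

Section Parseval.
Variables (R : realType) (E : completeNormedModType R[i]).
Variable dot : {dot E for @Num.conj R[i]}.
Hypothesis dot_norm : induces_norm dot.
Implicit Types (a : nat -> E) (t : R).

Lemma Re_cmean (f : R -> R[i]) :
  segint 0 (2 * pi) (fun t => complex.Re (f t)) = 2 * pi * complex.Re (cmean f).
Proof.
have p0 : 2 * pi != 0 :> R by rewrite gt_eqF// mulr_gt0// pi_gt0.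
by rewrite /cmean Re_mul [complex.Re (Complex _ _)]/= [complex.Im _%:C]/= mulr0 subr0 [RHS]mulrCA divff// mulr1.
Qed.

Lemma cmean_conj (f : R -> R[i]) : continuous f ->
  cmean (fun t => (f t)^*) = (cmean f)^*.
Proof.
move=> cf; rewrite /cmean rmorphM /=; congr (_ * _); last by rewrite oppr0.
congr (_ +i* _); first by apply: eq_segint => t _; case: (f t).
rewrite -mulN1r -segintZ; last by move=> t _; apply: continuous_Im_at; exact: cf.
by apply: eq_segint => t _; case: (f t) => x y /=; rewrite mulN1r.
Qed.

Lemma expiN t : expi (- t) = (expi t)^* :> R[i].
Proof. by rewrite /expi cosN sinN. Qed.

Lemma expi_conj t : (expi t)^*%C * expi t = 1 :> R[i].
Proof. by rewrite -expiN -expiD addNr expi0. Qed.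

(** Parseval's identity is applied to analytic polynomials for the values of
    [Theta], and to antianalytic ones for those of its adjoint. *)
Definition unimod (b : bool) t : R[i] := if b then expi t else (expi t)^*.

Lemma rnorm_unimod b t : rnorm (unimod b t) = 1.
Proof. by case: b; rewrite /unimod ?rnorm_conj rnorm_expi. Qed.

Lemma unimod_conj b t : (unimod b t)^* = unimod (~~ b) t.
Proof. by case: b; rewrite /unimod ?conjcK. Qed.

Lemma continuous_unimod b : continuous (unimod b).
Proof.
move=> t; case: b; apply: cvg_ReIm => /=; [exact: continuous_cos|exact: continuous_sin|exact: continuous_cos|].
exact/continuousN/continuous_sin.
Qed.

Lemma continuous_unimodX b n : continuous (fun t => unimod b t ^+ n).
Proof.
elim: n => [|n IH] t; first exact: cvg_cst.
rewrite (_ : (fun t => _) = (unimod b \* (fun t => unimod b t ^+ n))); last first.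
  by apply/funext => y; rewrite exprS.
by apply: continuousM; [exact: continuous_unimod|exact: IH].
Qed.

Lemma cmean_unimodX b n : cmean (fun t => unimod b t ^+ n.+1) = 0.
Proof.
have false0 : cmean (fun t => unimod false t ^+ n.+1) = 0.
  rewrite -(cmean_inv_pow n (@ltr01 R)); apply: eq_cmean => t; congr (_ ^+ _).
  have e0 : expi t != 0 :> R[i] by rewrite -rnorm_eq0 rnorm_expi oner_eq0.
  by rewrite /circle mul1r /unimod; apply: (mulIf e0); rewrite expi_conj mulVf.
case: b; last exact: false0.
rewrite (_ : (fun t => _) = fun t => (unimod false t ^+ n.+1)^*); last first.
  by apply/funext => t; rewrite rmorphXn; congr (_ ^+ _); exact/esym/(unimod_conj false).
rewrite cmean_conj; last exact: (@continuous_unimodX false).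
by rewrite false0 conjc0.
Qed.

Definition trig b a N t : E := \sum_(0 <= k < N) unimod b t ^+ k *: a k.

Lemma continuous_trig b a N : continuous (trig b a N).
Proof.
elim: N => [|N IH] t.
  rewrite (_ : trig b a 0 = fun=> 0); first exact: cvg_cst.
  by apply/funext => y; rewrite /trig big_nil.
rewrite (_ : trig b a N.+1 = trig b a N + (fun t => unimod b t ^+ N *: a N)); last first.
  by apply/funext => y; rewrite /trig big_nat_recr.
apply: continuousD; first exact: IH.
by apply: cvgZ; [exact: continuous_unimodX|exact: cvg_cst].
Qed.

Lemma continuous_rnorm_sqr (f : R -> E) t : {for t, continuous f} ->
  {for t, continuous (fun t => rnorm (f t) ^+ 2)}.
Proof.
move=> cf; apply: (@continuousM _ _ (fun t => rnorm (f t)) (fun t => rnorm (f t)));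
  exact: cvg_rnorm.
Qed.

Lemma cmean_trig_dot b a N K : (K <= N)%N ->
  continuous (fun t => dot (trig b a K t) (unimod b t ^+ N *: a N)) /\
  cmean (fun t => dot (trig b a K t) (unimod b t ^+ N *: a N)) = 0.
Proof.
elim: K => [|K IH] KN.
  rewrite (_ : (fun t => _) = fun=> 0); last first.
    by apply/funext => t; rewrite /trig big_nil dot0l.
  by split; [move=> t; exact: cvg_cst|rewrite cmean_cst].
have [IHc IH0] := IH (ltnW KN).
pose d := dot (a K) (a N); pose n := (N - K.+1)%N.
have E1 : (fun t => dot (trig b a K.+1 t) (unimod b t ^+ N *: a N)) =
    (fun t => dot (trig b a K t) (unimod b t ^+ N *: a N) +
              d * unimod (~~ b) t ^+ n.+1).
  apply/funext => t; rewrite /trig big_nat_recr//= dotDl; congr (_ + _).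
  rewrite dotZl dotZr (_ : Num.conj (unimod b t ^+ N) = unimod (~~ b) t ^+ N);
    last by rewrite rmorphXn; congr (_ ^+ _); exact: unimod_conj.
  rewrite -/d.
  rewrite (_ : N = (n.+1 + K)%N); last by rewrite /n addSnnS subnK.
  rewrite exprD; set u := unimod b t; set v := unimod (~~ b) t.
  have uv : u ^+ K * v ^+ K = 1.
    rewrite -exprMn /u /v -unimod_conj.
    by case: (b); rewrite /unimod ?conjcK ?[expi t * _]mulrC expi_conj expr1n.
  transitivity (u ^+ K * v ^+ K * (d * v ^+ n.+1)); first by ring.
  by rewrite uv mul1r.
have cE : continuous (fun t => d * unimod (~~ b) t ^+ n.+1).
  by move=> t; apply: cvgM; [exact: cvg_cst|exact: continuous_unimodX].
rewrite E1; split.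
  move=> t; apply: (@continuousD _ _ _
    (fun t => dot (trig b a K t) (unimod b t ^+ N *: a N))
    (fun t => d * unimod (~~ b) t ^+ n.+1)); [exact: IHc|exact: cE].
rewrite (cmeanD IHc cE) IH0 add0r.
rewrite (cmeanZ d (@continuous_unimodX (~~ b) n.+1)).
by rewrite (cmean_unimodX (~~ b) n) mulr0.
Qed.

Lemma parseval_trig b a N :
  segint 0 (2 * pi) (fun t => rnorm (trig b a N t) ^+ 2) =
  2 * pi * \sum_(0 <= k < N) rnorm (a k) ^+ 2.
Proof.
have p0 : 0 <= 2 * pi :> R by rewrite mulr_ge0// pi_ge0.
elim: N => [|N IH].
  rewrite big_nil mulr0 (@eq_segint _ _ _ _ (fun=> 0)) ?segint_cst ?mul0r//.
  by move=> t _; rewrite /trig big_nil rnorm0 expr0n.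
have [cX X0] := cmean_trig_dot b a (leqnn N).
pose X t := dot (trig b a N t) (unimod b t ^+ N *: a N).
have E1 t : rnorm (trig b a N.+1 t) ^+ 2 = rnorm (trig b a N t) ^+ 2 +
    (rnorm (a N) ^+ 2 + 2 * complex.Re (X t)).
  rewrite /trig big_nat_recr//= (sqr_rnormD dot_norm) -/(trig b a N t) addrA.
  by rewrite rnormZ rnormX rnorm_unimod expr1n mul1r.
rewrite (eq_segint (fun t _ => E1 t)).
have c2 : {in `[0, 2 * pi], continuous (fun t => 2 * complex.Re (X t))}.
  move=> t _; apply: cvgM; first exact: cvg_cst.
  by apply: cvg_Re; exact: cX.
rewrite segintD; last 2 first.
- by move=> t _; apply: continuous_rnorm_sqr; exact: continuous_trig.
- move=> t tI; apply: (@continuousD _ _ _ (fun=> rnorm (a N) ^+ 2)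
    (fun t => 2 * complex.Re (X t))); last exact: c2.
  exact: cvg_cst.
rewrite segintD; [|by move=> t _; exact: cvg_cst|exact: c2].
rewrite IH segint_cst// segintZ; last first.
  by move=> t _; apply: continuous_Re_at; exact: cX.
rewrite Re_cmean X0 mulr0 mulr0 addr0 subr0 big_nat_recr//=.
by rewrite [RHS]mulrDr; congr (_ + _); exact: mulrC.
Qed.

End Parseval.

(** * Taylor coefficients of a multiplier *)

Section TaylorOfMultiplier.
Variables (R : realType) (E : completeNormedModType R[i]).
Variable dot : {dot E for @Num.conj R[i]}.
Hypothesis dot_norm : induces_norm dot.
Variable Theta : R[i] -> {linear E -> E}.
Hypothesis Theta_Hinfty : Hinfty Theta.

Lemma Hinfty_bound : exists2 M : R, 0 <= M &
  forall z x, rnorm z < 1 -> rnorm (Theta z x) <= M * rnorm x.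
Proof.
have [_ [M MP]] := Theta_Hinfty; exists `|M| => // z x z1.
apply: le_trans (_ : M * rnorm x <= _); last first.
  by rewrite ler_wpM2r ?rnorm_ge0 ?ler_norm.
by have := MP z; rewrite norm_lt1 => /(_ z1 x); rewrite !rnormE -rmorphM lecR.
Qed.

Lemma Hinfty_coefs (M : R) : 0 <= M ->
  (forall z x, rnorm z < 1 -> rnorm (Theta z x) <= M * rnorm x) ->
  exists2 Th : nat -> E -> E,
    forall n y, rnorm (Th n y) <= 4 * M * rnorm y &
    forall y, taylor_coefs (fun z => Theta z y) (Th ^~ y).
Proof.
move=> M0 MP; have [dT _] := Theta_Hinfty.
have /choice[a aP] : forall y, exists a : nat -> E,
    (forall n, rnorm (a n) <= 4 * M * rnorm y) /\
    taylor_coefs (fun z => Theta z y) a.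
  move=> y.
  have [|z z1|z z1|a a1 a2] := @holomorphic_taylor R E dot dot_norm
      (fun z => Theta z y) (M * rnorm y).
  - by rewrite mulr_ge0 ?rnorm_ge0.
  - have := dT z; rewrite norm_lt1 => /(_ z1)[A cA AP]; exists (A y) => e e0.
    have y1 : 0 < rnorm y + 1 by have := rnorm_ge0 y; lra.
    have /near_rnormP[d d0 dP] := AP (e / (rnorm y + 1)) (divr_gt0 e0 y1).
    exists d => // w /dP/(_ y); rewrite !rnormE -!rmorphM lecR => /le_trans; apply.
    rewrite mulrAC ler_wpM2r ?rnorm_ge0// mulrAC ler_pdivrMr// ler_pM2l//.
    by rewrite lerDl.
  - exact: MP.
  by exists a; split=> // n; rewrite -mulrA.
by exists (fun n y => a y n) => [n y|y]; case: (aP y).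
Qed.

Lemma Hinfty_adjoint_coefs (M : R) (Th : nat -> E -> E) : 0 <= M ->
  (forall n y, rnorm (Th n y) <= 4 * M * rnorm y) ->
  (forall y, taylor_coefs (fun z => Theta z y) (Th ^~ y)) ->
  exists Ad : nat -> E -> E, forall n x y, dot (Th n y) x = dot y (Ad n x).
Proof.
move=> M0 ThM ThT.
have ThD k y y' n : Th n (k *: y + y') = k *: Th n y + Th n y'.
  suff : Th^~ (k *: y + y') = fun n => k *: Th n y + Th n y'.
    by move=> /(congr1 (fun f => f n)).
  apply: (taylor_coefs_unique (ThT _)).
  have -> : (fun z => Theta z (k *: y + y')) =
      k *: (fun z => Theta z y : E) + (fun z => Theta z y' : E).
    by apply/funext => z; rewrite linearP.
  by apply: comb_taylor; exact: ThT.
have ThZ k y n : Th n (k *: y) = k *: Th n y.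
  have Th0 : Th n 0 = 0.
    by apply/eqP; rewrite -rnorm_eq0 eq_le rnorm_ge0 andbT (le_trans (ThM _ _))// rnorm0 mulr0.
  by rewrite -[k *: y]addr0 ThD Th0 addr0.
suff /choice[Ad AdP] : forall u : nat * E, exists w,
    forall y, dot (Th u.1 y) u.2 = dot y w.
  by exists (fun n x => Ad (n, x)) => n x y; exact: (AdP (n, x)).
move=> [n x] /=.
have [|y y'|k y|y|w wP _] := @riesz_representation _ _ _ dot_norm
    (fun y => dot (Th n y) x) (4 * M * rnorm x).
- by rewrite !mulr_ge0 ?rnorm_ge0.
- by rewrite -[y]scale1r ThD !scale1r dotDl.
- by rewrite ThZ dotZl.
- apply: le_trans (rnorm_dot dot_norm _ _) _.
  by rewrite mulrAC ler_wpM2r ?rnorm_ge0.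
by exists w.
Qed.

End TaylorOfMultiplier.

Section RadialApproximation.
Variables (R : realType) (E : completeNormedModType R[i]).
Implicit Types (a : nat -> E).

Lemma exists_truncation (K r e : R) (m : nat) : 0 <= K -> 0 <= r < 1 -> 0 < e ->
  exists2 N, (m <= N)%N & forall a (C : R), 0 <= C ->
    (forall n, rnorm (a n) <= K * C) -> forall (z : R[i]) (l : E), rnorm z = r ->
    series (fun n => z ^+ n *: a n) @ \oo --> l ->
    rnorm (l - \sum_(0 <= k < N) z ^+ k *: a k) <= e * C.
Proof.
move=> K0 r01 e0; have cg := @geometric_series_cvg R K r r01.
have /cvgrPdist_lt/(_ _ e0)[N0 _ NP] := cg.
pose N := maxn m N0; exists N; first exact: leq_maxl.
move=> a C C0 aC z l zr al.
have r0 : 0 <= r by case/andP: r01.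
have nd : nondecreasing_seq (series (fun n => K * r ^+ n)).
  by apply/nondecreasing_series => n _ _; rewrite mulr_ge0 ?exprn_ge0.
have H : (fun n => series (fun n => z ^+ n *: a n) n -
    \sum_(0 <= k < N) z ^+ k *: a k) @ \oo --> l - \sum_(0 <= k < N) z ^+ k *: a k.
  by apply: cvgB => //; exact: cvg_cst.
apply: (ler_cvg_to (cvg_rnorm _ H) (cvg_cst (e * C))).
exists N => // n /= Nn; rewrite -[X in _ - X]/(series (fun n => z ^+ n *: a n) N).
rewrite seriesB_sum//; apply: le_trans (rnorm_sum _ _ _) _.
apply: le_trans (_ : \sum_(N <= k < n) K * r ^+ k * C <= _).
  apply: ler_sum => k _; rewrite rnormZ rnormX zr mulrC mulrAC.
  by rewrite ler_wpM2r ?exprn_ge0.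
rewrite -mulr_suml ler_wpM2r// -seriesB_sum//.
have := NP N (leq_maxr _ _); rewrite /= ltr_norml => /andP[_].
have := nondecreasing_cvgn_le nd cg n; lra.
Qed.

Definition radius (m : nat) : R := 1 - m.+2%:R^-1.

Lemma radius_itv m : 0 < radius m < 1.
Proof.
have : 0 < (m.+2%:R : R)^-1 by rewrite invr_gt0.
have : (m.+2%:R : R)^-1 < 1 by rewrite invf_lt1// ltr1n.
by rewrite /radius; move: (_^-1) => q ? ?; apply/andP; split; lra.
Qed.

Lemma radius_cvg : radius m @[m --> \oo] --> (1 : R).
Proof.
rewrite -[X in _ --> X]subr0; apply: cvgB; first exact: cvg_cst.
have := @cvg_harmonic R; rewrite -(cvg_shiftS (@harmonic R)).
by apply.
Qed.

Lemma radius_cvg_left : radius m @[m --> \oo] --> (1 : R)^'-.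
Proof.
move=> P P1; have H : \forall m \near \oo, radius m < 1 -> P (radius m).
  exact: radius_cvg P1.
apply: filterS H => m /=; apply; by case/andP: (radius_itv m).
Qed.

Lemma radiusX_cvg n : radius m ^+ n @[m --> \oo] --> (1 : R).
Proof.
elim: n => [|n IH]; first exact: cvg_cst.
rewrite -[X in _ --> X]mulr1.
rewrite (_ : (fun m => _) = (fun m => radius m * radius m ^+ n)); last first.
  by apply/funext => m; rewrite exprS.
by apply: cvgM => //; exact: radius_cvg.
Qed.

End RadialApproximation.

(** * Boundary values of an inner multiplier *)

Section BoundaryValues.
Variables (R : realType) (E : completeNormedModType R[i]).
Variable dot : {dot E for @Num.conj R[i]}.
Hypothesis dot_norm : induces_norm dot.
Variable Theta : R[i] -> {linear E -> E}.
Variables (M : R) (Th Ad : nat -> E -> E).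
Hypothesis M_ge0 : 0 <= M.
Hypothesis Theta_le : forall z x, rnorm z < 1 -> rnorm (Theta z x) <= M * rnorm x.
Hypothesis Th_le : forall n y, rnorm (Th n y) <= 4 * M * rnorm y.
Hypothesis Th_taylor : forall y, taylor_coefs (fun z => Theta z y) (Th ^~ y).
Hypothesis Ad_adjoint : forall n x y, dot (Th n y) x = dot y (Ad n x).
Implicit Types (p a : nat -> E) (t : R) (z : R[i]).

Definition delay j a n : E := if (j <= n)%N then a (n - j)%N else 0.

Lemma delay_taylor (f : R[i] -> E) a j : taylor_coefs f a ->
  taylor_coefs (fun z => z ^+ j *: f z) (delay j a).
Proof.
move=> fa; elim: j => [|j IH].
  rewrite (_ : delay 0 a = a); last by apply/funext => n; rewrite /delay subn0.
  by rewrite (_ : (fun z => _) = f)//; apply/funext => z; rewrite expr0 scale1r.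
rewrite (_ : delay j.+1 a = rshift (delay j a)); last by apply/funext => -[|n].
rewrite (_ : (fun z => _) = Defs.shift (fun z => z ^+ j *: f z)); last first.
  by apply/funext => z; rewrite /Defs.shift scalerA exprS.
exact: shift_taylor.
Qed.

Definition polyv p K z : E := \sum_(0 <= j < K) z ^+ j *: p j.

(** The Taylor coefficients of [Theta] times a polynomial. *)
Definition mulcoef p K n : E := \sum_(0 <= j < K) delay j (Th ^~ (p j)) n.

Lemma Theta_polyv p K z :
  Theta z (polyv p K z) = \sum_(0 <= j < K) z ^+ j *: Theta z (p j).
Proof. by rewrite linear_sum; apply: eq_bigr => j _; rewrite linearZ. Qed.

Lemma mulcoef_taylor p K :
  taylor_coefs (fun z => Theta z (polyv p K z)) (mulcoef p K).
Proof.
rewrite (_ : (fun z => _) = fun z => \sum_(0 <= j < K) z ^+ j *: Theta z (p j)); last first.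
  by apply/funext => z; exact: Theta_polyv.
elim: K => [|K IH].
  rewrite (_ : mulcoef p 0 = fun=> 0); last by apply/funext => n; rewrite /mulcoef big_nil.
  rewrite (_ : (fun z => _) = 0); last by apply/funext => z; rewrite big_nil.
  move=> z _; rewrite (_ : series _ = cst 0); first exact: cvg_cst.
  by apply/funext => n; rewrite /series /= big1// => j _; rewrite scaler0.
have := comb_taylor (k := 1) IH (delay_taylor (j := K) (@Th_taylor (p K))).
rewrite (_ : (fun n => _) = mulcoef p K.+1); last first.
  by apply/funext => n; rewrite scale1r /mulcoef big_nat_recr.
rewrite (_ : 1 *: _ + _ = (fun z => \sum_(0 <= j < K.+1) z ^+ j *: Theta z (p j)))//.
by rewrite scale1r; apply/funext => z; rewrite big_nat_recr.
Qed.

Lemma mulcoef_le p K n :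
  rnorm (mulcoef p K n) <= 4 * M * \sum_(0 <= j < K) rnorm (p j).
Proof.
apply: le_trans (rnorm_sum _ _ _) _; rewrite mulr_sumr; apply: ler_sum => j _.
rewrite /delay; case: ifP => _; first exact: Th_le.
by rewrite rnorm0 !mulr_ge0// rnorm_ge0.
Qed.

Lemma polyv_le p K z : rnorm z <= 1 ->
  rnorm (polyv p K z) <= \sum_(0 <= j < K) rnorm (p j).
Proof.
move=> z1; apply: le_trans (rnorm_sum _ _ _) _; apply: ler_sum => j _.
by rewrite rnormZ rnormX ler_piMl ?rnorm_ge0// exprn_ile1// rnorm_ge0.
Qed.

(** The radii tend to [1], and the Taylor series on the [m]-th circle is replaced
    by a partial sum, so that only trigonometric polynomials are integrated. The
    order [N] depends on a bound of the coefficients alone: in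
    [adjoint_coefs_lower] it must not depend on the point of the circle. *)
Definition truncates (m N : nat) := (m <= N)%N /\
  forall a (C : R), 0 <= C -> (forall n, rnorm (a n) <= 4 * M * C) ->
  forall (z : R[i]) (l : E), rnorm z = radius R m ->
    series (fun n => z ^+ n *: a n) @ \oo --> l ->
    rnorm (l - \sum_(0 <= k < N) z ^+ k *: a k) <= m.+1%:R^-1 * C.

Lemma truncation_orders : exists N : nat -> nat, forall m, truncates m (N m).
Proof.
suff /choice[N NP] : forall m, exists N, truncates m N by exists N.
move=> m; have /andP[r0 r1] := radius_itv R m.
have [| | |n mn nP] := @exists_truncation R E (4 * M) (radius R m) m.+1%:R^-1 m.
- by rewrite mulr_ge0.
- by rewrite ltW.
- by rewrite invr_gt0.
by exists n.
Qed.

Lemma rnorm_radius_circle m t : rnorm (circle (radius R m) t) = radius R m.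
Proof. by have /andP[/ltW r0 _] := radius_itv R m; rewrite rnorm_circle. Qed.

Lemma rnorm_radius_lt1 m t : rnorm (circle (radius R m) t) < 1.
Proof. by rewrite rnorm_radius_circle; case/andP: (radius_itv R m). Qed.

Lemma radial_limit_radius t (V : {linear E -> E}) x :
  radial_limit Theta (expi t) V ->
  Theta (circle (radius R m) t) x @[m --> \oo] --> V x.
Proof.
move=> TV; have H : (fun r => Theta (circle r t) x) @ (1 : R)^'- --> V x := TV x.
move=> P /H HP; exact: (@radius_cvg_left R _ HP).
Qed.

Lemma circle_radius_cvg t j :
  circle (radius R m) t ^+ j @[m --> \oo] --> (expi t : R[i]) ^+ j.
Proof.
rewrite -[X in _ --> X]mul1r.
rewrite (_ : (fun m => _) = (fun m => (radius R m ^+ j)%:C * expi t ^+ j)); last first.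
  by apply/funext => m; rewrite exprMn rmorphXn.
apply: cvgM; last exact: cvg_cst.
by apply: cvg_ReIm => /=; [exact: radiusX_cvg|exact: cvg_cst].
Qed.

Definition dilate m a k : E := (radius R m ^+ k)%:C *: a k.

Lemma trig_dilate m a N t : trig true (dilate m a) N t =
  \sum_(0 <= k < N) circle (radius R m) t ^+ k *: a k.
Proof.
by apply: eq_bigr => k _; rewrite /dilate scalerA /circle exprMn mulrC rmorphXn.
Qed.

Lemma sum_dilate_cvg a n :
  \sum_(0 <= k < n) rnorm (dilate m a k) ^+ 2 @[m --> \oo] -->
  \sum_(0 <= k < n) rnorm (a k) ^+ 2.
Proof.
elim: n => [|n IH].
  rewrite big_nil (_ : (fun m => _) = fun=> 0); first exact: cvg_cst.
  by apply/funext => m; rewrite big_nil.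
rewrite big_nat_recr//= (_ : (fun m => _) = (fun m => \sum_(0 <= k < n) rnorm (dilate m a k) ^+ 2) +
   (fun m => radius R m ^+ (n * 2) * rnorm (a n) ^+ 2)); last first.
  apply/funext => m; rewrite big_nat_recr//=; congr (_ + _).
  have /andP[/ltW r0 _] := radius_itv R m.
  by rewrite /dilate rnormZ rnorm_real ger0_norm ?exprn_ge0// exprMn exprM.
apply: cvgD => //; rewrite -[X in _ --> X]mul1r.
by apply: cvgM; [exact: radiusX_cvg|exact: cvg_cst].
Qed.

Lemma sum_dilate_le m a n : \sum_(0 <= k < n) rnorm (dilate m a k) ^+ 2 <=
  \sum_(0 <= k < n) rnorm (a k) ^+ 2.
Proof.
apply: ler_sum => k _; have /andP[/ltW r0 /ltW r1] := radius_itv R m.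
rewrite lerXn2r ?nnegrE ?rnorm_ge0// /dilate rnormZ rnorm_real.
by rewrite ger0_norm ?exprn_ge0// ler_piMl ?rnorm_ge0// exprn_ile1.
Qed.

Lemma ae_imply2 (P Q S : R -> Prop) : (forall t, P t -> Q t -> S t) ->
  {ae @lebesgue_measure R, forall t, P t} -> {ae @lebesgue_measure R, forall t, Q t} ->
  {ae @lebesgue_measure R, forall t, S t}.
Proof.
move=> H aP aQ; have aeF := ae_filter_ringOfSetsType (@lebesgue_measure R).
by apply: (@filterS2 _ _ aeF _ _ _ _ aP aQ).
Qed.

Lemma ae_imply (P S : R -> Prop) : (forall t, P t -> S t) ->
  {ae @lebesgue_measure R, forall t, P t} -> {ae @lebesgue_measure R, forall t, S t}.
Proof. by move=> H aP; apply: (ae_imply2 _ aP aP) => t Pt _; exact: H. Qed.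

Let pi2_ge0 : 0 <= 2 * pi :> R. Proof. by rewrite mulr_ge0// pi_ge0. Qed.
Let pi2_gt0 : 0 < 2 * pi :> R. Proof. by rewrite mulr_gt0// pi_gt0. Qed.

Lemma inv_succ_cvg0 (C : R) : m.+1%:R^-1 * C @[m --> \oo] --> (0 : R).
Proof.
rewrite -[X in _ --> X](mul0r C); apply: cvgM; last exact: cvg_cst.
exact: cvg_harmonic.
Qed.

(** The boundary values of [Theta * p] and [p] have the same norm almost
    everywhere, and a mean square over a circle bounds the sum of the squared
    coefficients. *)
Theorem mulcoef_contraction p K n :
  ae_circle (fun zeta => exists2 V, radial_limit Theta zeta V & isometry_op V) ->
  \sum_(0 <= k < n) rnorm (mulcoef p K k) ^+ 2 <= \sum_(0 <= j < K) rnorm (p j) ^+ 2.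
Proof.
move=> inner; have [N NP] := truncation_orders.
pose C : R := \sum_(0 <= j < K) rnorm (p j); pose c := mulcoef p K.
have C0 : 0 <= C by apply: sumr_ge0 => j _; exact: rnorm_ge0.
pose F z := Theta z (polyv p K z); pose D m t := trig true (dilate m c) (N m) t.
have tail m t : rnorm (F (circle (radius R m) t) - D m t) <= m.+1%:R^-1 * C.
  rewrite /D trig_dilate; apply: (NP m).2 => //; first exact: mulcoef_le.
    exact: rnorm_radius_circle.
  by apply: mulcoef_taylor; rewrite norm_lt1 rnorm_radius_lt1.
have D_le m t : rnorm (D m t) <= M * C + C.
  have -> : D m t = F (circle (radius R m) t) - (F (circle (radius R m) t) - D m t).
    by rewrite subKr.
  apply: le_trans (rnormB _ _) _; apply: lerD.
    apply: le_trans (Theta_le _ (rnorm_radius_lt1 m t)) _.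
    by apply: ler_wpM2l => //; apply: polyv_le; exact/ltW/rnorm_radius_lt1.
  apply: le_trans (tail m t) _; rewrite ler_piMl// invf_le1// ler1n.
  by [].
have cv : segint 0 (2 * pi) (fun t => rnorm (D m t) ^+ 2) @[m --> \oo] -->
    segint 0 (2 * pi) (fun t => rnorm (trig true p K t) ^+ 2).
  apply: (@bounded_convergence _ _ _ ((M * C + C) ^+ 2)).
  - by move=> m t _; apply: continuous_rnorm_sqr; exact: continuous_trig.
  - by move=> t _; apply: continuous_rnorm_sqr; exact: continuous_trig.
  - move=> m t _; rewrite ger0_norm ?sqr_ge0//.
    by rewrite lerXn2r ?nnegrE ?rnorm_ge0 ?addr_ge0 ?mulr_ge0.
  apply: ae_imply inner => t H tI; have [V TV isoV] := H tI.
  have FV : F (circle (radius R m) t) @[m --> \oo] --> V (trig true p K t).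
    rewrite (_ : V _ = \sum_(0 <= j < K) expi t ^+ j *: V (p j)); last first.
      by rewrite linear_sum; apply: eq_bigr => j _; rewrite linearZ.
    rewrite (_ : (fun m => _) = (fun m => \sum_(0 <= j < K)
      circle (radius R m) t ^+ j *: Theta (circle (radius R m) t) (p j))); last first.
      by apply/funext => m; exact: Theta_polyv.
    suff H' k : \sum_(0 <= j < k)
        circle (radius R m) t ^+ j *: Theta (circle (radius R m) t) (p j)
        @[m --> \oo] --> \sum_(0 <= j < k) expi t ^+ j *: V (p j) by exact: H'.
    elim: k => [|k IH].
      rewrite big_nil (_ : (fun m => _) = fun=> 0); first exact: cvg_cst.
      by apply/funext => m; rewrite big_nil.
    rewrite big_nat_recr//= (_ : (fun m => _) = (fun m => \sum_(0 <= j < k)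
      circle (radius R m) t ^+ j *: Theta (circle (radius R m) t) (p j)) + (fun m =>
      circle (radius R m) t ^+ k *: Theta (circle (radius R m) t) (p k))); last first.
      by apply/funext => m; rewrite big_nat_recr.
    apply: cvgD => //; apply: cvgZ; first exact: circle_radius_cvg.
    exact: radial_limit_radius.
  have DV : D m t @[m --> \oo] --> V (trig true p K t).
    apply/cvg_rnormP; apply: (@squeeze_cvgr _ _ _ _ (cst 0) (fun m =>
      rnorm (F (circle (radius R m) t) - V (trig true p K t)) + m.+1%:R^-1 * C)).
    - apply: nearW => m; rewrite rnorm_ge0 /=.
      apply: le_trans (rnorm_dist _ _ (F (circle (radius R m) t))) _.
      by rewrite [leRHS]addrC; apply: lerD => //; rewrite rnormC; exact: tail.
    - exact: cvg_cst.
    - rewrite -[X in _ --> X]addr0; apply: cvgD; last exact: inv_succ_cvg0.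
      exact/cvg_rnormP.
  have -> : rnorm (trig true p K t) = rnorm (V (trig true p K t)).
    by rewrite /rnorm isoV.
  by apply: (@cvgM R); exact: cvg_rnorm.
have {}cv : (2 * pi)^-1 * segint 0 (2 * pi) (fun t => rnorm (D m t) ^+ 2)
    @[m --> \oo] --> \sum_(0 <= j < K) rnorm (p j) ^+ 2.
  have -> : \sum_(0 <= j < K) rnorm (p j) ^+ 2 =
      (2 * pi)^-1 * segint 0 (2 * pi) (fun t => rnorm (trig true p K t) ^+ 2).
    by rewrite (parseval_trig dot_norm) mulKf// gt_eqF.
  by apply: cvgM; [exact: cvg_cst|exact: cv].
apply: (ler_cvg_to (@sum_dilate_cvg c n) cv); exists n => // m /= nm.
rewrite /D (parseval_trig dot_norm) mulKf ?gt_eqF//.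
rewrite [leRHS](big_cat_nat (n := n))//=; last exact: leq_trans nm (NP m).1.
by rewrite lerDl sumr_ge0// => k _; exact: sqr_ge0.
Qed.

Lemma dot_trig_dilate y x m N t :
  dot y (trig false (dilate m (Ad ^~ x)) N t) =
  dot (\sum_(0 <= k < N) circle (radius R m) t ^+ k *: Th k y) x.
Proof.
rewrite dot_suml dotC dot_suml rmorph_sum; apply: eq_bigr => k _.
transitivity (dot y (unimod false t ^+ k *: dilate m (Ad^~ x) k)).
  exact/esym/dotC.
rewrite /dilate scalerA dotZr dotZl Ad_adjoint; congr (_ * _).
transitivity (expi t ^+ k * (radius R m ^+ k)%:C).
  rewrite rmorphM rmorphXn; congr (_ ^+ _ * _); last exact: conjc_real.
  exact: (unimod_conj false).
by rewrite /circle exprMn rmorphXn mulrC.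
Qed.

(** Almost everywhere on the circle [fun z => adjoint (Theta z) x] tends weakly
    to a vector of norm [rnorm x], because there [Theta] is unitary; weak limits
    do not increase the norm. *)
Theorem adjoint_coefs_lower x (L : R) :
  ae_circle (fun zeta => exists2 V, radial_limit Theta zeta V & isometry_op V) ->
  ae_circle (fun zeta => exists2 V, radial_limit Theta zeta V & invertible_op V) ->
  (forall n, \sum_(0 <= k < n) rnorm (Ad k x) ^+ 2 <= L) -> rnorm x ^+ 2 <= L.
Proof.
move=> inner inv AL; have [N NP] := truncation_orders.
pose G m t := trig false (dilate m (Ad ^~ x)) (N m) t.
(* The minimum makes Fatou's lemma an instance of bounded convergence. *)
pose h m t := Num.min (rnorm (G m t) ^+ 2) (rnorm x ^+ 2).
have ch m t : {for t, continuous (h m)}.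
  apply: continuous_min; last exact: cvg_cst.
  by apply: continuous_rnorm_sqr; exact: continuous_trig.
have h0 m t : 0 <= h m t by rewrite le_min !sqr_ge0.
have cv : segint 0 (2 * pi) (h m) @[m --> \oo] -->
    segint 0 (2 * pi) (fun=> rnorm x ^+ 2).
  apply: (@bounded_convergence _ _ _ (rnorm x ^+ 2)).
  - by move=> m t _; exact: ch.
  - by move=> t _; exact: cvg_cst.
  - by move=> m t _; rewrite ger0_norm// ge_min lexx orbT.
  apply: ae_imply2 inner inv => t H1 H2 tI.
  have [V TV isoV] := H1 tI; have [V' TV' [_ [W _ [_ WV']]]] := H2 tI.
  pose y := W x; have Vy : V y = x.
    rewrite -(WV' x) -/y.
    exact: (cvg_uniq (radial_limit_radius TV) (radial_limit_radius TV')).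
  have ny : rnorm y = rnorm x by rewrite -Vy /rnorm isoV.
  pose q m := complex.Re (dot y (G m t)).
  have qx : q m @[m --> \oo] --> rnorm x ^+ 2.
    have d0 : dot (Theta (circle (radius R m) t) y) x @[m --> \oo] --> dot x x.
      rewrite -{2}Vy; apply: cvg_dotl => //; exact: radial_limit_radius.
    have dG : dot y (G m t) @[m --> \oo] --> dot x x.
      apply/cvg_rnormP; apply: (@squeeze_cvgr _ _ _ _ (cst 0) (fun m =>
        rnorm (dot (Theta (circle (radius R m) t) y) x - dot x x) +
        m.+1%:R^-1 * (rnorm y * rnorm x))).
      - apply: nearW => m; rewrite rnorm_ge0 /=.
        apply: le_trans (rnorm_dist _ _ (dot (Theta (circle (radius R m) t) y) x)) _.
        rewrite [leRHS]addrC; apply: lerD => //.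
        rewrite /G dot_trig_dilate rnormC -dotBl.
        apply: le_trans (rnorm_dot dot_norm _ _) _.
        rewrite mulrA ler_wpM2r ?rnorm_ge0//.
        apply: ((NP m).2 (Th ^~ y)); first exact: rnorm_ge0.
        - by move=> k; exact: Th_le.
        - exact: rnorm_radius_circle.
        - by apply: Th_taylor; rewrite norm_lt1 rnorm_radius_lt1.
      - exact: cvg_cst.
      - rewrite -[X in _ --> X]addr0; apply: cvgD; last exact: inv_succ_cvg0.
        exact/cvg_rnormP.
    have := cvg_Re _ dG; rewrite (dot_self dot_norm); exact.
  (* [2 * Re (dot y g) - rnorm y ^+ 2 <= rnorm g ^+ 2] for every [g]. *)
  apply: (@squeeze_cvgr _ _ _ _
    (fun m => Num.min (2 * q m - rnorm x ^+ 2) (rnorm x ^+ 2)) (cst (rnorm x ^+ 2))).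
  - apply: nearW => m; apply/andP; split; last by rewrite ge_min lexx orbT.
    rewrite /h le_min !ge_min lexx orbT andbT; apply/orP; left.
    have := sqr_ge0 (rnorm (y - G m t)).
    have := sqr_rnormD dot_norm y (- G m t); rewrite rnormN ny => ->.
    have -> : complex.Re (dot y (- G m t)) = - q m.
      by rewrite -[- G m t]add0r dotBr dot0r sub0r Re_opp.
    lra.
  - have H : Num.min (2 * q m - rnorm x ^+ 2) (rnorm x ^+ 2) @[m --> \oo] -->
        Num.min (2 * rnorm x ^+ 2 - rnorm x ^+ 2) (rnorm x ^+ 2).
      have c1 : {for 2 * rnorm x ^+ 2 - rnorm x ^+ 2,
          continuous (fun u : R => Num.min u (rnorm x ^+ 2))}.
        by apply: continuous_min; [exact: cvg_id|exact: cvg_cst].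
      have c2 : 2 * q m - rnorm x ^+ 2 @[m --> \oo] -->
          2 * rnorm x ^+ 2 - rnorm x ^+ 2.
        by apply: cvgB; [apply: cvgM; [exact: cvg_cst|exact: qx]|exact: cvg_cst].
      exact: (continuous_cvg _ c1 c2).
    have E1 : 2 * rnorm x ^+ 2 - rnorm x ^+ 2 = rnorm x ^+ 2 by ring.
    by rewrite E1 minxx in H.
  - exact: cvg_cst.
rewrite segint_cst// subr0 in cv.
have : rnorm x ^+ 2 * (2 * pi) <= 2 * pi * L.
  apply: (ler_cvg_to cv (cvg_cst _)); apply: nearW => m.
  apply: (@le_trans _ _ (segint 0 (2 * pi) (fun t => rnorm (G m t) ^+ 2))).
    apply: le_segint => [t _|t _|t _]; first exact: ch.
      by apply: continuous_rnorm_sqr; exact: continuous_trig.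
    by rewrite ge_min lexx.
  rewrite (parseval_trig dot_norm) ler_pM2l//.
  exact: le_trans (sum_dilate_le _ _ _) (AL _).
by rewrite mulrC ler_pM2l.
Qed.

End BoundaryValues.

(** * The model space and the compressed shift *)

Section ModelSpace.
Variables (R : realType) (E : completeNormedModType R[i]).
Variable dot : {dot E for @Num.conj R[i]}.
Hypothesis dot_norm : induces_norm dot.
Variable Theta : R[i] -> {linear E -> E}.
Variables (M : R) (Th Ad : nat -> E -> E).
Hypothesis M_ge0 : 0 <= M.
Hypothesis Theta_le : forall z x, rnorm z < 1 -> rnorm (Theta z x) <= M * rnorm x.
Hypothesis Th_le : forall n y, rnorm (Th n y) <= 4 * M * rnorm y.
Hypothesis Th_taylor : forall y, taylor_coefs (fun z => Theta z y) (Th ^~ y).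
Hypothesis Ad_adjoint : forall n x y, dot (Th n y) x = dot y (Ad n x).
Hypothesis inner : ae_circle (fun zeta =>
  exists2 V, radial_limit Theta zeta V & isometry_op V).
Hypothesis invertible : ae_circle (fun zeta =>
  exists2 V, radial_limit Theta zeta V & invertible_op V).
Implicit Types (f g h u : R[i] -> E) (a b : nat -> E).

Let Q := Qspace dot Theta.
Let S := model_operator dot Theta.

(** ** Invariance under the backward shift *)

Lemma taylor_coefs0 f a : taylor_coefs f a -> f 0 = a 0%N.
Proof.
move=> fa; have z1 : `|0 : R[i]| < 1 by rewrite normr0.
apply: (cvg_uniq (fa 0 z1)).
have H := @series_finite_cvg R E (fun n => (0 : R[i]) ^+ n *: a n) 1.
rewrite big_nat1 expr0 scale1r in H; apply: H => -[//|n] _.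
by rewrite exprS mul0r scale0r.
Qed.

(** Continuity of [fun z => Theta z (f z)] at the origin, where the power series
    is not assumed to converge to it. *)
Lemma Theta_mul_coef0 f a : H2 f ->
  (forall z : R[i], z != 0 -> rnorm z < 1 ->
    series (fun n => z ^+ n *: a n) @ \oo --> Theta z (f z)) ->
  Theta 0 (f 0) = a 0%N.
Proof.
move=> Hf fa; have [C C0 CP] := punctured_series_near0 fa.
have ft := H2_taylor Hf.
have punct (g : R[i] -> E) b : taylor_coefs g b -> forall z : R[i], z != 0 -> rnorm z < 1 ->
    series (fun n => z ^+ n *: b n) @ \oo --> g z.
  by move=> gb z _; rewrite -norm_lt1; exact: gb.
have [C1 C10 C1P] := punctured_series_near0 (punct _ _ ft).
have [C2 C20 C2P] := punctured_series_near0 (punct _ _ (@Th_taylor (f 0))).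
have f0 := taylor_coefs0 ft; have T0 := taylor_coefs0 (@Th_taylor (f 0)).
apply/eqP; rewrite -subr_eq0 -rnorm_eq0; apply/eqP.
apply: (@le_small_eq0 _ _ (C + M * C1 + C2)) => [||x x0 x4].
- exact: rnorm_ge0.
- by rewrite !addr_ge0 ?mulr_ge0.
have x1 : rnorm x%:C < 1 :> R by rewrite rnorm_real gtr0_norm//; lra.
apply: le_trans (rnorm_dist _ _ (Theta x%:C (f x%:C))) _.
have := CP x x0 x4.
have : rnorm (Theta 0 (f 0) - Theta x%:C (f x%:C)) <= M * C1 * x + C2 * x.
  rewrite rnormC; apply: le_trans (rnorm_dist _ _ (Theta x%:C (f 0))) _.
  apply: lerD; last by rewrite T0; exact: C2P.
  rewrite -linearB; apply: le_trans (Theta_le _ x1) _.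
  by rewrite -mulrA ler_wpM2l// f0 C1P.
lra.
Qed.

Lemma ThetaH2_shift g : ThetaH2 Theta g -> ThetaH2 Theta (Defs.shift g).
Proof.
move=> [f Hf <-]; exists (Defs.shift f); first by case: (H2_shift Hf).
by apply/funext => z; rewrite /Defs.shift linearZ.
Qed.

(** When [g] has no Taylor series both sides are the default [0]: a Taylor series
    of [Defs.shift g] could be divided by [z]. *)
Lemma ThetaH2_coef_shift g : ThetaH2 Theta g ->
  coef (Defs.shift g) = rshift (coef g).
Proof.
move=> [f Hf <-]; set g' := fun z => _.
have [[a ga]|no] := pselect (exists a, taylor_coefs g' a).
  by rewrite (coef_eq ga) (coef_eq (shift_taylor ga)).
have coef0 k : ~ (exists a, taylor_coefs k a) -> coef k = fun=> 0 :> E.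
  by move=> nk; apply: xgetPN => a ka; apply: nk; exists a.
rewrite (coef0 _ no) coef0.
  by apply/funext => -[|n].
move=> [b gb]; apply: no; exists (lshift b).
have b0 : b 0%N = 0.
  by rewrite -(taylor_coefs0 gb) /Defs.shift scale0r.
have punct (z : R[i]) : z != 0 -> rnorm z < 1 ->
    series (fun n => z ^+ n *: lshift b n) @ \oo --> g' z.
  move=> z0; rewrite -norm_lt1 => z1.
  have H : (fun n => z^-1 *: series (fun n => z ^+ n *: b n) n.+1) @ \oo -->
      z^-1 *: (z *: g' z).
    apply: cvgZ; first exact: cvg_cst.
    by have := gb z z1; rewrite -cvg_shiftS.
  rewrite scalerA mulVf// scale1r in H; refine (eq_seq_cvg _ H) => m.
  rewrite /series /= big_nat_recl// b0 scaler0 add0r scaler_sumr.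
  by apply: eq_bigr => k _; rewrite scalerA exprS mulKf.
move=> z; rewrite norm_lt1 => z1; have [->|z0] := eqVneq z 0; last exact: punct.
rewrite /g' (Theta_mul_coef0 Hf punct).
have H := @series_finite_cvg R E (fun n => (0 : R[i]) ^+ n *: lshift b n) 1.
rewrite big_nat1 expr0 scale1r in H; apply: H => -[//|n] _.
by rewrite exprS mul0r scale0r.
Qed.

Lemma Q_H2 f : Q f -> H2 f. Proof. by case. Qed.

Lemma H2dot0l g : H2dot dot 0 g = 0.
Proof.
have [_ c0] := @H2_0 R E; rewrite /H2dot.
have -> : coef (0 : R[i] -> E) = fun=> 0 by [].
rewrite -/(l2dot dot (fun=> 0) (coef g)) (@l2dot_finitel _ _ dot _ _ 0)//.
by rewrite big_nil.
Qed.

Lemma H2dot0r g : H2dot dot g 0 = 0.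
Proof.
have [_ c0] := @H2_0 R E; rewrite /H2dot.
have -> : coef (0 : R[i] -> E) = fun=> 0 by [].
rewrite -/(l2dot dot (coef g) (fun=> 0)) (@l2dot_finiter _ _ dot _ _ 0)//.
by rewrite big_nil.
Qed.

Lemma Q0 : Q 0.
Proof. by split; [case: (@H2_0 R E)|move=> g _; exact: H2dot0l]. Qed.

Lemma Q_backward_shift f : Q f ->
  Q (pseries (lshift (coef f))) /\ coef (pseries (lshift (coef f))) = lshift (coef f).
Proof.
move=> [Hf fQ]; have [HB cB] := H2_pseries (l2_lshift (H2_l2 Hf)).
split=> //; split=> // g gT.
rewrite /H2dot cB -/(l2dot dot (lshift (coef f)) (coef g)) -l2dot_rshiftr.
by rewrite -(ThetaH2_coef_shift gT); exact: fQ (ThetaH2_shift gT).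
Qed.

(** ** Coefficients of elements of the model space *)

Let adsum n x : R := \sum_(0 <= k < n.+1) rnorm (Ad k x) ^+ 2.

(** The coefficients of the adjoint of multiplication by [Theta], applied to
    [z ^+ n *: x]. *)
Let q n x j : E := if (j <= n)%N then Ad (n - j) x else 0.

Lemma adsum_rev n x : \sum_(0 <= j < n.+1) rnorm (q n x j) ^+ 2 = adsum n x.
Proof.
rewrite /adsum big_nat_rev /= add0n; apply: eq_big_nat => j /andP[_ jn].
by rewrite /q subSS leq_subr subKn.
Qed.

Lemma mulcoef_q n x : dot (mulcoef Th (q n x) n.+1 n) x = (adsum n x)%:C.
Proof.
rewrite dot_suml -adsum_rev rmorph_sum /=; apply: eq_big_nat => j /andP[_ jn].
rewrite /delay /q -ltnS jn Ad_adjoint (dot_self dot_norm).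
by [].
Qed.

(** [dot x (coef u n)] is the inner product of [u] with [z ^+ n *: x], and also
    with the difference [d] of [z ^+ n *: x] and [Theta] times the polynomial with
    coefficients [q n x], because [u] is orthogonal to the latter product. *)
Lemma Q_dot_coef u n x : Q u -> adsum n x <= rnorm x ^+ 2 /\
  rnorm (dot x (coef u n)) <=
    Num.sqrt (rnorm x ^+ 2 - adsum n x) * l2norm (coef u).
Proof.
move=> [Hu uQ]; pose c := mulcoef Th (q n x) n.+1.
have c_le m : \sum_(0 <= k < m) rnorm (c k) ^+ 2 <= adsum n x.
  by rewrite -adsum_rev; apply: (@mulcoef_contraction _ _ _ dot_norm Theta M).
have lc := l2_of_bound c_le.
pose f z : E := if `|z| < 1 then polyv (q n x) n.+1 z else 0.
have [Hf _] : H2 f /\ coef f = q n x.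
  apply: H2_of_coefs; first by move=> z /negPf z1; rewrite /f z1.
    move=> z z1; rewrite /f z1; apply: series_finite_cvg => j nj.
    by rewrite /q leqNgt nj scaler0.
  by apply: (@l2_finite _ _ _ n.+1) => j nj; rewrite /q leqNgt nj.
pose g z := Theta z (f z).
have gc : coef g = c.
  apply: coef_eq => z z1; have := @mulcoef_taylor _ _ _ _ Th_taylor (q n x) n.+1 z z1.
  by rewrite /g /f z1.
have cu : l2dot dot c (coef u) = 0.
  have : H2dot dot u g = 0 by apply: uQ; exists f.
  rewrite /H2dot gc -/(l2dot dot (coef u) c) => uc.
  by rewrite (l2dotC dot_norm (H2_l2 Hu) lc) uc conjc0.
pose e k : E := if k == n then x else 0.
have le : l2 e.
  by apply: (@l2_finite _ _ _ n.+1) => j nj; rewrite /e gtn_eqF.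
pose d k : E := -1 *: c k + e k.
have d_le m : \sum_(0 <= k < m) rnorm (d k) ^+ 2 <= rnorm x ^+ 2 - adsum n x.
  apply: le_trans (_ : \sum_(0 <= k < m + n.+1) rnorm (d k) ^+ 2 <= _).
    rewrite [leRHS](big_cat_nat (n := m)) ?leq_addr//= lerDl sumr_ge0// => k _.
    exact: sqr_ge0.
  have dk k : rnorm (d k) ^+ 2 = rnorm (c k) ^+ 2 +
      (if k == n then rnorm x ^+ 2 - 2 * adsum n x else 0).
    rewrite /d /e; case: eqVneq => [->|_]; last by rewrite !addr0 scaleN1r rnormN.
    rewrite (sqr_rnormD dot_norm) scaleN1r rnormN -sub0r dotBl dot0l mulcoef_q.
    by rewrite sub0r Re_opp /=; ring.
  rewrite (eq_bigr _ (fun k _ => dk k)) big_split/=.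
  rewrite -big_mkcond /= big_nat1_eq leq0n /= ltn_addl//.
  by have := c_le (m + n.+1)%N; lra.
have ld := l2_of_bound d_le.
have E1 : l2dot dot d (coef u) = dot x (coef u n).
  rewrite (l2dot_comb dot_norm (-1) lc le (H2_l2 Hu)) cu mulr0 add0r.
  rewrite (@l2dot_finitel _ _ dot _ _ n.+1); last first.
    by move=> j nj; rewrite /e gtn_eqF.
  rewrite big_nat_recr//= /e eqxx big_nat_cond big1 ?add0r// => j /andP[/andP[_ jn] _].
  by rewrite ltn_eqF// dot0l.
split; first by have := le_trans (l2sq_ge0 ld) (l2sq_le_bound d_le); lra.
rewrite -E1; apply: le_trans (l2_cauchy_schwarz dot_norm ld (H2_l2 Hu)) _.
rewrite ler_wpM2r ?sqrtr_ge0// ler_wsqrtr//.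
exact: l2sq_le_bound d_le.
Qed.

Lemma Q_coef_small x (e : R) : 0 < e -> exists n0, forall n u, (n0 <= n)%N ->
  Q u -> rnorm (dot x (coef u n)) <= e * l2norm (coef u).
Proof.
move=> e0.
have [n0 n0P] : exists n0, rnorm x ^+ 2 - adsum n0 x < e ^+ 2.
  apply: contrapT => /forallNP H.
  have : rnorm x ^+ 2 <= rnorm x ^+ 2 - e ^+ 2.
    apply: (@adjoint_coefs_lower _ _ _ dot_norm Theta M Th Ad) => // -[|n].
      rewrite big_nil; have /negP := H 0%N; rewrite -leNgt.
      have : 0 <= adsum 0 x by apply: sumr_ge0 => k _; exact: sqr_ge0.
      lra.
    by have /negP := H n; rewrite -leNgt /adsum; lra.
  by have := exprn_gt0 2 e0; lra.
exists n0 => n u nn uQ; have [le1 /le_trans] := Q_dot_coef n x uQ; apply.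
rewrite ler_wpM2r ?sqrtr_ge0//.
have mono : adsum n0 x <= adsum n x.
  rewrite /adsum [leRHS](big_cat_nat (n := n0.+1))//= lerDl sumr_ge0// => k _.
  exact: sqr_ge0.
have : Num.sqrt (rnorm x ^+ 2 - adsum n x) <= Num.sqrt (e ^+ 2).
  by rewrite ler_wsqrtr//; lra.
by rewrite sqrtr_sqr ger0_norm// ltW.
Qed.

Definition lshiftn n a k : E := a (k + n)%N.

Lemma lshiftnS n a : lshiftn n (lshift a) = lshiftn n.+1 a.
Proof. by apply/funext => k; rewrite /lshiftn /lshift addnS. Qed.

Lemma l2_lshiftn n a : l2 a -> l2 (lshiftn n a).
Proof.
elim: n a => [|n IH] a la.
  by rewrite (_ : lshiftn 0 a = a)//; apply/funext => k; rewrite /lshiftn addn0.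
by rewrite -lshiftnS; apply/IH/l2_lshift.
Qed.

Lemma l2norm_lshiftn n a : l2 a -> l2norm (lshiftn n a) <= l2norm a.
Proof.
move=> la; rewrite ler_wsqrtr//; apply: l2sq_le_bound => m.
apply: le_trans (sum_le_l2sq (n + m) la).
rewrite [leRHS](big_cat_nat (n := n)) ?leq_addr//=.
have -> : \sum_(n <= k < n + m) rnorm (a k) ^+ 2 =
    \sum_(0 <= k < m) rnorm (lshiftn n a k) ^+ 2.
  by rewrite -{1}[n]add0n big_addn addKn.
by rewrite lerDr sumr_ge0// => k _; exact: sqr_ge0.
Qed.

(** The left-hand side is the inner product of [z ^+ n *: f z] with [u]. A finite
    head of the coefficients of [f] is treated by [Q_coef_small], the tail by the
    Cauchy-Schwarz inequality. *)
Lemma Q_tail_small f (e : R) : H2 f -> 0 < e -> exists n0, forall n u,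
  (n0 <= n)%N -> Q u ->
  rnorm (l2dot dot (coef f) (lshiftn n (coef u))) <= e * l2norm (coef u).
Proof.
move=> Hf e0; have lf := H2_l2 Hf; set a := coef f in lf *.
have e20 : 0 < e / 2 by rewrite divr_gt0.
have [N NP] : exists N, l2sq a - \sum_(0 <= k < N) rnorm (a k) ^+ 2 < (e / 2) ^+ 2.
  have /cvgrPdist_lt/(_ _ (exprn_gt0 2 e20))[N _ NP] := lf.
  exists N; apply: le_lt_trans (ler_norm _) _; exact: (NP N (leqnn N)).
have head (d : R) : 0 < d -> exists n0, forall n u, (n0 <= n)%N -> Q u ->
    \sum_(0 <= k < N) rnorm (dot (a k) (lshiftn n (coef u) k)) <=
    d * l2norm (coef u).
  elim: (N) d => [|K IH] d d0.
    by exists 0%N => n u _ _; rewrite big_nil mulr_ge0 ?sqrtr_ge0 ?(ltW d0).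
  have d20 : 0 < d / 2 by rewrite divr_gt0.
  have [n1 n1P] := IH _ d20; have [n2 n2P] := Q_coef_small (a K) d20.
  exists (maxn n1 n2) => n u; rewrite geq_max => /andP[nn1 nn2] Qu.
  rewrite big_nat_recr//=; have := n1P n u nn1 Qu.
  have := n2P (K + n)%N u (leq_trans nn2 (leq_addl _ _)) Qu.
  by rewrite -/(lshiftn n (coef u) K); lra.
have [n0 n0P] := head _ e20; exists n0 => n u nn Qu.
have lu := l2_lshiftn (n := n) (H2_l2 (Q_H2 Qu)); set v := lshiftn n (coef u) in lu *.
pose a1 k : E := if (k < N)%N then a k else 0.
pose a2 k : E := if (k < N)%N then 0 else a k.
have la1 : l2 a1 by apply: (@l2_finite _ _ _ N) => k Nk; rewrite /a1 ltnNge Nk.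
have a2_le m : \sum_(0 <= k < m) rnorm (a2 k) ^+ 2 <= (e / 2) ^+ 2.
  apply: le_trans (_ : \sum_(0 <= k < N + m) rnorm (a2 k) ^+ 2 <= _).
    rewrite [leRHS](big_cat_nat (n := m)) ?leq_addl//= lerDl sumr_ge0// => k _.
    exact: sqr_ge0.
  rewrite (big_cat_nat (n := N)) ?leq_addr//= big_nat_cond big1 ?add0r; last first.
    by move=> k /andP[/andP[_ kN] _]; rewrite /a2 kN rnorm0 expr0n.
  have -> : \sum_(N <= k < N + m) rnorm (a2 k) ^+ 2 =
      \sum_(N <= k < N + m) rnorm (a k) ^+ 2.
    by apply: eq_big_nat => k /andP[Nk _]; rewrite /a2 ltnNge Nk.
  have := sum_le_l2sq (N + m) lf.
  by rewrite (big_cat_nat (n := N)) ?leq_addr//=; move: NP; lra.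
have la2 := l2_of_bound a2_le.
have aE : l2dot dot a v = l2dot dot a1 v + l2dot dot a2 v.
  rewrite -[l2dot dot a1 v]mul1r -(l2dot_comb dot_norm 1 la1 la2 lu).
  apply: eq_l2dot => // k; rewrite /a1 /a2 scale1r.
  by case: ifP => _; rewrite ?addr0 ?add0r.
rewrite aE; apply: le_trans (rnormD _ _) _.
rewrite [e](splitr e) mulrDl; apply: lerD.
  rewrite (@l2dot_finitel _ _ dot _ _ N); last by move=> k Nk; rewrite /a1 ltnNge Nk.
  apply: le_trans (rnorm_sum _ _ _) _; apply: le_trans (n0P n u nn Qu).
  by rewrite le_eqVlt; apply/orP; left; apply/eqP; apply: eq_big_nat => k /andP[_ kN];
    rewrite /a1 kN.
apply: le_trans (l2_cauchy_schwarz dot_norm la2 lu) _.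
apply: ler_pM; rewrite ?sqrtr_ge0//; last exact/l2norm_lshiftn/H2_l2/Q_H2.
have : l2norm a2 <= Num.sqrt ((e / 2) ^+ 2).
  by rewrite ler_wsqrtr//; exact: l2sq_le_bound a2_le.
by rewrite sqrtr_sqr ger0_norm// ltW.
Qed.

Lemma H2_norm_eq0 f : H2 f -> l2norm (coef f) = 0 -> f = 0.
Proof.
move=> Hf f0; have [H0 _] := @H2_0 R E; apply: H2_ext => //.
have [_ ->] := @H2_0 R E; apply/funext => n.
exact: l2norm_eq0 (H2_l2 Hf) f0 n.
Qed.

Lemma H2dot_self_eq0 f : H2 f -> H2dot dot f f = 0 -> f = 0.
Proof.
move=> Hf; rewrite /H2dot -/(l2dot dot (coef f) (coef f)) (l2dot_self dot_norm (H2_l2 Hf)).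
by move=> [f0]; apply: H2_norm_eq0 => //; rewrite /l2norm f0 sqrtr0.
Qed.

Lemma H2dot_subl f g h : H2 f -> H2 g -> H2 h ->
  H2dot dot (f - g) h = H2dot dot f h - H2dot dot g h.
Proof.
move=> Hf Hg Hh; have [_ cfg] := H2_sub Hf Hg.
rewrite /H2dot cfg -/(l2dot dot (fun n => coef f n - coef g n) (coef h)).
have := l2dot_comb dot_norm (-1) (H2_l2 Hg) (H2_l2 Hf) (H2_l2 Hh).
rewrite mulN1r addrC => <-; apply: eq_l2dot => // n.
by rewrite scaleN1r addrC.
Qed.

(** ** The compressed shift *)

(** [S f] is the projection of [Defs.shift f], or else the default value [0]; the
    estimates below hold in either case. *)
Lemma S_cases f : Q f -> Q (S f) /\
  (S f = 0 \/ forall h, Q h -> H2dot dot (S f) h = H2dot dot (Defs.shift f) h).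
Proof.
move=> Qf; have Hs := (H2_shift (Q_H2 Qf)).1.
rewrite /S /model_operator /orth_proj; case: xgetP => [g gE [Qg gP]|_].
  split=> //; right=> h Qh; have := gP h Qh.
  rewrite H2dot_subl; [|exact: Hs|exact: Q_H2|exact: Q_H2].
  by move/eqP; rewrite subr_eq0 => /eqP.
by split; [exact: Q0|left].
Qed.

Lemma S0 : S 0 = 0.
Proof.
have [QS [//|SP]] := S_cases Q0.
apply: H2dot_self_eq0; first exact: Q_H2.
rewrite SP//; have -> : Defs.shift (0 : R[i] -> E) = 0.
  by apply/funext => z; rewrite /Defs.shift scaler0.
exact: H2dot0l.
Qed.

Lemma Q_iter n f : Q f -> Q (iter n S f).
Proof. by move=> Qf; elim: n => //= n IH; have [] := S_cases IH. Qed.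

Lemma S_iter_cases n f : Q f -> iter n S f = 0 \/ forall h, Q h ->
  H2dot dot (iter n S f) h = l2dot dot (coef f) (lshiftn n (coef h)).
Proof.
move=> Qf; elim: n => [|n [IH|IH]].
- right=> h _; rewrite /H2dot /=; congr (l2dot dot _ _).
  by apply/funext => k; rewrite /lshiftn addn0.
- by left; rewrite iterS IH S0.
rewrite iterS; have [_ [->|SP]] := S_cases (Q_iter n Qf); [by left|right=> h Qh].
rewrite SP// /H2dot (H2_shift (Q_H2 (Q_iter n Qf))).2.
rewrite -/(l2dot dot (rshift (coef (iter n S f))) (coef h)) l2dot_rshift.
have [QB cB] := Q_backward_shift Qh; have := IH _ QB.
by rewrite /H2dot cB lshiftnS.
Qed.

Lemma l2norm_coef0 : l2norm (coef (0 : R[i] -> E)) = 0.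
Proof.
have [_ ->] := @H2_0 R E.
by rewrite /l2norm (@l2sq_finite _ _ _ 0)// big_nil sqrtr0.
Qed.

Lemma l2norm_S_iter n f (X : R) : Q f -> 0 <= X ->
  rnorm (l2dot dot (coef f) (lshiftn n (coef (iter n S f)))) <=
    X * l2norm (coef (iter n S f)) ->
  l2norm (coef (iter n S f)) <= X.
Proof.
move=> Qf X0 le_X; have [->|SP] := S_iter_cases n Qf.
  by rewrite l2norm_coef0.
have Qu := Q_iter n Qf; move: le_X (SP _ Qu); set u := iter n S f => le_X.
have lu := H2_l2 (Q_H2 Qu).
rewrite /H2dot -/(l2dot dot (coef u) (coef u)) (l2dot_self dot_norm lu) => uE.
move: le_X; rewrite -uE rnorm_real -(sqr_l2norm lu) ger0_norm ?sqr_ge0// expr2.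
have [u0|u0] := eqVneq (l2norm (coef u)) 0; first by rewrite u0.
by rewrite ler_pM2r// lt_neqAle eq_sym u0 sqrtr_ge0.
Qed.

Lemma l2norm_S_iter_le n f : Q f -> l2norm (coef (iter n S f)) <= l2norm (coef f).
Proof.
move=> Qf; have lf := H2_l2 (Q_H2 Qf); have lu := H2_l2 (Q_H2 (Q_iter n Qf)).
apply: l2norm_S_iter => //; first exact: sqrtr_ge0.
apply: le_trans (l2_cauchy_schwarz dot_norm lf (l2_lshiftn lu)) _.
by rewrite ler_wpM2l ?sqrtr_ge0//; exact: l2norm_lshiftn.
Qed.

(** In the terminology of Sz.-Nagy and Foias, [S] is of class C_{0.}. *)
Lemma S_iter_small f (e : R) : Q f -> 0 < e ->
  exists n, l2norm (coef (iter n S f)) <= e.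
Proof.
move=> Qf e0; have [n nP] := Q_tail_small (Q_H2 Qf) e0; exists n.
apply: l2norm_S_iter => //; first exact: ltW.
by apply: nP => //; exact: Q_iter.
Qed.

Section FixedPoint.
Variable T : (R[i] -> E) -> R[i] -> E.
Hypothesis T_bounded : bounded_operator_on dot Q T.

Lemma T0 : T 0 = 0.
Proof.
have [_ /(_ 1 0 0 Q0 Q0) TE _] := T_bounded; move: TE.
rewrite !scale1r addr0 => /eqP; rewrite -subr_eq subrr eq_sym => /eqP; exact.
Qed.

(** An equality when [T (S f)] is in the domain of the adjoint; otherwise [T f] is
    the default value [0]. *)
Lemma adjoint_step f h : Q f -> Q h -> adjoint_on dot Q S (T (S f)) = T f ->
  rnorm (H2dot dot h (T f)) <= rnorm (H2dot dot (S h) (T (S f))).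
Proof.
move=> Qf Qh; rewrite /adjoint_on; case: xgetP => [g gE [Qg gP] gT|_ <-].
  by rewrite gP// gT.
by rewrite H2dot0r rnorm0 rnorm_ge0.
Qed.

Theorem fixed_point_eq0 :
  (forall f, Q f -> adjoint_on dot Q S (T (S f)) = T f) ->
  forall f, Q f -> T f = 0.
Proof.
move=> fixT f Qf; have [TQ _ [B BP]] := T_bounded.
have iter_le n h : Q h -> rnorm (H2dot dot h (T f)) <=
    rnorm (H2dot dot (iter n S h) (T (iter n S f))).
  move=> Qh; elim: n => [//|n IH]; apply: le_trans IH _; rewrite !iterS.
  apply: adjoint_step; [exact: Q_iter|exact: Q_iter|].
  by apply: fixT; exact: Q_iter.
have T_le u : Q u -> l2norm (coef (T u)) <= `|B| * l2norm (coef u).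
  move=> Qu; have := BP u Qu.
  rewrite !(H2norm_l2norm dot_norm); [|exact: Q_H2|exact/Q_H2/TQ].
  rewrite -rmorphM lecR => /le_trans; apply.
  by rewrite ler_wpM2r ?sqrtr_ge0// ler_norm.
have Tf := TQ f Qf; apply: H2dot_self_eq0; first exact: Q_H2.
apply/eqP; rewrite -rnorm_eq0 eq_le rnorm_ge0 andbT.
apply/ler_addgt0Pl => e e0; rewrite addr0.
set h := T f in Tf *; pose c := l2norm (coef h) * `|B| + 1.
have c0 : 0 < c by rewrite ltr_wpDl// mulr_ge0 ?sqrtr_ge0.
have [n nP] := S_iter_small Qf (divr_gt0 e0 c0).
apply: le_trans (iter_le n h Tf) _.
have Qu := Q_iter n Qf; have Qv := Q_iter n Tf.
have lu := H2_l2 (Q_H2 (TQ _ Qu)); have lv := H2_l2 (Q_H2 Qv).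
apply: le_trans (l2_cauchy_schwarz dot_norm lv lu) _.
apply: le_trans (_ : l2norm (coef h) * (`|B| * (e / c)) <= _).
  apply: ler_pM; rewrite ?sqrtr_ge0//; first exact: l2norm_S_iter_le.
  by apply: le_trans (T_le _ Qu) _; rewrite ler_wpM2l.
rewrite !mulrA ler_pdivrMr// mulrC ler_wpM2l ?(ltW e0)//.
by rewrite /c lerDl.
Qed.

Theorem zero_is_fixed_point : (forall f, Q f -> T f = 0) ->
  forall f, Q f -> adjoint_on dot Q S (T (S f)) = T f.
Proof.
move=> Tz f Qf; rewrite (Tz f Qf) (Tz (S f)); last by have [] := S_cases Qf.
rewrite /adjoint_on; case: xgetP => [g gE [Qg gP]|//].
apply: H2dot_self_eq0; first exact: Q_H2.
by rewrite -gP// H2dot0r.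
Qed.

End FixedPoint.

End ModelSpace.

(** * The theorem *)

Theorem proposition5p5 (R : realType) (E : completeNormedModType R[i])
    (dot : {dot E for @Num.conj R[i]}) (dot_norm : induces_norm dot)
    (Theta : R[i] -> {linear E -> E}) (Theta_inner : inner_multiplier Theta)
    (T : (R[i] -> E) -> (R[i] -> E))
    (T_bounded : bounded_operator_on dot (Qspace dot Theta) T)
    (Theta_invertible : ae_invertible_boundary Theta) :
  let Q := Qspace dot Theta in
  let S := model_operator dot Theta in
  (forall f, Q f -> adjoint_on dot Q S (T (S f)) = T f) <->
  (forall f, Q f -> T f = 0).
Proof.
case: (Theta_inner) => hol inner.
have [M M0 ThetaM] := Hinfty_bound hol.
have [Th ThM ThT] := Hinfty_coefs dot_norm hol M0 ThetaM.
have [Ad AdP] := Hinfty_adjoint_coefs dot_norm M0 ThM ThT.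
split.
  exact: (fixed_point_eq0 dot_norm M0 ThetaM ThM ThT AdP inner Theta_invertible).
exact: (zero_is_fixed_point dot_norm).
Qed.
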